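(* Let $s\in\{s_1,\dots,s_m\}$ be an interior knot of $p_0$. Then there exists a unique minimizer of $$\Phi^{\le s}(g)=\frac12\sum_{k=0}^s(g(k)-\mathbb W(k))^2$$ over $\mathcal C^{\le s}(\mathcal K)$, the set of vectors $g=(g(0),\dots,g(s))\in\mathbb R^{s+1}$ that are convex on $\{s_j,\dots,s_{j+1}\}$ for every $j\in\{0,\dots,m\}$ with $s_{j+1}\le s$. This minimizer equals $(\hat g(0),\dots,\hat g(s))$ if and only if $\widehat{\mathbb G}(s)=\mathbb U(F_{p_0}(s))$. Moreover, $\sqrt n\big(\hat p_n(0)-p_0(0),\dots,\hat p_n(s)-p_0(s)\big)$ converges in distribution to the minimizer of $\Phi^{\le s}$ over $\mathcal C^{\le s}(\mathcal K)$ if and only if $F_{\hat p_n}(s)=F_{p_n}(s)+o_p(n^{-1/2})$.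
   Context: Let $\mathbb N=\{0,1,\dots\}$. For a real sequence $p$ and $k\ge1$ let $\Delta p(k)=p(k+1)-2p(k)+p(k-1)$; $p$ is convex if $\Delta p(k)\ge0$ for all $k\ge1$; $\mathcal C$ is the set of convex sequences with $\sum_kp(k)^2<\infty$. A knot of $p$ is an integer $k\ge1$ with $\Delta p(k)>0$. For a sequence $p$ let $F_p(k)=\sum_{j=0}^kp(j)$ ($F_p(-1)=0$). Let $p_0$ be a convex probability mass function on $\mathbb N$ with finite support $\{0,\dots,S\}$, $S\ge1$. Let $X_1,X_2,\dots$ be i.i.d. with pmf $p_0$, $p_n(j)=\frac1n\sum_{i\le n}\mathbb 1\{X_i=j\}$, and let $\hat p_n$ be the unique minimizer over $\mathcal C$ of $\frac12\sum_j(p_n(j)-p(j))^2$. Let $\mathbb U$ be a standard Brownian bridge on $[0,1]$, $\mathbb W(k)=\mathbb U(F_{p_0}(k))-\mathbb U(F_{p_0}(k-1))$ for $k\in\{0,\dots,S+1\}$. Let $s_1<\dots<s_m$ ($m\ge1$) be the knots of $p_0$ in $\{1,\dots,S\}$, $s_0=0$, $s_{m+1}=S+1$, $\mathcal K=\{s_1,\dots,s_m\}$. A vector $g$ is convex on $\{a,\dots,b\}$ if $g(k+1)-2g(k)+g(k-1)\ge0$ for $a<k<b$; $\mathcal C(\mathcal K)$ is the set of $g\in\mathbb R^{S+2}$ (indexed $0,\dots,S+1$) convex on $\{s_j,\dots,s_{j+1}\}$ for all $j=0,\dots,m$. Let $\hat g$ be the unique minimizer over $\mathcal C(\mathcal K)$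 of $\frac12\sum_{k=0}^{S+1}(g(k)-\mathbb W(k))^2$, and $\widehat{\mathbb G}(x)=\sum_{k=0}^x\hat g(k)$. The first two assertions hold for each realization of $\mathbb U$. *)

(* Defs.v *)
From HB Require Import structures.
From mathcomp Require Import all_boot all_order all_algebra.
From mathcomp Require Import all_classical all_reals all_analysis.
Set Implicit Arguments. Unset Strict Implicit. Unset Printing Implicit Defensive.
Import Order.TTheory GRing.Theory Num.Theory.
Import numFieldNormedType.Exports.
Local Open Scope classical_set_scope.
Local Open Scope ring_scope.

Section Defs.
Variable R : realType.

(* second difference  Δp(k) = p(k+1) - 2 p(k) + p(k-1), meaningful for k >= 1 *)
Definition Delta (p : nat -> R) (k : nat) : R := p k.+1 - 2 * p k + p k.-1.

Definition Fcum (p : nat -> R) (k : nat) : R := \sum_(j < k.+1) p j.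

Definition convex_pmf_support (p0 : nat -> R) (S : nat) : Prop :=
  [/\ (1 <= S)%N,
      (forall k, (k <= S)%N -> 0 < p0 k),
      (forall k, (S < k)%N -> p0 k = 0),
      \sum_(k < S.+1) p0 k = 1 &
      (forall k, (1 <= k)%N -> 0 <= Delta p0 k)].

Definition knots (p0 : nat -> R) (S : nat) : seq nat :=
  [seq k <- iota 1 S | 0 < Delta p0 k].

Definition ext_knots (p0 : nat -> R) (S : nat) : seq nat :=
  0%N :: rcons (knots p0 S) S.+1.

Definition nknots (p0 : nat -> R) (S : nat) : nat := size (knots p0 S).

Definition sk (p0 : nat -> R) (S : nat) (j : nat) : nat := nth 0%N (ext_knots p0 S) j.

Definition convex_on (g : nat -> R) (a b : nat) : Prop :=
  forall k, (a < k)%N -> (k < b)%N -> 0 <= Delta g k.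

(* C(K): vectors g = (g(0),...,g(S+1)) (encoded as nat -> R, only indices
   0..S+1 matter) convex on {s_j,...,s_{j+1}} for all j = 0..m *)
Definition in_CK (p0 : nat -> R) (S : nat) (g : nat -> R) : Prop :=
  forall j, (j <= nknots p0 S)%N -> convex_on g (sk p0 S j) (sk p0 S j.+1).

Definition in_CK_le (p0 : nat -> R) (S s : nat) (g : nat -> R) : Prop :=
  forall j, (j <= nknots p0 S)%N -> (sk p0 S j.+1 <= s)%N ->
    convex_on g (sk p0 S j) (sk p0 S j.+1).

(* W(k) = U(F_{p0}(k)) - U(F_{p0}(k-1)), F_{p0}(-1) = 0 *)
Definition Wvec (p0 : nat -> R) (U : R -> R) (k : nat) : R :=
  U (\sum_(j < k.+1) p0 j) - U (\sum_(j < k) p0 j).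

Definition Phi (S : nat) (W g : nat -> R) : R :=
  2^-1 * \sum_(k < S.+2) (g k - W k) ^+ 2.

Definition Phi_le (s : nat) (W g : nat -> R) : R :=
  2^-1 * \sum_(k < s.+1) (g k - W k) ^+ 2.

Definition is_min_CK (p0 : nat -> R) (S : nat) (W g : nat -> R) : Prop :=
  in_CK p0 S g /\ forall h, in_CK p0 S h -> Phi S W g <= Phi S W h.

Definition is_min_CK_le (p0 : nat -> R) (S s : nat) (W g : nat -> R) : Prop :=
  in_CK_le p0 S s g /\ forall h, in_CK_le p0 S s h -> Phi_le s W g <= Phi_le s W h.

Definition eq_upto (s : nat) (g h : nat -> R) : Prop :=
  forall k, (k <= s)%N -> g k = h k.

Definition in_C (p : nat -> R) : Prop :=
  (forall k, (1 <= k)%N -> 0 <= Delta p k) /\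
  (\sum_(0 <= k <oo) ((p k) ^+ 2)%:E < +oo)%E.

(* 1/2 sum_j (q(j) - p(j))^2 (as an extended real; finite on C) *)
Definition LS_crit (q p : nat -> R) : \bar R :=
  (\sum_(0 <= k <oo) ((2^-1 * (q k - p k) ^+ 2)%:E))%E.

Definition is_LSE (q p : nat -> R) : Prop :=
  in_C p /\ forall p', in_C p' -> (LS_crit q p <= LS_crit q p')%E.

(* empirical pmf p_n(j) = (1/n) #{i <= n : X_i = j} (indices shifted to 0..n-1) *)
Definition emp_pmf (T : Type) (X : nat -> T -> nat) (n : nat) (w : T) (j : nat) : R :=
  (\sum_(i < n) ((X i w == j) : nat)%:R) / n%:R.

Definition bridge_path (u : R -> R) : Prop :=
  [/\ u 0 = 0, u 1 = 0 & {within `[0, 1], continuous u}].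

Definition centered_normal_law (v : R) (A : set R) : \bar R :=
  if v == 0 then (\1_A (0 : R))%:E else normal_prob 0 (Num.sqrt v) A.

(* U is a standard Brownian bridge on [0,1] under Q: continuous paths pinned
   at 0 and 1, and centered Gaussian finite-dimensional distributions with
   covariance min(t,t') - t t' (every finite linear combination is normal) *)
Definition brownian_bridge d (T : measurableType d) (Q : probability T R)
    (U : T -> R -> R) : Prop :=
  [/\ (forall w, bridge_path (U w)),
      (forall t, measurable_fun setT (fun w => U w t)) &
      (forall (n : nat) (t c : 'I_n -> R), (forall i, 0 <= t i <= 1) ->
        forall A : set R, measurable A ->
        Q ((fun w => \sum_(i < n) c i * U w (t i)) @^-1` A) =
        centered_normal_law
          (\sum_(i < n) \sum_(i' < n) c i * c i' * (Num.min (t i) (t i') - t i * t i'))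
          A)].

Definition iid_pmf d (T : measurableType d) (P : probability T R)
    (X : nat -> T -> nat) (p0 : nat -> R) : Prop :=
  (forall i j, measurable (X i @^-1` [set j])) /\
  (forall (n : nat) (a : nat -> nat),
    P [set w | forall i, (i < n)%N -> X i w = a i] = (\prod_(i < n) p0 (a i))%:E).

Definition cvg_in_dist d (T : measurableType d) (P : probability T R)
    d' (T' : measurableType d') (Q : probability T' R) (k : nat)
    (Y : nat -> T -> 'rV[R]_k) (Z : T' -> 'rV[R]_k) : Prop :=
  forall f : 'rV[R]_k -> R, continuous f -> (exists M, forall x, `|f x| <= M) ->
    (fun n => \int[P]_w (f (Y n w))%:E)%E @ \oo --> (\int[Q]_w (f (Z w))%:E)%E.

Definition op_sqrt_n d (T : measurableType d) (P : probability T R)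
    (V : nat -> T -> R) : Prop :=
  forall eps : R, 0 < eps ->
    (fun n => P [set w | eps < `| Num.sqrt (n%:R) * V n w |]) @ \oo --> 0%E.

End Defs.

(* Main.v *)
(* The least squares problems over the cones are projections, so their solutions are characterised
   by variational inequalities and depend on the data in a nonexpansive way. Adding constants to g
   is allowed, hence the minimizer over {0, ..., s} has the same total mass as W, namely U(F(s));
   conversely, if g-hat has that mass, then extending a competitor on {0, ..., s} by g-hat shifted
   by a constant gives a competitor on {0, ..., S+1}.

   For the limit theorem, let A_n be the rescaled empirical fluctuations, Y_n the rescaled
   estimation error on {0, ..., s} and V_n >= 0 the rescaled gap F_{p-hat}(s) - F_{p_n}(s), so that
   the sums over {0, ..., s} satisfy sum Y_n = sum A_n + V_n. When the empirical pmf is close to p0,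
   the estimator is strictly curved at s, and comparing it with the candidate built from the
   projection g_n of A_n onto the cone gives |Y_n - g_n| <= V_n. So V_n -> 0 yields the convergence
   of Y_n. Conversely, convergence of Y_n forces sum A_n and sum A_n + V_n to have the same limit
   law, and since V_n >= 0 this is only possible if V_n -> 0.

   The multinomial central limit theorem is obtained for cosines of linear forms by comparing
   characteristic functions and extended to continuous functions by approximation with
   trigonometric polynomials. Since the estimator is determined by the sample, all integrals over P
   are finite sums over words in the alphabet {0, ..., S}. *)
Require Import Defs.
From HB Require Import structures.
From mathcomp Require Import all_boot all_order all_algebra.
From mathcomp Require Import all_classical all_reals all_analysis.
From mathcomp Require Import measurable_realfun.
From mathcomp Require Import ring lra zify.
Set Implicit Arguments.
Unset Strict Implicit.
Unset Printing Implicit Defensive.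
Import Order.TTheory GRing.Theory Num.Theory.
Import numFieldNormedType.Exports.
Local Open Scope classical_set_scope.
Local Open Scope ring_scope.

(** * Characteristic function of the centered normal law *)

Section CharNormal.
Variable R : realType.
Notation mu := (@lebesgue_measure R).

(** The bound |Y_n - g_n| <= V_n adds two variational inequalities. The estimator is tested against
    p0 + g_n / sqrt n on {0, ..., s}, shifted by a constant so as to meet the estimator at s; the
    projection is tested against Y_n, which lies in the cone because p0 has zero second difference
    off its knots. With X = |Y_n - g_n|^2 and e = g_n(s) - Y_n(s) the sum reads X + e V_n <= 0,
    where e V_n is the price of the shift; as e^2 <= X, this gives X <= V_n^2. Measurability has to
    be derived: for the estimator it follows from uniqueness, which makes it a function of finitely
    many observations; for the limit it follows from continuity of the projection, since a
    continuous function of W is a pointwise limit of trigonometric polynomials. Such polynomials are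
    accurate only on a cube, so tightness is needed on both sides: second moments for the sample,
    continuity from above for the bridge. *)

Lemma is_derive_normal_pdf (s x : R) : s != 0 ->
  is_derive x 1 (normal_pdf 0 s) (- (x / s ^+ 2) * normal_pdf 0 s x).
Proof.
move=> s0; rewrite normal_pdfE// /normal_fun.
have h : is_derive x 1 (fun x : R => - (x - 0) ^+ 2 / (s ^+ 2 *+ 2)) (- (x / s ^+ 2)).
  rewrite [X in is_derive _ _ X](_ : _ = (fun x => (- (s ^+ 2 *+ 2)^-1) *: (x ^+ 2))); last first.
    by apply/funext => y; rewrite /GRing.scale/= subr0 mulrC mulNr mulrN.
  apply: is_derive_eq.
  rewrite /GRing.scale/= !mulr1.
  by field.
have h2 := is_derive1_comp (is_derive_expR _) h.
have h3 := is_deriveZ (normal_peak s) h2.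
apply: is_derive_eq.
by rewrite /GRing.scale/=; ring.
Qed.

Lemma integrable_cvg_itv (f : R -> R) : mu.-integrable [set: R] (EFin \o f) ->
  (fun n : nat => \int[mu]_(x in `[(- n%:R)%R, n%:R]) (f x)%:E)%E @ \oo
    --> (\int[mu]_x (f x)%:E)%E.
Proof.
move=> fi.
pose fn (n : nat) : R -> \bar R := (EFin \o f) \_ `[- n%:R, n%:R].
have mf := measurable_int _ fi.
have mfn (n : nat) : measurable_fun [set: R] (fn n).
  apply/(measurable_restrictT _ _).1.
    by exact: measurable_itv.
  exact: measurable_funTS.
have H : {ae mu, forall x, [set: R] x -> fn ^~ x @ \oo --> (f x)%:E}.
  apply: aeW => x _.
  apply: cvg_near_cst; near=> n.
  rewrite /fn patchE ifT// mem_set//= in_itv/= -ler_norml.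
  by apply: ltW; near: n; exact: nbhs_infty_gtr.
have fn_le : {ae mu, forall x (n : nat), [set: R] x -> (`|fn n x| <= (`| f x |)%:E)%E}.
  apply: aeW => x n _; rewrite /fn patchE; case: ifPn => // _.
  by rewrite (_ : point = 0%E)// abse0 lee_fin.
have fi' : mu.-integrable [set: R] (fun x => (`| f x |)%:E) by exact: integrable_norm.
have [_ _] := @dominated_convergence _ _ _ mu setT measurableT fn (EFin \o f) _
  mfn mf H fi' fn_le.
move=> h; apply: cvg_trans h; apply: near_eq_cvg; near=> n.
by rewrite /= /fn -integral_mkcond.
Unshelve. all: by end_near. Qed.

(** The fundamental theorem of calculus on [-n, n] leaves boundary terms of order 1/n. Bounds at the
    integers suffice, since integrability already gives convergence along these intervals. *)
Lemma integral_derive_eq0 (F f : R -> R) (C : R) :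
  (forall x : R, is_derive x (1 : R) F (f x)) -> continuous f ->
  mu.-integrable [set: R] (EFin \o f) ->
  (forall n : nat, `|F n%:R| <= C * n.+1%:R^-1) ->
  (forall n : nat, `|F (- n%:R)| <= C * n.+1%:R^-1) ->
  \int[mu]_x f x = 0.
Proof.
move=> dF cf fi FC FNC.
have cF : continuous F.
  move=> x; apply: differentiable_continuous; apply/derivable1_diffP.
  exact: ex_derive.
have L := integrable_cvg_itv fi.
have E n : (0 < n)%N -> (\int[mu]_(x in `[(- n%:R)%R, n%:R]) (f x)%:E = (F n%:R - F (- n%:R))%:E)%E.
  move=> n0; apply: continuous_FTC2.
  - by rewrite -subr_gt0 opprK -natrD ltr0n addn_gt0 n0.
  - by apply: continuous_subspaceT.
  - split.
    + by move=> x _; exact: ex_derive.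
    + exact/cvg_at_right_filter/cF.
    + exact/cvg_at_left_filter/cF.
  - by move=> x _; rewrite derive1E; exact: derive_val.
have fin : (\int[mu]_x (f x)%:E)%E \is a fin_num by exact: integrable_fin_num.
have L2 : (fun n : nat => F n%:R - F (- n%:R)) @ \oo --> \int[mu]_x f x.
  suff /fine_cvgP[_] : (fun n : nat => (F n%:R - F (- n%:R))%:E) @ \oo --> (\int[mu]_x f x)%:E by [].
  rewrite /Rintegral fineK//.
  apply: cvg_trans L; apply: near_eq_cvg; near=> n.
  by rewrite /= E//; near: n; exists 1%N.
have L3 : (fun n : nat => F n%:R - F (- n%:R)) @ \oo --> (0 : R).
  apply: norm_cvg0.
  apply: (@squeeze_cvgr _ _ _ _ (cst 0) (fun n => (2 * C) * @harmonic R n)).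
  - near=> n; rewrite normr_ge0/= /harmonic (le_trans (ler_normB _ _))//.
    have := FC n; have := FNC n; rewrite -(mulrA 2).
    by move: (C / _) => k; lra.
  - exact: cvg_cst.
  - by rewrite -[X in _ --> X](mulr0 (2 * C)); apply: cvgMr; exact: cvg_harmonic.
exact: (cvg_unique _ L2 L3).
Unshelve. all: by end_near. Qed.

(** From [1 + y <= expR y] with y = n^2 / (2 s^2): the product (1 + y)(2 + 2 s^2) = 2 + 2 s^2 + n^2
    + n^2 / s^2 dominates n + 1, whence the constant. *)
Lemma normal_pdf_decay (s : R) : s != 0 -> exists2 C : R, 0 <= C &
  forall n : nat, normal_pdf 0 s n%:R <= C * n.+1%:R^-1
    /\ normal_pdf 0 s (- n%:R) <= C * n.+1%:R^-1.
Proof.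
move=> s0; have s2 : 0 < s ^+ 2 by rewrite exprn_even_gt0.
exists (normal_peak s * (2 + 2 * s ^+ 2)).
  by rewrite mulr_ge0 ?normal_peak_ge0//; lra.
move=> n; suff h : expR (- n%:R ^+ 2 / (s ^+ 2 *+ 2)) <= (2 + 2 * s ^+ 2) * n.+1%:R^-1.
  by rewrite !normal_pdfE// /normal_fun !subr0 sqrrN; split; rewrite -mulrA ler_wpM2l ?normal_peak_ge0.
have hy := @expR_ge1Dx R (n%:R ^+ 2 / (s ^+ 2 *+ 2)).
rewrite mulNr expRN ler_pdivlMr ?ltr0n// ler_pdivrMl ?expR_gt0//.
apply: (@le_trans _ _ ((1 + n%:R ^+ 2 / (s ^+ 2 *+ 2)) * (2 + 2 * s ^+ 2))); last first.
  by rewrite ler_wpM2r//; lra.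
have -> : (1 + n%:R ^+ 2 / (s ^+ 2 *+ 2)) * (2 + 2 * s ^+ 2) = 2 + 2 * s ^+2 + n%:R ^+ 2 + n%:R ^+ 2 / s ^+ 2.
  by rewrite -mulr_natr; field.
rewrite -natr1.
have : 0 <= n%:R ^+ 2 / s ^+ 2 by rewrite divr_ge0 ?sqr_ge0.
have := sqr_ge0 (n%:R - 1 / 2 : R).
nra.
Qed.

Lemma integrable_norm_normal_pdf (s : R) : s != 0 ->
  mu.-integrable [set: R] (EFin \o (fun x => `|x| * normal_pdf 0 s x)).
Proof.
move=> s0; have s2 : 0 < s ^+ 2 by rewrite exprn_even_gt0.
(* Doubling the variance leaves room for the factor |x|: with y = x^2 / (4 s^2) the original density
   contains [expR (- y)] twice, and one copy absorbs |x| <= 1 + x^2 = 1 + 4 s^2 y. *)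
pose s' := Num.sqrt 2 * s.
have s'0 : s' != 0 by rewrite mulf_neq0// sqrtr_eq0 -ltNge.
pose C := (1 + 4 * s ^+ 2) * normal_peak s / normal_peak s'.
apply: (@le_integrable _ _ _ mu _ measurableT _ (EFin \o (fun x => C * normal_pdf 0 s' x))).
- have m : measurable_fun [set: R] (fun x => `|x| * normal_pdf 0 s x).
    by apply: measurable_funM; [apply: continuous_measurable_fun; exact: norm_continuous|exact: measurable_normal_pdf].
  exact/measurable_EFinP.
- move=> x _; rewrite /= lee_fin.
  have C0 : 0 <= C.
    apply: mulr_ge0; last by rewrite invr_ge0 normal_peak_ge0.
    by apply: mulr_ge0; [lra|exact: normal_peak_ge0].
  rewrite [leLHS]ger0_norm ?mulr_ge0 ?normal_pdf_ge0//.
  rewrite [leRHS]ger0_norm; last exact: mulr_ge0 C0 (normal_pdf_ge0 _ _ _).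
  rewrite !normal_pdfE// /C /normal_fun subr0.
  have -> : (s' ^+ 2 *+ 2) = (s ^+ 2 *+ 2) * 2.
    by rewrite /s' exprMn sqr_sqrtr// ; ring.
  set y := x ^+ 2 / ((s ^+ 2 *+ 2) * 2).
  have -> : - x ^+ 2 / (s ^+ 2 *+ 2) = - y - y.
    by rewrite /y ; field.
  rewrite expRD mulNr -/y.
  have -> : (1 + 4 * s ^+ 2) * normal_peak s / normal_peak s' * (normal_peak s' * expR (- y)) =
     (1 + 4 * s ^+ 2) * (normal_peak s * expR (- y)).
    by field; rewrite gt_eqF// normal_peak_gt0.
  rewrite mulrCA (mulrC `|x|) -!mulrA (mulrC (1 + _)) -!mulrA.
  rewrite ler_wpM2l ?normal_peak_ge0// ler_wpM2l ?expR_ge0//.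
  rewrite expRN ler_pdivrMl ?expR_gt0//.
  have y0 : 0 <= y by rewrite divr_ge0 ?sqr_ge0// mulr_ge0// mulrn_wge0// sqr_ge0.
  have hy := @expR_ge1Dx R y.
  have xy : x ^+ 2 = 4 * s ^+ 2 * y by rewrite /y ; field.
  have : `|x| <= 1 + x ^+ 2.
    have := sqr_ge0 (`|x| - 1); rewrite -(real_normK (num_real x)).
    by have := normr_ge0 x; nra.
  rewrite xy; nra.
- rewrite /comp; under eq_fun do rewrite EFinM.
  by apply: integrableZl => //; exact: integrable_normal_pdf.
Qed.

Lemma bounded_trig_integrable (g h : R -> R) :
  mu.-integrable [set: R] (EFin \o g) -> measurable_fun [set: R] h ->
  (forall x, `|h x| <= 1) -> mu.-integrable [set: R] (EFin \o (fun x => h x * g x)).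
Proof.
move=> gi mh h1.
apply: (@le_integrable _ _ _ mu _ measurableT _ (EFin \o g)) => //.
- have mg : measurable_fun [set: R] g by apply/measurable_EFinP; exact: (measurable_int _ gi).
  by apply/measurable_EFinP; exact: measurable_funM.
- by move=> x _; rewrite /= lee_fin normrM ler_piMl.
Qed.

Lemma continuous_affine_cos (t th : R) : continuous (fun x : R => cos (t * x + th)).
Proof.
move=> x; apply: (continuous_comp (f := fun x => t * x + th) (g := cos)); last exact: continuous_cos.
by apply: cvgD; [apply: cvgMr|]; [exact: cvg_id|exact: cvg_cst].
Qed.

Lemma continuous_affine_sin (t th : R) : continuous (fun x : R => sin (t * x + th)).
Proof.
move=> x; apply: (continuous_comp (f := fun x => t * x + th) (g := sin)); last exact: continuous_sin.
by apply: cvgD; [apply: cvgMr|]; [exact: cvg_id|exact: cvg_cst].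
Qed.

Lemma integrable_cos_normal_pdf (s t th : R) :
  mu.-integrable [set: R] (EFin \o (fun x => cos (t * x + th) * normal_pdf 0 s x)).
Proof.
apply: bounded_trig_integrable.
- exact: integrable_normal_pdf.
- by apply: continuous_measurable_fun; exact: continuous_affine_cos.
- by move=> x; exact: cos_max.
Qed.

Lemma integrable_xsin_normal_pdf (s t th : R) : s != 0 ->
  mu.-integrable [set: R] (EFin \o (fun x => x * sin (t * x + th) * normal_pdf 0 s x)).
Proof.
move=> s0.
apply: (le_integrable measurableT _ _ (integrable_norm_normal_pdf s0)).
- apply/measurable_EFinP; apply: measurable_funM; last exact: measurable_normal_pdf.
  apply: measurable_funM => //; apply: continuous_measurable_fun; exact: continuous_affine_sin.
- move=> x _; rewrite /= lee_fin !normrM normr_id ler_wpM2r ?normr_ge0//.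
  by rewrite ler_piMr//; exact: sin_max.
Qed.

Lemma is_derive_affine_sin (t th x : R) :
  is_derive x 1 (fun x => sin (t * x + th)) (t * cos (t * x + th)).
Proof.
have h : is_derive x 1 (fun x : R => t *: x + th) t.
  by apply: is_derive_eq; rewrite /GRing.scale/= mulr1 addr0.
have h2 := is_derive1_comp (is_derive_sin _) h.
by apply: is_derive_eq; rewrite /GRing.scale/= mulrC.
Qed.

Lemma is_derive_affine_cos (t th x : R) :
  is_derive t 1 (fun t => cos (t * x + th)) (- (x * sin (t * x + th))).
Proof.
have h : is_derive t 1 (fun t : R => x *: t + th) x.
  by apply: is_derive_eq; rewrite /GRing.scale/= mulr1 addr0.
have h2 := is_derive1_comp (is_derive_cos _) h.
rewrite [X in is_derive _ _ X](_ : _ = cos \o (fun t : R => x *: t + th)); last first.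
  by apply/funext => y /=; rewrite /GRing.scale/= mulrC.
by apply: is_derive_eq; rewrite /GRing.scale/= (mulrC x t); ring.
Qed.

(** The two sides differ by s^2 times the integral of the derivative of sin(t x + th) times the
    density, a product that decays at infinity. *)
Lemma normal_pdf_by_parts (s t th : R) : s != 0 ->
  \int[mu]_x (x * sin (t * x + th) * normal_pdf 0 s x) =
  t * s ^+ 2 * \int[mu]_x (cos (t * x + th) * normal_pdf 0 s x).
Proof.
move=> s0; have s2 : 0 < s ^+ 2 by rewrite exprn_even_gt0.
pose F x := sin (t * x + th) * normal_pdf 0 s x.
pose f x := t * (cos (t * x + th) * normal_pdf 0 s x) -
  (s ^+ 2)^-1 * (x * sin (t * x + th) * normal_pdf 0 s x).
have [C C0 HC] := normal_pdf_decay s0.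
have i1 := integrable_cos_normal_pdf s t th.
have i2 := @integrable_xsin_normal_pdf s t th s0.
have i1' : mu.-integrable [set: R] (EFin \o (fun x => t * (cos (t * x + th) * normal_pdf 0 s x))).
  by rewrite /comp; under eq_fun do rewrite EFinM; exact: integrableZl.
have i2' : mu.-integrable [set: R] (EFin \o (fun x => (s ^+ 2)^-1 * (x * sin (t * x + th) * normal_pdf 0 s x))).
  by rewrite /comp; under eq_fun do rewrite EFinM; exact: integrableZl.
have h : \int[mu]_x f x = 0.
  apply: (@integral_derive_eq0 F f C).
  - move=> x.
    have a := is_derive_affine_sin t th x; have b := @is_derive_normal_pdf s x s0.
    have c := @is_deriveM _ _ _ _ x 1 _ _ a b.
    apply: is_derive_eq.
    by rewrite /f /GRing.scale/=; field.
  - move=> x; rewrite /f; apply: cvgB; apply: cvgM; try exact: cvg_cst.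
      apply: cvgM; [exact: continuous_affine_cos|exact: continuous_normal_pdf].
    apply: cvgM; last exact: continuous_normal_pdf.
    by apply: cvgM; [exact: cvg_id|exact: continuous_affine_sin].
  - rewrite /comp /f; under eq_fun do rewrite EFinB.
    exact: integrableB.
  - move=> n; rewrite /F normrM [X in _ * X]ger0_norm ?normal_pdf_ge0//.
    by apply: le_trans (HC n).1; rewrite ler_piMl ?normal_pdf_ge0// sin_max.
  - move=> n; rewrite /F normrM [X in _ * X]ger0_norm ?normal_pdf_ge0//.
    by apply: le_trans (HC n).2; rewrite ler_piMl ?normal_pdf_ge0// sin_max.
move: h; rewrite /f RintegralB// !RintegralZl// => /eqP; rewrite subr_eq0 => /eqP h.
by rewrite mulrAC h; field.
Qed.

(** Differentiation under the integral sign, dominated by |x| times the density, followed by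
    integration by parts: the cosine transform solves c' = - s^2 t c. *)
Lemma normal_char_derive (s t th : R) : s != 0 ->
  is_derive t 1 (fun t => \int[mu]_x (cos (t * x + th) * normal_pdf 0 s x))
    (- (t * s ^+ 2 * \int[mu]_x (cos (t * x + th) * normal_pdf 0 s x))).
Proof.
move=> s0.
pose f (t x : R) := cos (t * x + th) * normal_pdf 0 s x.
have df (t' x : R) : is_derive t' (1 : R) (f ^~ x) (- (x * sin (t' * x + th) * normal_pdf 0 s x)).
  have a := is_derive_affine_cos t' th x.
  have b := is_deriveZ (normal_pdf 0 s x) a.
  rewrite [X in is_derive _ _ X](_ : _ = normal_pdf 0 s x \*: (fun t : R => cos (t * x + th))).
    by apply: is_derive_eq; rewrite /GRing.scale/=; ring.
  by apply/funext => y; rewrite /f mulrC.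
have tI : (`]t - 1, t + 1[%classic : set R) t by rewrite /= in_itv/=; lra.
have intf x : (`]t - 1, t + 1[%classic : set R) x -> mu.-integrable [set: R] (EFin \o f x).
  by move=> _; exact: integrable_cos_normal_pdf.
have derf x y : (`]t - 1, t + 1[%classic : set R) x -> [set: R] y -> derivable (f ^~ y) x 1.
  by move=> _ _; case: (df x y).
have d1f x y : partial1of2 f x y = - (y * sin (x * y + th) * normal_pdf 0 s y).
  by rewrite partial1of2E; case: (df x y).
have G0 (y : R) : 0 <= `|y| * normal_pdf 0 s y by rewrite mulr_ge0 ?normal_pdf_ge0.
have Gub x y : (`]t - 1, t + 1[%classic : set R) x -> [set: R] y ->
    `|partial1of2 f x y| <= `|y| * normal_pdf 0 s y.
  move=> _ _; rewrite d1f normrN 2!normrM [X in _ * X <= _]ger0_norm ?normal_pdf_ge0//.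
  rewrite ler_wpM2r ?normal_pdf_ge0// ler_piMr//; exact: sin_max.
apply: DeriveDef.
  exact: (derivable_under_integral measurableT tI intf derf G0 (integrable_norm_normal_pdf s0) Gub).
rewrite -derive1E (differentiation_under_integral measurableT tI intf derf G0 (integrable_norm_normal_pdf s0) Gub).
under eq_Rintegral do rewrite d1f -mulN1r.
by rewrite RintegralZl// ?mulN1r ?normal_pdf_by_parts//; exact: integrable_xsin_normal_pdf.
Qed.

(** By the differential equation, the transform times exp(t^2 s^2 / 2) is constant in t. The phase
    [th] lets one real identity carry both the cosine and the sine part of the characteristic
    function. *)
Lemma normal_char (s t th : R) : s != 0 ->
  \int[mu]_x (cos (t * x + th) * normal_pdf 0 s x) =
  expR (- (t ^+ 2 * s ^+ 2 / 2)) * cos th.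
Proof.
move=> s0.
pose c t := \int[mu]_x (cos (t * x + th) * normal_pdf 0 s x).
pose E (t : R) := expR (t ^+ 2 * s ^+ 2 / 2).
have dE (t' : R) : is_derive t' (1 : R) E (t' * s ^+ 2 * E t').
  have h : is_derive t' 1 (fun t : R => (s ^+ 2 / 2) *: (t ^+ 2)) (t' * s ^+ 2).
    by apply: is_derive_eq; rewrite /GRing.scale/= !mulr1; field.
  have h2 := is_derive1_comp (is_derive_expR _) h.
  rewrite [X in is_derive _ _ X](_ : _ = expR \o (fun t : R => (s ^+ 2 / 2) *: (t ^+ 2))); last first.
    by apply/funext => y /=; rewrite /E /GRing.scale/=; congr expR; ring.
  apply: is_derive_eq; rewrite /GRing.scale/= mulrC /E; congr (_ * expR _).
  by rewrite /GRing.scale/=; ring.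
have d0 (t' : R) : is_derive t' (1 : R) (c * E) 0.
  have a := @normal_char_derive s t' th s0.
  have b := @is_deriveM _ _ _ _ t' 1 _ _ a (dE t').
  by apply: is_derive_eq; rewrite /GRing.scale/= -/(c t'); ring.
have := is_derive_0_is_cst t 0 d0.
rewrite /= !fctE /E /c expr0n/= !mul0r expR0 mulr1 expRN => h.
rewrite -[LHS](@mulfK _ (expR (t ^+ 2 * s ^+ 2 / 2))) ?gt_eqF ?expR_gt0// h mulrC; congr (_ * _).
under eq_Rintegral do rewrite mul0r add0r.
rewrite RintegralZl//; last exact: integrable_normal_pdf.
by rewrite /Rintegral integral_normal_pdf mulr1.
Qed.

End CharNormal.

(** * Central limit theorem for cosines *)

Section IteratedExpectation.
Variable R : realType.
Implicit Types (w : nat -> R) (ws : seq (nat -> R)) (K n : nat) (H : seq nat -> R).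

(** Expectation of [H] at a random word with independent letters, one weight function per letter.
    The recursion draws the first letter first, so inductions condition on it. *)
Fixpoint expect K ws H : R :=
  if ws is w :: ws' then \sum_(x < K) w x * expect K ws' (fun l => H (nat_of_ord x :: l))
  else H [::].

Definition weight K w := (forall x, (x < K)%N -> 0 <= w x) /\ \sum_(x < K) w x = 1.

Lemma eq_expect K ws H H' :
  (forall l, size l = size ws -> all (fun x => x < K)%N l -> H l = H' l) ->
  expect K ws H = expect K ws H'.
Proof.
elim: ws H H' => [|w ws IH] H H' e /=; first exact: e.
by apply: eq_bigr => x _; congr (_ * _); apply: IH => l sl al; apply: e; rewrite /= ?sl// ltn_ord.
Qed.

Lemma expectD K ws H H' :
  expect K ws (fun l => H l + H' l) = expect K ws H + expect K ws H'.
Proof.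
elim: ws H H' => [//|w ws IH] H H' /=.
by rewrite -big_split; apply: eq_bigr => x _; rewrite IH mulrDr.
Qed.

Lemma expectZ K ws (c : R) H : expect K ws (fun l => c * H l) = c * expect K ws H.
Proof.
elim: ws H => [//|w ws IH] H /=.
by rewrite mulr_sumr; apply: eq_bigr => x _; rewrite IH mulrCA.
Qed.

Lemma expectB K ws H H' :
  expect K ws (fun l => H l - H' l) = expect K ws H - expect K ws H'.
Proof.
rewrite -mulN1r -expectZ -expectD; apply: eq_expect => l _ _.
by rewrite mulN1r.
Qed.

Lemma expect_sum K ws m (F : nat -> seq nat -> R) :
  expect K ws (fun l => \sum_(k < m) F k l) = \sum_(k < m) expect K ws (F k).
Proof.
elim: m => [|m IH].
  rewrite big_ord0 -[RHS](mul0r (expect K ws (fun _ => 0))) -expectZ.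
  by apply: eq_expect => l _ _; rewrite big_ord0 mul0r.
rewrite big_ord_recr /= -IH -expectD; apply: eq_expect => l _ _.
by rewrite big_ord_recr.
Qed.

Lemma ler_expect K ws H H' : (forall w, List.In w ws -> weight K w) ->
  (forall l, size l = size ws -> all (fun x => x < K)%N l -> H l <= H' l) ->
  expect K ws H <= expect K ws H'.
Proof.
elim: ws H H' => [|w ws IH] H H' wws e /=; first exact: e.
apply: ler_sum => x _; apply: ler_wpM2l; first by apply: (wws w _).1 => //; left.
apply: IH => [w' ?|l sl al]; first by apply: wws; right.
by apply: e; rewrite /= ?sl// ltn_ord.
Qed.

Lemma expect_cst K ws (c : R) : (forall w, List.In w ws -> weight K w) ->
  expect K ws (fun=> c) = c.
Proof.
elim: ws => [//|w ws IH] wws /=.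
rewrite IH; last by move=> w' ?; apply: wws; right.
by rewrite -mulr_suml (wws w _).2 ?mul1r//; left.
Qed.

Lemma ler_norm_expect K ws H : (forall w, List.In w ws -> weight K w) ->
  `|expect K ws H| <= expect K ws (fun l => `|H l|).
Proof.
move=> wws; rewrite ler_norml -[- _]mulN1r -expectZ; apply/andP; split.
  by apply: ler_expect => // l _ _; rewrite mulN1r lerNnormlW.
by apply: ler_expect => // l _ _; rewrite ler_norm.
Qed.

Definition iid_expect K n w H := expect K (nseq n w) H.

Lemma weight_nseq K n w : weight K w -> forall w', List.In w' (nseq n w) -> weight K w'.
Proof. by move=> ww; elim: n => [//|n IH] w' /= [<-|/IH]. Qed.

(** The offset [c] collects the letters already drawn, so that the induction closes; cross terms
    vanish because [f] has mean zero. *)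
Lemma iid_expect_sum_sqr K n w (f : nat -> R) (c : R) : weight K w ->
  \sum_(x < K) w x * f x = 0 ->
  iid_expect K n w (fun l => (c + \sum_(x <- l) f x) ^+ 2) =
  c ^+ 2 + n%:R * \sum_(x < K) w x * f x ^+ 2.
Proof.
move=> ww f0; elim: n c => [|n IH] c.
  by rewrite /iid_expect /= big_nil addr0 mul0r addr0.
rewrite /iid_expect /=.
under eq_bigr => x _.
  rewrite (@eq_expect _ _ _ (fun l => (c + f x + \sum_(y <- l) f y) ^+ 2)); last first.
    by move=> l _ _; rewrite big_cons addrA.
  rewrite -/(iid_expect _ _ _ _) IH.
  over.
rewrite /=.
rewrite (eq_bigr (fun x : 'I_K => w x * (c ^+ 2 + n%:R * \sum_(x < K) w x * f x ^+ 2)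
   + 2 * c * (w x * f x) + w x * f x ^+ 2)); last by move=> x _; ring.
rewrite !big_split /= -mulr_suml ww.2 -mulr_sumr f0 -natr1; ring.
Qed.

(** Telescoping: replacing the average over one letter by multiplication with [rho] costs [eta], and
    powers of [rho] have modulus at most 1. The one-letter bound is uniform in the phase because the
    letters already drawn shift it. *)
Lemma iid_expect_cos K n w (h : nat -> R) (rho eta : R) : weight K w ->
  `|rho| <= 1 ->
  (forall z, `|\sum_(x < K) w x * cos (z + h x) - rho * cos z| <= eta) ->
  forall z, `|iid_expect K n w (fun l => cos (z + \sum_(x <- l) h x)) - rho ^+ n * cos z| <= n%:R * eta.
Proof.
move=> ww r1 hz; elim: n => [|n IH] z.
  by rewrite /iid_expect /= big_nil addr0 mul1r subrr normr0 mul0r.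
rewrite /iid_expect /=.
under eq_bigr => x _.
  rewrite (@eq_expect _ _ _ (fun l => cos (z + h x + \sum_(y <- l) h y))); last first.
    by move=> l _ _; rewrite big_cons addrA.
  rewrite -/(iid_expect _ _ _ _).
  over.
rewrite /=.
have -> : \sum_(x < K) w x * iid_expect K n w (fun l => cos (z + h x + \sum_(y <- l) h y)) - rho ^+ n.+1 * cos z =
  \sum_(x < K) w x * (iid_expect K n w (fun l => cos (z + h x + \sum_(y <- l) h y)) - rho ^+ n * cos (z + h x))
  + rho ^+ n * (\sum_(x < K) w x * cos (z + h x) - rho * cos z).
  under [X in _ = X + _]eq_bigr do rewrite mulrBr mulrCA.
  by rewrite sumrB -mulr_sumr exprSr; ring.
apply: le_trans (ler_normD _ _) _; rewrite -natr1 mulrDl mul1r; apply: lerD.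
  apply: le_trans (ler_norm_sum _ _ _) _.
  have -> : n%:R * eta = (\sum_(x < K) w x) * (n%:R * eta) by rewrite ww.2 mul1r.
  rewrite mulr_suml; apply: ler_sum => x _.
  by rewrite normrM ger0_norm ?ww.1// ler_wpM2l ?ww.1.
rewrite normrM -[leRHS]mul1r; apply: ler_pM => //.
by rewrite normrX exprn_ile1.
Qed.

End IteratedExpectation.

(** * Taylor bounds and the one-dimensional limit for cosines *)

Section CosineTaylor.
Variable R : realType.
Implicit Types h z v B : R.

Lemma mvt_bound (f f' : R -> R) (K h : R) :
  (forall x, is_derive x (1 : R) f (f' x)) ->
  (forall x, `|x| <= `|h| -> `|f' x| <= K) -> `|f h - f 0| <= K * `|h|.
Proof.
move=> df bf.
have cf (A : set R) : {within A, continuous f}.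
  apply: continuous_subspaceT => x; apply: differentiable_continuous; apply/derivable1_diffP.
  by case: (df x).
have [h0|h0] := leP 0 h.
  have [c] := @MVT_segment _ f f' 0 h h0 (fun x _ => df x) (cf _).
  rewrite in_itv/= => /andP[c0 ch] ->; rewrite subr0 normrM ler_wpM2r// bf//.
  by rewrite !ger0_norm.
have [c] := @MVT_segment _ f f' h 0 (ltW h0) (fun x _ => df x) (cf _).
rewrite in_itv/= distrC => /andP[ch c0] ->; rewrite sub0r normrM normrN ler_wpM2r// bf//.
by rewrite !ler0_norm ?lerN2// ltW.
Qed.

Lemma sin_norm_le h : `|sin h| <= `|h|.
Proof.
have := @mvt_bound sin cos 1 h (@is_derive_sin R) (fun x _ => cos_max x).
by rewrite sin0 subr0 mul1r.
Qed.

(** Each Taylor bound follows from the preceding one by the mean value inequality. The factorials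
    are lost; only the orders matter. *)
Lemma cos_taylor1 h : `|cos h - 1| <= `|h| ^+ 2.
Proof.
have := @mvt_bound cos (fun x => - sin x) `|h| h (@is_derive_cos R).
rewrite cos0 expr2; apply => x xh; rewrite normrN; exact: le_trans (sin_norm_le _) xh.
Qed.

Lemma sin_taylor2 h : `|sin h - h| <= `|h| ^+ 3.
Proof.
have := @mvt_bound (fun x => sin x - x) (fun x => cos x - 1) (`|h| ^+ 2) h.
rewrite sin0 !subr0 -exprSr; apply => x.
by move=> xh; apply: le_trans (cos_taylor1 _) _; rewrite lerXn2r ?nnegrE.
Qed.

Lemma cos_taylor3 h : `|cos h - 1 + h ^+ 2 / 2| <= `|h| ^+ 4.
Proof.
have := @mvt_bound (fun x => cos x + 2^-1 *: x ^+ 2) (fun x => - (sin x - x)) (`|h| ^+ 3) h.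
rewrite cos0 expr0n /GRing.scale /= mulr0 addr0 -exprSr.
have -> : cos h + 2^-1 * h ^+ 2 - 1 = cos h - 1 + h ^+ 2 / 2 by ring.
apply => x.
  by apply: is_derive_eq; rewrite /GRing.scale /= !mulr1; field.
move=> xh; rewrite normrN; apply: le_trans (sin_taylor2 _) _; rewrite lerXn2r ?nnegrE//.
Qed.

Lemma cosD_taylor z h :
  `|cos (z + h) - (cos z - h * sin z - h ^+ 2 / 2 * cos z)| <= `|h| ^+ 3 + `|h| ^+ 4.
Proof.
rewrite cosD.
have -> : cos z * cos h - sin z * sin h - (cos z - h * sin z - h ^+ 2 / 2 * cos z) =
  - sin z * (sin h - h) + cos z * (cos h - 1 + h ^+ 2 / 2) by ring.
apply: le_trans (ler_normD _ _) _; rewrite !normrM normrN; apply: lerD.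
  by rewrite -[leRHS]mul1r ler_pM// ?sin_max// sin_taylor2.
by rewrite -[leRHS]mul1r ler_pM// ?cos_max// cos_taylor3.
Qed.

(** The upper bound is expR (- x) <= 1 / (1 + x) <= 1 - x + x^2, the latter since (1 - x + x^2)(1 +
    x) = 1 + x^3. *)
Lemma expRN_taylor (x : R) : 0 <= x -> `|expR (- x) - (1 - x)| <= x ^+ 2.
Proof.
move=> x0; have e0 := expR_gt0 x.
have h1 := expR_ge1Dx (- x); rewrite ger0_norm; last by lra.
have h2 := expR_ge1Dx x.
rewrite lerBlDr expRN -div1r ler_pdivrMr//.
have h3 : 1 <= (x ^+ 2 + (1 - x)) * (1 + x).
  have -> : (x ^+ 2 + (1 - x)) * (1 + x) = 1 + x ^+ 3 by ring.
  by rewrite lerDl exprn_ge0.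
apply: (le_trans h3); apply: ler_wpM2l => //.
have := sqr_ge0 (x - 2^-1); lra.
Qed.

(** Averaging over one letter multiplies cosines by about 1 - v / (2 n), which agrees with [rho],
    the exact n-th root of exp(- v / 2), up to order n^(-3/2). Over n letters the error is of order
    n^(-1/2). *)
Lemma cos_clt K (w xi : nat -> R) B z : weight K w -> 0 <= B ->
  (forall x, (x < K)%N -> `|xi x| <= B) ->
  \sum_(x < K) w x * xi x = 0 ->
  (fun n => iid_expect K n w (fun l => cos (z + (\sum_(x <- l) xi x) / Num.sqrt n%:R))) @ \oo
   --> expR (- (\sum_(x < K) w x * xi x ^+ 2) / 2) * cos z.
Proof.
move=> ww B0 xiB xi0; set v := \sum_(x < K) _ * _ ^+ 2.
have v0 : 0 <= v by apply: sumr_ge0 => x _; rewrite mulr_ge0 ?sqr_ge0 ?ww.1.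
(* The first two terms come from the cubic and quartic remainders of the cosine, the last from the
   quadratic remainder of [rho]; powers of q <= 1 beyond the third are discarded. *)
pose C := B ^+ 3 + B ^+ 4 + v ^+ 2.
have C0 : 0 <= C by rewrite /C !addr_ge0 ?exprn_ge0.
have bound n : (0 < n)%N ->
  `|expR (- v / 2) * cos z - iid_expect K n w (fun l => cos (z + (\sum_(x <- l) xi x) / Num.sqrt n%:R))|
   <= C / Num.sqrt n%:R.
  move=> n0; set r := Num.sqrt n%:R.
  have r2 : r ^+ 2 = n%:R :> R by rewrite sqr_sqrtr.
  have r0 : 0 < r by rewrite sqrtr_gt0 ltr0n.
  have r1 : 1 <= r by rewrite -sqrtr1 ler_wsqrtr// ler1n.
  set q := r^-1.
  have q0 : 0 < q by rewrite invr_gt0.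
  have q0' := ltW q0.
  have q1 : q <= 1 by rewrite invf_le1.
  have qn : n%:R * q ^+ 2 = 1 by rewrite -r2 /q exprVn mulfV// expf_neq0// gt_eqF.
  pose rho := expR (- (v * q ^+ 2 / 2)).
  have rhon : rho ^+ n = expR (- v / 2).
    rewrite /rho -expRM_natl; congr expR.
    have -> : n%:R * - (v * q ^+ 2 / 2) = - (v / 2) * (n%:R * q ^+ 2) by ring.
    by rewrite qn; ring.
  have rho1 : `|rho| <= 1.
    have h0 : 0 <= v * q ^+ 2 / 2 by rewrite divr_ge0// mulr_ge0// exprn_ge0.
    by rewrite ger0_norm ?expR_ge0// expR_le1 oppr_le0.
  have step : forall y, `|\sum_(x < K) w x * cos (y + xi x * q) - rho * cos y| <= C * q ^+ 3.
    move=> y.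
    have -> : \sum_(x < K) w x * cos (y + xi x * q) - rho * cos y =
      \sum_(x < K) w x * (cos (y + xi x * q) - (cos y - xi x * q * sin y - (xi x * q) ^+ 2 / 2 * cos y))
      - (rho - (1 - v * q ^+ 2 / 2)) * cos y.
      have -> : \sum_(x < K) w x * (cos (y + xi x * q) - (cos y - xi x * q * sin y - (xi x * q) ^+ 2 / 2 * cos y)) =
        \sum_(x < K) w x * cos (y + xi x * q) - (\sum_(x < K) w x) * cos y + (\sum_(x < K) w x * xi x) * (q * sin y)
         + v * (q ^+ 2 / 2 * cos y).
        rewrite /v !mulr_suml -sumrB -!big_split; apply: eq_bigr => x _ /=; ring.
      by rewrite ww.2 xi0; ring.
    apply: le_trans (ler_normB _ _) _.
    have -> : C * q ^+ 3 = (B ^+ 3 + B ^+ 4) * q ^+ 3 + v ^+ 2 * q ^+ 3 by rewrite /C; ring.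
    apply: lerD.
      apply: le_trans (ler_norm_sum _ _ _) _.
      rewrite -[leRHS]mul1r -[X in X * _]ww.2 mulr_suml; apply: ler_sum => x _.
      rewrite normrM ger0_norm ?ww.1// ler_wpM2l ?ww.1//.
      apply: le_trans (cosD_taylor _ _) _.
      rewrite normrM (ger0_norm q0') !exprMn mulrDl; apply: lerD.
        by rewrite ler_wpM2r ?exprn_ge0// lerXn2r ?nnegrE// xiB.
      apply: ler_pM; rewrite ?exprn_ge0//.
        by rewrite lerXn2r ?nnegrE// xiB.
      by rewrite [leLHS]exprS ler_piMl ?exprn_ge0.
    rewrite normrM -[leRHS]mulr1 ler_pM// ?cos_max//.
    apply: le_trans (expRN_taylor _) _.
      by rewrite divr_ge0// mulr_ge0// exprn_ge0.
    have -> : (v * q ^+ 2 / 2) ^+ 2 = v ^+ 2 * q ^+ 3 * (q / 4) by field.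
    rewrite ler_piMr//; last by lra.
    by rewrite mulr_ge0 ?exprn_ge0.
  have := @iid_expect_cos _ K n w (fun x => xi x * q) rho _ ww rho1 step z.
  rewrite rhon distrC => h.
  have -> : C / r = n%:R * (C * q ^+ 3).
    have -> : n%:R * (C * q ^+ 3) = C * q * (n%:R * q ^+ 2) by ring.
    by rewrite qn mulr1.
  apply: le_trans h; rewrite le_eqVlt; apply/orP; left; apply/eqP; congr `|_ - _|.
  apply: eq_expect => l _ _; congr (cos (_ + _)).
  by rewrite mulr_suml.
apply/cvgrPdist_le => e e0.
near=> n.
have n0 : (0 < n)%N by near: n; exists 1%N.
apply: le_trans (bound n n0) _.
have r0 : 0 < Num.sqrt (n%:R : R) by rewrite sqrtr_gt0 ltr0n.
rewrite ler_pdivrMr// mulrC -ler_pdivrMr//.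
have Ce : 0 <= C / e by rewrite divr_ge0// ltW.
rewrite -(ger0_norm Ce) -sqrtr_sqr ler_wsqrtr//.
apply: ltW; near: n; exact: nbhs_infty_gtr.
Unshelve. all: by end_near. Qed.

End CosineTaylor.

(** * Projections on cones of partially convex vectors *)

Section Cone.
Variable R : realType.
Implicit Types (N : nat -> bool) (f g h W : nat -> R) (m k : nat).

(** [N] marks the points at which convexity is imposed. Marking the points that are not knots yields
    C(K) for m = S + 1 and its truncation at s for m = s. *)
Definition cone N m g := forall k, (0 < k < m)%N -> N k -> 0 <= Delta g k.

Definition cone_min N m W g :=
  cone N m g /\ forall h, cone N m h -> Phi_le m W g <= Phi_le m W h.

Lemma DeltaD f g k : Delta (fun i => f i + g i) k = Delta f k + Delta g k.
Proof. by rewrite /Delta; ring. Qed.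

Lemma DeltaZ (c : R) g k : Delta (fun i => c * g i) k = c * Delta g k.
Proof. by rewrite /Delta; ring. Qed.

Lemma Phi_leB m W g h : Phi_le m W h - Phi_le m W g =
  \sum_(k < m.+1) (g k - W k) * (h k - g k) + 2^-1 * \sum_(k < m.+1) (h k - g k) ^+ 2.
Proof.
rewrite /Phi_le -mulrBr -sumrB !mulr_sumr -big_split; apply: eq_bigr => k _ /=.
by field.
Qed.

Lemma cone_minP N m W g : cone_min N m W g <->
  cone N m g /\ forall h, cone N m h -> 0 <= \sum_(k < m.+1) (g k - W k) * (h k - g k).
Proof.
split=> -[cg mg]; split=> // h ch; last first.
  rewrite -subr_ge0 Phi_leB addr_ge0 ?mg// mulr_ge0 ?invr_ge0//.
  by apply: sumr_ge0 => k _; exact: sqr_ge0.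
set A := \sum_(k < _) _; pose B := \sum_(k < m.+1) (h k - g k) ^+ 2.
have B0 : 0 <= B by apply: sumr_ge0 => k _; exact: sqr_ge0.
rewrite leNgt; apply/negP => A0.
(* If A < 0, this t in (0, 1] satisfies t B <= - A, so moving from g towards h changes the criterion
   by t (A + t B / 2) <= t A / 2 < 0. *)
pose t := - A / (B - A).
have BA : 0 < B - A by lra.
have t0 : 0 < t by rewrite divr_gt0//; lra.
have t1 : t <= 1 by rewrite ler_pdivrMr//; lra.
pose h' k := (1 - t) * g k + t * h k.
have ch' : cone N m h'.
  move=> k k0 Nk; rewrite /h' DeltaD !DeltaZ.
  by rewrite addr_ge0// mulr_ge0 ?cg ?ch//; lra.
have := mg _ ch'; rewrite -subr_ge0 Phi_leB.
have -> : \sum_(k < m.+1) (g k - W k) * (h' k - g k) = t * A.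
  by rewrite /A mulr_sumr; apply: eq_bigr => k _; rewrite /h'; ring.
have -> : \sum_(k < m.+1) (h' k - g k) ^+ 2 = t ^+ 2 * B.
  by rewrite /B mulr_sumr; apply: eq_bigr => k _; rewrite /h'; ring.
have -> : t * A + 2^-1 * (t ^+ 2 * B) = t * (A + 2^-1 * (t * B)) by ring.
rewrite pmulr_rge0// => H.
have tB : t * B <= - A.
  by rewrite /t mulrAC ler_pdivrMr//; nra.
lra.
Qed.

(** Testing each variational inequality at the other minimizer gives |g - g'|^2 <= <W - W', g - g'>,
    and Young's inequality concludes. *)
Lemma cone_min_nonexpansive N m W W' g g' :
  cone_min N m W g -> cone_min N m W' g' ->
  \sum_(k < m.+1) (g k - g' k) ^+ 2 <= \sum_(k < m.+1) (W k - W' k) ^+ 2.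
Proof.
move=> /cone_minP[cg mg] /cone_minP[cg' mg'].
have := addr_ge0 (mg _ cg') (mg' _ cg); rewrite -big_split /= => H.
suff : 2 * \sum_(k < m.+1) (g k - g' k) ^+ 2 + 2 * (\sum_(k < m.+1) ((g k - W k) * (g' k - g k) + (g' k - W' k) * (g k - g' k)))
  <= \sum_(k < m.+1) (g k - g' k) ^+ 2 + \sum_(k < m.+1) (W k - W' k) ^+ 2 by lra.
rewrite !mulr_sumr -!big_split /=; apply: ler_sum => k _.
by have := sqr_ge0 (g k - g' k - (W k - W' k)); nra.
Qed.

Lemma sum_sqr_eq0 m f : \sum_(k < m.+1) f k ^+ 2 <= 0 -> forall k, (k <= m)%N -> f k = 0.
Proof.
move=> h k km; apply/eqP; rewrite -sqrf_eq0 eq_le sqr_ge0 andbT.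
apply: le_trans h; rewrite (bigD1 (Ordinal (km : (k < m.+1)%N)))//= lerDl.
by apply: sumr_ge0 => i _; exact: sqr_ge0.
Qed.

Lemma cone_min_uniq N m W g g' :
  cone_min N m W g -> cone_min N m W g' -> forall k, (k <= m)%N -> g k = g' k.
Proof.
move=> mg mg' k km; apply/eqP; rewrite -subr_eq0.
apply/eqP; apply: (@sum_sqr_eq0 m (fun k => g k - g' k)) => //.
apply: le_trans (cone_min_nonexpansive mg mg') _.
by rewrite big1// => i _; rewrite subrr expr0n.
Qed.

Lemma cvg_Delta (T : Type) (F : set_system T) (FF : Filter F) (e : T -> nat -> R) (l : nat -> R) k :
  (forall k, e u k @[u --> F] --> l k) -> Delta (e u) k @[u --> F] --> Delta l k.
Proof.
move=> el; apply: cvgD; last exact: el.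
by apply: cvgB; [exact: el|apply: cvgM; [exact: cvg_cst|exact: el]].
Qed.

Lemma cvg_Phi_le (T : Type) (F : set_system T) (FF : Filter F) (e : T -> nat -> R) (l : nat -> R) m W :
  (forall k, e u k @[u --> F] --> l k) -> Phi_le m W (e u) @[u --> F] --> Phi_le m W l.
Proof.
move=> el; apply: cvgM; first exact: cvg_cst.
have h k : (e u k - W k) ^+ 2 @[u --> F] --> (l k - W k) ^+ 2.
  by apply: cvgM; (apply: cvgB; [exact: el|exact: cvg_cst]).
elim: m.+1 => [|n IH]; first by rewrite big_ord0; under eq_fun do rewrite big_ord0; exact: cvg_cst.
by rewrite big_ord_recr /=; under eq_fun do rewrite big_ord_recr /=; apply: cvgD.
Qed.

Lemma cone_min_ex N m W : exists g, cone_min N m W g.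
Proof.
pose ext (v : 'rV[R]_m.+1) k := v ord0 (inord k).
have cext k : continuous (fun v : 'rV[R]_m.+1 => ext v k) by move=> v; exact: coord_continuous.
(* A competitor h that beats the zero vector has sum (h - W)^2 <= sum W^2, hence |h k| <= |h k - W
   k| + |W k| <= C by |x| <= 1 + x^2. Minimizing over this compact box is therefore enough. *)
pose C := 2 * (1 + \sum_(k < m.+1) W k ^+ 2).
pose A : set 'rV[R]_m.+1 := [set v | cone N m (ext v)] `&` [set v | forall k : 'I_m.+1, `|ext v k| <= C].
have SW0 : 0 <= \sum_(k < m.+1) W k ^+ 2 by apply: sumr_ge0 => i _; exact: sqr_ge0.
have C0 : 0 <= C by rewrite /C; lra.
have extE (v : 'rV[R]_m.+1) (k : 'I_m.+1) : ext v k = v ord0 k by rewrite /ext inord_val.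
have closedge (f : 'rV[R]_m.+1 -> R) c : continuous f -> closed [set v | f v <= c].
  by move=> cf; apply: (@closed_comp _ _ f [set x | x <= c]) => [v _|]; [exact: cf|exact: closed_le].
have cA : compact A.
  apply: bounded_closed_compact.
    exists C; split => //= M CM v [_ vC] /=.
    rewrite [`|v|]mx_normrE; apply: bigmax_le; first by lra.
    by move=> [i j] _ /=; rewrite (ord1 i) -extE; apply: le_trans (vC j) _; exact: ltW.
  apply: closedI.
    rewrite (_ : [set v | _] = \bigcap_(k in [set k | (0 < k < m)%N /\ N k]) [set v | 0 <= Delta (ext v) k]); last first.
      apply/seteqP; split => v /= h k; first by move=> -[k0 Nk] /=; exact: h.
      by move=> k0 Nk; exact: (h k (conj k0 Nk)).
    apply: closed_bigI => k _.
    have cD : continuous (fun v : 'rV[R]_m.+1 => Delta (ext v) k).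
      by move=> v; exact: (@cvg_Delta _ _ (nbhs_filter v) _ _ _ (fun i => cext i v)).
    by apply: (@closed_comp _ _ (fun v : 'rV[R]_m.+1 => Delta (ext v) k) [set x | 0 <= x]) => [v _|]; [exact: cD|exact: closed_ge].
  rewrite (_ : [set v | _] = \bigcap_(k : 'I_m.+1) [set v | `|ext v k| <= C]); last first.
    by apply/seteqP; split => v /= h k; [move=> _; exact: h|exact: (h k I)].
  apply: closed_bigI => k _; apply: closedge => v.
  exact: (cvg_norm (cext _ _)).
have A0 : A !=set0.
  by exists 0; split => /= k; rewrite /Delta /ext !mxE ?normr0// mulr0 subrr addr0.
have cP : continuous (fun v : 'rV[R]_m.+1 => Phi_le m W (ext v)).
  by move=> v; exact: (@cvg_Phi_le _ _ (nbhs_filter v) _ _ _ _ (fun i => cext i v)).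
have [c Ac hc] := @EVT_min_rV R m.+1 (fun v => Phi_le m W (ext v)) A A0 cA (continuous_subspaceT cP).
exists (ext c); split; first by move: Ac; rewrite inE => -[].
move=> h ch.
pose v : 'rV[R]_m.+1 := \row_i h i.
have vE k : (k <= m)%N -> ext v k = h k by move=> km; rewrite /ext mxE inordK.
have Pv : Phi_le m W (ext v) = Phi_le m W h.
  by congr (_ * _); apply: eq_bigr => k _; rewrite vE// -ltnS.
have cv : cone N m (ext v).
  move=> k /andP[k0 km] Nk; rewrite /Delta !vE//; [|by lia..].
  by apply: ch => //; rewrite k0.
have [Av|nAv] := pselect (A v); first by rewrite -Pv; apply: hc; rewrite inE.
have P0 : Phi_le m W (ext c) <= Phi_le m W (ext 0).
  by apply: hc; rewrite inE; split => /= k; rewrite /Delta /ext !mxE ?normr0// mulr0 subrr addr0.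
apply: (le_trans P0); rewrite leNgt; apply/negP => hP; apply: nAv; split => //= k.
rewrite vE; last by rewrite -ltnS ltn_ord.
have hk : (h k - W k) ^+ 2 <= \sum_(k < m.+1) W k ^+ 2.
  have := hP; rewrite /Phi_le ltr_pM2l ?invr_gt0// => hP'.
  have -> : \sum_(k < m.+1) W k ^+ 2 = \sum_(k < m.+1) (ext 0 k - W k) ^+ 2.
    by apply: eq_bigr => i _; rewrite /ext mxE sub0r sqrrN.
  apply: le_trans (ltW hP'); rewrite (bigD1 k)//= lerDl sumr_ge0// => i _; exact: sqr_ge0.
have Wk : W k ^+ 2 <= \sum_(k < m.+1) W k ^+ 2.
  by rewrite (bigD1 k)//= lerDl sumr_ge0// => i _; exact: sqr_ge0.
have sq (x : R) : `|x| <= 1 + x ^+ 2.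
  have := sqr_ge0 (`|x| - 1); rewrite -(real_normK (num_real x)).
  by have := normr_ge0 x; nra.
rewrite -[h k](subrK (W k)); apply: le_trans (ler_normD _ _) _.
by have := sq (h k - W k); have := sq (W k); rewrite /C; lra.
Qed.

End Cone.

(** * Blockwise convexity between consecutive knots *)

Section Knots.
Variables (R : realType) (p0 : nat -> R) (S : nat).

Lemma ext_knotsE : ext_knots p0 S =
  [seq k <- iota 0 S.+2 | [|| k == 0%N, k == S.+1 | 0 < Delta p0 k]].
Proof.
have -> : iota 0 S.+2 = 0%N :: (iota 1 S ++ [:: S.+1]) by rewrite -[S.+2]addn1 iotaD /= add0n.
rewrite /= filter_cat /= eqxx /= cats1 /ext_knots /knots; congr (_ :: rcons _ _).
apply: eq_in_filter => k; rewrite mem_iota add1n ltnS => /andP[k0 kS].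
by rewrite [k == S.+1]ltn_eqF// [k == 0%N]gtn_eqF.
Qed.

Lemma mem_ext_knots k : (k \in ext_knots p0 S) =
  (k <= S.+1)%N && [|| k == 0%N, k == S.+1 | 0 < Delta p0 k].
Proof. by rewrite ext_knotsE mem_filter mem_iota /= add0n ltnS andbC. Qed.

Lemma sorted_ext_knots : sorted ltn (ext_knots p0 S).
Proof. by rewrite ext_knotsE; apply: sorted_filter; [exact: ltn_trans|exact: iota_ltn_sorted]. Qed.

Lemma size_ext_knots : size (ext_knots p0 S) = (nknots p0 S).+2.
Proof. by rewrite /= size_rcons. Qed.

Lemma sk_mono i j : (i < (nknots p0 S).+2)%N -> (j < (nknots p0 S).+2)%N ->
  (sk p0 S i < sk p0 S j)%N = (i < j)%N.
Proof.
rewrite -size_ext_knots => hi hj.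
exact: (lt_sorted_ltn_nth 0%N sorted_ext_knots).
Qed.

(** A point is interior to a block between consecutive extended knots exactly when it is no extended
    knot itself, so the blockwise conditions collapse to a pointwise one. As s is an extended knot,
    no block straddles it. *)
Lemma in_CK_leP s g : s \in ext_knots p0 S ->
  in_CK_le p0 S s g <-> cone (fun k => ~~ (0 < Delta p0 k)) s g.
Proof.
move=> sl.
have sS : (s <= S.+1)%N by move: sl; rewrite mem_ext_knots => /andP[].
split=> [h k /andP[k0 ks] Nk|h j jn js k jk kj].
(* The block around k ends at the first extended knot beyond k; its predecessor in the list is then
   strictly below k. *)
- pose i := find (fun x => (k < x)%N) (ext_knots p0 S).
  have hasl : has (fun x => (k < x)%N) (ext_knots p0 S) by apply/hasP; exists s.
  have il : (i < (nknots p0 S).+2)%N by rewrite -size_ext_knots -has_find.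
  have ki : (k < sk p0 S i)%N by exact: (nth_find 0%N hasl).
  have i0 : (0 < i)%N by rewrite lt0n; apply/eqP => i0; move: ki; rewrite i0 /sk /=.
  have kl : k \notin ext_knots p0 S.
    rewrite mem_ext_knots negb_and !negb_or Nk -!lt0n k0 neq_ltn.
    by rewrite (leq_trans ks sS) /= orbT.
  have ik : (sk p0 S i.-1 < k)%N.
    have : ~~ (k < sk p0 S i.-1)%N.
      by apply/negbT/(before_find 0%N); rewrite -/i prednK.
    rewrite -leqNgt leq_eqVlt => /orP[/eqP ek|//].
    by move: kl; rewrite -ek mem_nth// size_ext_knots; lia.
  have := h i.-1; rewrite prednK// => /(_ _ _ k ik ki); apply; first by lia.
  rewrite leqNgt; apply/negP => si.
  have sidx : (index s (ext_knots p0 S) < (nknots p0 S).+2)%N by rewrite -size_ext_knots index_mem.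
  have : (sk p0 S (index s (ext_knots p0 S)) < sk p0 S i)%N by rewrite /sk nth_index.
  rewrite sk_mono// => /(before_find 0%N).
  by rewrite nth_index// ks.
- apply: h; first by rewrite (leq_trans _ jk)//= (leq_trans kj).
  apply/negP => Dk.
  have kl : k \in ext_knots p0 S by rewrite mem_ext_knots Dk !orbT andbT ltnW// (leq_trans kj)// (leq_trans js).
  have kidx : (index k (ext_knots p0 S) < (nknots p0 S).+2)%N by rewrite -size_ext_knots index_mem.
  move: jk kj; rewrite -(nth_index 0%N kl) -/(sk p0 S _) !sk_mono//; lia.
Qed.

Lemma in_CKP g : in_CK p0 S g <-> cone (fun k => ~~ (0 < Delta p0 k)) S.+1 g.
Proof.
rewrite -in_CK_leP; last by rewrite mem_ext_knots leqnn eqxx.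
split=> [h j jn _|h j jn]; first exact: h.
apply: h => //.
have : sk p0 S j.+1 \in ext_knots p0 S by rewrite mem_nth// size_ext_knots.
by rewrite mem_ext_knots => /andP[].
Qed.

End Knots.

(** * Approximation by trigonometric polynomials *)

Section TrigPoly.
Variable R : realType.
Implicit Types (m k N : nat) (x : nat -> R) (y : R).

(** Real trigonometric polynomials in the first m coordinates. Arbitrary phases include sines and
    make the class closed under products. *)
Inductive trig m : ((nat -> R) -> R) -> Prop :=
| trig_cos c (t : nat -> R) th : trig m (fun x => c * cos (\sum_(k < m) t k * x k + th))
| trig_add f g : trig m f -> trig m g -> trig m (fun x => f x + g x).

Lemma trig_ext m f g : trig m f -> (forall x, f x = g x) -> trig m g.
Proof. by move=> tf /funext <-. Qed.

Lemma trig_cst m c : trig m (fun=> c).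
Proof.
apply: (trig_ext (trig_cos m c (fun=> 0) 0)) => x.
by rewrite big1 ?addr0 ?cos0 ?mulr1// => k _; rewrite mul0r.
Qed.

Lemma trig_mul m f g : trig m f -> trig m g -> trig m (fun x => f x * g x).
Proof.
move=> tf tg; elim: tf => {f} [c t th|f f' _ hf _ hf']; last first.
  by apply: (trig_ext (trig_add hf hf')) => x; rewrite mulrDl.
elim: tg => {g} [c' t' th'|g g' _ hg _ hg']; last first.
  by apply: (trig_ext (trig_add hg hg')) => x; rewrite mulrDr.
apply: (trig_ext (trig_add (trig_cos m (c * c' / 2) (fun k => t k + t' k) (th + th'))
  (trig_cos m (c * c' / 2) (fun k => t k - t' k) (th - th')))) => x.
set A := \sum_(k < m) t k * x k + th; set B := \sum_(k < m) t' k * x k + th'.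
have -> : \sum_(k < m) (t k + t' k) * x k + (th + th') = A + B.
  by rewrite /A /B addrACA -big_split; congr (_ + _); apply: eq_bigr => k _; rewrite mulrDl.
have -> : \sum_(k < m) (t k - t' k) * x k + (th - th') = A - B.
  by rewrite /A /B opprD addrACA -sumrB; congr (_ + _); apply: eq_bigr => k _; rewrite mulrBl.
by rewrite cosB cosD; field.
Qed.

Lemma trig_coord m k (a b : R) : (k < m)%N -> trig m (fun x => cos (a * x k + b)).
Proof.
move=> km; apply: (trig_ext (trig_cos m 1 (fun j => if j == k then a else 0) b)) => x.
rewrite mul1r (bigD1 (Ordinal km))//= eqxx big1 ?addr0// => j jk.
by rewrite ifF ?mul0r//; apply: contraNF jk => /eqP jk; apply/eqP/val_inj.
Qed.

(* The Bernstein polynomial of degree [N], as an expectation under Binomial(N, y). *)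
Fixpoint bern N y (f : nat -> R) : R :=
  if N is N'.+1 then bern N' y (fun i => (1 - y) * f i + y * f i.+1) else f 0%N.

Lemma ler_bern N y f g : 0 <= y <= 1 -> (forall i, (i <= N)%N -> f i <= g i) ->
  bern N y f <= bern N y g.
Proof.
move=> /andP[y0 y1]; elim: N f g => [|N IH] f g fg /=; first exact: fg.
apply: IH => i iN; apply: lerD; apply: ler_wpM2l; rewrite ?subr_ge0//; apply: fg; lia.
Qed.

(** Second moment of Binomial(N, y) about an arbitrary centre, as variance plus squared bias.
    Averaging over one trial moves the centre from c to c - y and adds y (1 - y). *)
Lemma bern_sqr N y (a b c : R) :
  bern N y (fun i => a + b * (i%:R - c) ^+ 2) = a + b * (N%:R * y * (1 - y) + (N%:R * y - c) ^+ 2).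
Proof.
elim: N a c => [|N IH] a c /=; first by ring.
have -> : (fun i : nat => (1 - y) * (a + b * (i%:R - c) ^+ 2) + y * (a + b * (i.+1%:R - c) ^+ 2)) =
  (fun i => (a + b * y * (1 - y)) + b * (i%:R - (c - y)) ^+ 2).
  by apply/funext => i; rewrite -natr1; ring.
by rewrite IH -natr1; ring.
Qed.

Lemma bern_cst N y (a : R) : bern N y (fun=> a) = a.
Proof.
have := bern_sqr N y a 0 0; rewrite mul0r addr0; apply: etrans.
by congr bern; apply/funext => i; rewrite mul0r addr0.
Qed.

Lemma bernDr N y g (a : R) : bern N y g + a = bern N y (fun i => g i + a).
Proof.
elim: N g => [//|n IHn] g /=.
by rewrite IHn; congr bern; apply/funext => i; ring.
Qed.

Lemma bernN N y g : - bern N y g = bern N y (fun i => - g i).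
Proof.
elim: N g => [//|n IHn] g /=.
by rewrite IHn; congr bern; apply/funext => i; ring.
Qed.

Lemma trig_bern m N (y : (nat -> R) -> R) (f : (nat -> R) -> nat -> R) :
  trig m y -> (forall i, trig m (fun x => f x i)) -> trig m (fun x => bern N (y x) (f x)).
Proof.
move=> ty; elim: N f => [|N IH] f tf /=; first exact: tf.
apply: (IH (fun x i => (1 - y x) * f x i + y x * f x i.+1)) => i.
apply: trig_add; apply: trig_mul => //.
have t1 := trig_mul (trig_cst m (-1)) ty.
by apply: (trig_ext (trig_add (trig_cst m 1) t1)) => x; rewrite mulN1r.
Qed.

(** Tensor product of Bernstein operators: the expectation of [H] at independent binomial variables
    with parameters [ys]. *)
Fixpoint mbern N (ys : seq R) (H : seq nat -> R) : R :=
  if ys is y :: ys' then bern N y (fun i => mbern N ys' (fun l => H (i :: l))) else H [::].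

Lemma mbern_bound N ys H (M : R) : all (fun y => 0 <= y <= 1) ys ->
  (forall l, `|H l| <= M) -> `|mbern N ys H| <= M.
Proof.
elim: ys H => [|y ys IH] H /=; first by move=> _; exact.
move=> /andP[y01 ys01] HM.
rewrite ler_norml -(bern_cst N y (- M)) -{2}(bern_cst N y M).
have h i : `|mbern N ys (fun l => H (i :: l))| <= M by apply: IH.
by apply/andP; split; apply: ler_bern => // i _; have := h i; rewrite ler_norml => /andP[].
Qed.

(** Each coordinate contributes its binomial variance, at most N / 4. In the induction the square
    belonging to the first coordinate is fixed and absorbed into [eta]. *)
Lemma mbern_approx N ys H (c eta D : R) : all (fun y => 0 <= y <= 1) ys -> 0 <= D ->
  (forall l, size l = size ys -> all (fun i => i <= N)%N l ->
     `|H l - c| <= eta + D * \sum_(k < size ys) ((nth 0%N l k)%:R - N%:R * nth 0 ys k) ^+ 2) ->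
  `|mbern N ys H - c| <= eta + D * ((size ys)%:R * N%:R / 4).
Proof.
move=> + D0; elim: ys H eta => [|y ys IH] H eta /=.
  by move=> _ /(_ [::] erefl isT); rewrite big_ord0 !mul0r.
move=> /andP[y01 ys01] HH.
set f := (fun i => _); set e := D * ((size ys)%:R * N%:R / 4).
have h i : (i <= N)%N -> `|f i - c| <= (eta + e) + D * (i%:R - N%:R * y) ^+ 2.
  move=> iN.
  have := IH (fun l => H (i :: l)) (eta + D * (i%:R - N%:R * y) ^+ 2) ys01.
  rewrite addrAC; apply => l sl al.
  have := HH (i :: l); rewrite /= sl iN al => /(_ erefl isT).
  by rewrite big_ord_recl /= mulrDr addrA.
have E := bern_sqr N y (eta + e) D (N%:R * y).
have le : bern N y (fun i => (eta + e) + D * (i%:R - N%:R * y) ^+ 2) <= eta + D * ((size ys).+1%:R * N%:R / 4).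
  rewrite E subrr expr0n /= addr0 -addrA lerD2l /e -mulrDr ler_wpM2l//.
  have -> : (size ys).+1%:R = (size ys)%:R + 1 :> R by rewrite natr1.
  have -> : ((size ys)%:R + 1) * N%:R / 4 = (size ys)%:R * N%:R / 4 + N%:R * 4^-1 :> R by ring.
  rewrite lerD2l -mulrA ler_wpM2l//.
  by have := sqr_ge0 (y - 2^-1); lra.
rewrite ler_norml lerNl bernDr bernN; apply/andP; split.
  apply: le_trans le; apply: ler_bern => // i iN.
  by have := h i iN; rewrite ler_norml => /andP[]; lra.
apply: le_trans le; apply: ler_bern => // i iN.
by have := h i iN; rewrite ler_norml => /andP[].
Qed.

Lemma trig_mbern m N (ys : seq ((nat -> R) -> R)) H :
  (forall g, List.In g ys -> trig m g) ->
  trig m (fun x => mbern N [seq (g : (nat -> R) -> R) x | g <- ys] H).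
Proof.
elim: ys H => [|g ys IH] H tys /=; first exact: trig_cst.
apply: (@trig_bern m N g (fun x i => mbern N [seq (g : (nat -> R) -> R) x | g <- ys] (fun l => H (i :: l)))).
  by apply: tys; left.
by move=> i; apply: IH => g' ?; apply: tys; right.
Qed.

(** On [0, pi] the cosine varies least near the ends. With h = d / 2, cos a - cos (a + d) = 2 sin h
    sin (a + h) and 1 - cos d = 2 (sin h)^2, while sin h <= sin (a + h) since h <= a + h <= pi -
    h. *)
Lemma cos_separation (a b d : R) : 0 <= a -> b <= pi -> 0 <= d -> a + d <= b ->
  1 - cos d <= cos a - cos b.
Proof.
move=> a0 bpi d0 adb.
have cosle (u v : R) : 0 <= u -> u <= v -> v <= pi -> cos v <= cos u.
  move=> u0 uv vpi; rewrite leNgt ltr_cos ?in_itv/= -?leNgt//; apply/andP; split; lra.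
have cb : cos b <= cos (a + d) by apply: cosle => //; lra.
apply: (@le_trans _ _ (cos a - cos (a + d))); last by lra.
pose h := d / 2; pose u := a + h.
have -> : a = u - h by rewrite /u; ring.
have -> : u - h + d = u + h by rewrite /h; field.
have -> : d = h + h by rewrite /h; field.
rewrite cosB !cosD -!expr2 cos2sin2.
have sh : 0 <= sin h by apply: sin_ge0_pi; rewrite /h; lra.
suff su : sin h <= sin u by nra.
have sinE (z : R) : sin z = cos (pi / 2 - z) by rewrite cosB cos_pihalf sin_pihalf mul0r add0r mul1r.
rewrite (sinE h) (sinE u) -(cos_norm (pi / 2 - u)); apply: cosle => //.
  rewrite ler_norml /u /h; lra.
rewrite /h; lra.
Qed.

(* [ycoord] maps [-L, L] monotonically onto [0, 1] and is affine in a cosine, so that Bernstein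
   polynomials in these coordinates are trigonometric polynomials. *)
Definition ycoord (L z : R) := (1 + cos (pi / (2 * L) * z + pi / 2)) / 2.

(** The inverse of [ycoord L] on [0, 1]; it carries the Bernstein grid back to [-L, L]. *)
Definition xcoord (L y : R) := 2 * L / pi * (acos (2 * y - 1) - pi / 2).

Lemma ycoord01 (L z : R) : 0 <= ycoord L z <= 1.
Proof.
have := cos_geN1 (pi / (2 * L) * z + pi / 2); have := cos_le1 (pi / (2 * L) * z + pi / 2).
by rewrite /ycoord; lra.
Qed.

Lemma xcoord_le (L y : R) : 0 < L -> 0 <= y <= 1 -> `|xcoord L y| <= L.
Proof.
move=> L0 y01; have p0 := @pi_gt0 R.
have y1 : -1 <= 2 * y - 1 <= 1 by lra.
have a0 := acos_ge0 y1; have a1 := acos_lepi y1.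
rewrite /xcoord normrM ger0_norm; last by rewrite divr_ge0 ?mulr_ge0// ltW.
apply: (@le_trans _ _ (2 * L / pi * (pi / 2))).
  rewrite ler_wpM2l//; first by rewrite divr_ge0 ?mulr_ge0// ltW.
  rewrite ler_norml; lra.
have pn : pi != 0 :> R by rewrite gt_eqF.
have -> // : 2 * L / pi * (pi / 2) = L.
by move: pn; move: (@pi R) => p pn; field.
Qed.

Lemma xcoordK (L y : R) : 0 < L -> 0 <= y <= 1 -> ycoord L (xcoord L y) = y.
Proof.
move=> L0 y01; have p0 := @pi_gt0 R.
rewrite /ycoord /xcoord.
have -> : pi / (2 * L) * (2 * L / pi * (acos (2 * y - 1) - pi / 2)) + pi / 2 = acos (2 * y - 1).
  by move: p0; move: (@pi R) => p p0; field; rewrite (gt_eqF L0) (gt_eqF p0).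
rewrite acosK; first by field.
by rewrite in_itv/=; lra.
Qed.

(** A quantitative form of injectivity, used in place of uniform continuity of the inverse: values
    of [ycoord] closer than kappa force arguments closer than d. *)
Lemma ycoord_separation (L d : R) : 0 < L -> 0 < d -> d <= L -> exists2 kappa : R, 0 < kappa &
  forall z z' : R, `|z| <= L -> `|z'| <= L -> d <= `|z - z'| -> kappa <= `|ycoord L z - ycoord L z'|.
Proof.
move=> L0 d0 dL; have p0 := @pi_gt0 R.
pose q := pi / (2 * L).
have q0 : 0 < q by rewrite divr_gt0// mulr_gt0.
have qL : q * L = pi / 2 by rewrite /q; field; rewrite ?(gt_eqF L0).
have qd0 : 0 < q * d by rewrite mulr_gt0.
have qd1 : q * d <= pi / 2 by rewrite -qL ler_pM2l.
exists ((1 - cos (q * d)) / 2).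
  rewrite divr_gt0// subr_gt0 -{1}(@cos0 R) ltr_cos ?in_itv//=; lra.
move=> z z'.
wlog zz' : z z' / z' <= z.
  move=> W zL z'L; have [zz'|/ltW zz'] := leP z' z; first exact: W.
  by rewrite distrC (distrC (ycoord L z)); exact: W.
rewrite (ger0_norm (x := z - z')) ?subr_ge0// !ler_norml => /andP[z1 z2] /andP[z3 z4] dz.
rewrite distrC; apply: le_trans (ler_norm _).
rewrite /ycoord -/q -mulrBl ler_pM2r//.
have -> : 1 + cos (q * z' + pi / 2) - (1 + cos (q * z + pi / 2)) = cos (q * z' + pi / 2) - cos (q * z + pi / 2) by ring.
have m1 : q * z <= q * L by rewrite ler_pM2l.
have m2 : q * (- L) <= q * z' by rewrite ler_pM2l.
have m3 : q * d <= q * (z - z') by rewrite ler_pM2l.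
apply: cos_separation; lra.
Qed.

(** Bernstein's proof of the Weierstrass theorem in the coordinates [ycoord]. Grid points near x are
    handled by the modulus of continuity; at a grid point far from x in some coordinate the error 2
    M is dominated by [D] times the squared deviation. As an average of values of [phi], the
    approximant keeps the bound M outside the cube too. *)
Lemma trig_approx m (phi : (nat -> R) -> R) (M L : R) : 0 < L ->
  (forall x, `|phi x| <= M) ->
  (forall eta : R, 0 < eta -> exists2 delta : R, 0 < delta & forall x x' : nat -> R,
    (forall k, (k < m)%N -> `|x k| <= L) -> (forall k, (k < m)%N -> `|x' k| <= L) ->
    (forall k, (k < m)%N -> `|x k - x' k| <= delta) -> `|phi x - phi x'| <= eta) ->
  forall eps : R, 0 < eps -> exists tau, [/\ trig m tau, forall x, `|tau x| <= M &
    forall x, (forall k, (k < m)%N -> `|x k| <= L) -> `|tau x - phi x| <= eps].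
Proof.
move=> L0 phiM phic eps eps0.
have M0 : 0 <= M by apply: le_trans (phiM (fun=> 0)); exact: normr_ge0.
have [delta delta0 hdelta] := phic _ (divr_gt0 eps0 (ltr0n _ 2)).
have d10 : 0 < Num.min delta L by rewrite lt_min delta0.
have d1L : Num.min delta L <= L by rewrite ge_min lexx orbT.
have [kappa kappa0 hkappa] := ycoord_separation L0 d10 d1L.
(* This makes the variance term D m N / 4 = M m / (2 kappa^2 N) at most eps / 2. *)
pose N := (Num.trunc (M * m%:R / (kappa ^+ 2 * eps))).+1.
have hN : M * m%:R / (kappa ^+ 2 * eps) <= N%:R.
  by apply: ltW; exact: truncnS_gt.
have N0 : 0 < N%:R :> R by rewrite ltr0n.
pose H (l : seq nat) := phi (fun k => xcoord L ((nth 0%N l k)%:R / N%:R)).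
pose ys := [seq (fun x : nat -> R => ycoord L (x k)) | k <- iota 0 m].
exists (fun x => mbern N [seq (g : (nat -> R) -> R) x | g <- ys] H).
have ys01 x : all (fun y => 0 <= y <= 1) [seq (g : (nat -> R) -> R) x | g <- ys].
  by rewrite -map_comp; apply/allP => _ /mapP[k _ ->]; exact: ycoord01.
have sys x : size [seq (g : (nat -> R) -> R) x | g <- ys] = m by rewrite !size_map size_iota.
split.
- apply: trig_mbern => y.
  have : all (fun k => k < m)%N (iota 0 m) by apply/allP => k; rewrite mem_iota add0n.
  rewrite /ys; elim: (iota 0 m) => [//|k s IH] /= /andP[km sm] [<-|]; last exact: IH.
  apply: (trig_ext (trig_add (trig_cst m 2^-1) (trig_mul (trig_cst m 2^-1) (trig_coord (pi / (2 * L)) (pi / 2) km)))) => x.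
  by rewrite /ycoord; field.
- by move=> x; apply: mbern_bound => // l; exact: phiM.
move=> x xL.
have nthy k : (k < m)%N -> nth 0 [seq (g : (nat -> R) -> R) x | g <- ys] k = ycoord L (x k).
  move=> km; rewrite (nth_map (fun=> 0)) ?size_map ?size_iota//.
  by rewrite (nth_map 0%N) ?size_iota// nth_iota// add0n.
pose D := 2 * M / (kappa ^+ 2 * N%:R ^+ 2).
have D0 : 0 <= D by rewrite /D divr_ge0 ?mulr_ge0 ?exprn_ge0 ?ler0n// ltW.
apply: le_trans (mbern_approx (eta := eps / 2) (D := D) (ys01 x) D0 _) _; last first.
  rewrite sys.
  have -> : D * (m%:R * N%:R / 4) = M * m%:R / (kappa ^+ 2 * eps) * (eps / (2 * N%:R)).
    by rewrite /D; field; rewrite ?(gt_eqF N0) ?(gt_eqF kappa0) ?(gt_eqF eps0).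
  apply: (@le_trans _ _ (eps / 2 + N%:R * (eps / (2 * N%:R)))).
    by rewrite lerD2l ler_wpM2r// divr_ge0 ?mulr_ge0 ?ltW.
  have -> : N%:R * (eps / (2 * N%:R)) = eps / 2 by field; rewrite ?(gt_eqF N0).
  lra.
rewrite sys => l sl al.
have l01 k : 0 <= ((nth 0%N l k)%:R / N%:R : R) <= 1.
  rewrite divr_ge0//= ler_pdivrMr// mul1r ler_nat.
  have [kl|kl] := ltnP k (size l); last by rewrite nth_default.
  by move/(all_nthP 0%N): al; exact.
have S0 k : 0 <= ((nth 0%N l k)%:R - N%:R * nth 0 [seq (g : (nat -> R) -> R) x | g <- ys] k) ^+ 2 :> R by exact: sqr_ge0.
have [close|] := pselect (forall k, (k < m)%N -> `|ycoord L (x k) - (nth 0%N l k)%:R / N%:R| < kappa).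
  have : `|phi (fun k => xcoord L ((nth 0%N l k)%:R / N%:R)) - phi x| <= eps / 2.
    apply: hdelta => // k km; first exact: xcoord_le.
    rewrite distrC leNgt; apply/negP => lt.
    have := close k km; rewrite ltNge => /negP; apply.
    rewrite -[X in _ - X](xcoordK L0 (l01 k)); apply: hkappa => //; [exact: xL|exact: xcoord_le|].
    by rewrite ge_min ltW.
  move=> h; apply: (le_trans h); rewrite lerDl mulr_ge0// sumr_ge0//.
move=> /existsNP[k /not_implyP[km /negP]]; rewrite -leNgt => far.
have : `|H l - phi x| <= 2 * M.
  by apply: le_trans (ler_normB _ _) _; have := phiM x; have := phiM (fun k => xcoord L ((nth 0%N l k)%:R / N%:R)); rewrite /H; lra.
move=> h; apply: (le_trans h).
rewrite -[leLHS]add0r lerD//; first by rewrite ltW// divr_gt0.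
apply: (@le_trans _ _ (D * ((nth 0%N l k)%:R - N%:R * nth 0 [seq (g : (nat -> R) -> R) x | g <- ys] k) ^+ 2)); last first.
  rewrite ler_wpM2l// (bigD1 (Ordinal km))//= lerDl; apply: sumr_ge0 => //.
rewrite nthy//.
have -> : ((nth 0%N l k)%:R - N%:R * ycoord L (x k)) ^+ 2 = N%:R ^+ 2 * `|ycoord L (x k) - (nth 0%N l k)%:R / N%:R| ^+ 2.
  move: (gt_eqF N0); move: (N%:R : R) => nn nn0.
  by rewrite real_normK ?num_real//; field; rewrite nn0.
have -> : D * (N%:R ^+ 2 * `|ycoord L (x k) - (nth 0%N l k)%:R / N%:R| ^+ 2) =
   2 * M * (`|ycoord L (x k) - (nth 0%N l k)%:R / N%:R| ^+ 2 / kappa ^+ 2).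
  by rewrite /D; field; rewrite ?(gt_eqF N0) ?(gt_eqF kappa0) ?(gt_eqF eps0).
rewrite ler_peMr ?mulr_ge0// ler_pdivlMr ?exprn_gt0// mul1r lerXn2r ?nnegrE//; exact: ltW.
Qed.

End TrigPoly.

(** * Finite samples *)

Section FiniteLaw.
Variables (R : realType) (p0 : nat -> R) (S : nat).
Variables (d : measure_display) (T : measurableType d) (P : probability T R).
Variable (X : nat -> T -> nat).
Hypothesis p0_gt0 : forall k, (k <= S)%N -> 0 < p0 k.
Hypothesis p0_sum1 : \sum_(k < S.+1) p0 k = 1.
Hypothesis Xiid : iid_pmf P X p0.

Definition cylinder (l : seq nat) : set T :=
  [set w | forall i, (i < size l)%N -> X i w = nth 0%N l i].

Lemma measurable_cylinder l : measurable (cylinder l).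
Proof.
rewrite (_ : cylinder l = \bigcap_(i in `I_(size l)) (X i @^-1` [set nth 0%N l i])); last first.
  by apply/seteqP; split => w /= h i; exact: h.
by apply: fin_bigcap_measurable; [exact: finite_II|move=> i _; exact: Xiid.1].
Qed.

Lemma prob_cylinder l : P (cylinder l) = (\prod_(x <- l) p0 x)%:E.
Proof.
have := Xiid.2 (size l) (nth 0%N l); rewrite /cylinder => ->.
by rewrite (big_nth 0%N) big_mkord.
Qed.

(** Every word over {0, ..., S} has positive probability, so some outcome produces it. Fixing one
    outcome per word turns functions of the outcome into functions of words. *)
Lemma exists_samples : exists om : seq nat -> T,
  forall l, all (fun x => x < S.+1)%N l -> cylinder l (om l).
Proof.
suff /choice[om omP] : forall l, exists w, all (fun x => x < S.+1)%N l -> cylinder l w by exists om.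
move=> l.
have T0 : [set: T] !=set0.
  apply/set0P; apply/eqP => T0; have := @probability_setT _ _ _ P.
  by rewrite T0 measure0 => /eqP; rewrite lt_eqF// lte01.
have [al|] := boolP (all (fun x => x < S.+1)%N l); last by case: T0 => w _ _; exists w.
suff /set0P[w ?] : cylinder l != set0 by exists w.
apply/eqP => l0; have := prob_cylinder l; rewrite l0 measure0.
suff h : 0 < \prod_(x <- l) p0 x by case => e; move: h; rewrite -e ltxx.
elim: l al {l0} => [|x l IH]; first by rewrite big_nil.
by rewrite big_cons /= => /andP[xS al]; rewrite mulr_gt0 ?IH ?p0_gt0.
Qed.

Definition determined n (G : T -> R) :=
  forall w w', (forall i, (i < n)%N -> X i w = X i w') -> G w = G w'.

(** There are countably many words, so every preimage is a countable union of cylinders.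
    Measurability of the estimator comes from here. *)
Lemma measurable_determined n G : determined n G -> measurable_fun [set: T] G.
Proof.
move=> dG _ Y mY; rewrite setTI.
pose F l := if `[< size l = n /\ exists w, cylinder l w /\ Y (G w) >] then cylinder l else set0.
rewrite (_ : G @^-1` Y = \bigcup_l F l).
  apply: countable_bigcupT_measurable; first exact: countableP.
  by move=> l; rewrite /F; case: ifP => // _; exact: measurable_cylinder.
apply/seteqP; split => [w Yw|w [l _]].
  exists (mkseq (X^~ w) n) => //.
  have cw : cylinder (mkseq (X^~ w) n) w by move=> i; rewrite size_mkseq => ni; rewrite nth_mkseq.
  rewrite /F ifT//; apply/asboolP; rewrite size_mkseq; split => //; by exists w.
rewrite /F; case: ifP => // /asboolP[sl [w' [cw' Yw']]] cw.
rewrite /= (dG w w')// => i ni; rewrite cw ?cw' ?sl//.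
Qed.

Variable om : seq nat -> T.
Hypothesis om_cylinder : forall l, all (fun x => x < S.+1)%N l -> cylinder l (om l).

(** Induction on the number m of letters still to be drawn: the cylinder splits according to its
    next letter. Letters above S are possible outcomes but carry no mass, since [p0] sums to 1 on
    {0, ..., S}. *)
Lemma integral_cylinder n G (M : R) : determined n G -> (forall w, `|G w| <= M) ->
  forall m l, (size l + m)%N = n -> all (fun x => x < S.+1)%N l ->
  (\int[P]_(w in cylinder l) (G w)%:E =
  ((\prod_(x <- l) p0 x) * iid_expect S.+1 m p0 (fun l' => G (om (l ++ l'))))%:E)%E.
Proof.
move=> dG GM.
have mG := measurable_determined dG.
elim=> [|m IH] l sl al.
  rewrite addn0 in sl.
  rewrite (eq_integral (fun=> (G (om l))%:E)).
    rewrite integral_cst/= ?cats0; last exact: measurable_cylinder.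
    by rewrite [P _]prob_cylinder -EFinM mulrC /iid_expect /= cats0.
  move=> w; rewrite inE => cw; congr EFin; apply: dG => i.
  by rewrite -sl => il; rewrite cw// (om_cylinder al).
pose F x := cylinder (rcons l x).
pose U := \big[setU/set0]_(x <- iota 0 S.+1) F x.
have mF x : measurable (F x) by exact: measurable_cylinder.
have mU : measurable U by exact: bigsetU_measurable.
have tF : trivIset [set` iota 0 S.+1] F.
  move=> x y _ _ [w [Fx Fy]].
  have := Fx (size l); have := Fy (size l).
  by rewrite !size_rcons !nth_rcons ltnn eqxx => -> // ->.
have UF : U `<=` cylinder l.
  rewrite /U; elim: (iota 0 S.+1) => [|x s IHs]; first by rewrite big_nil.
  rewrite big_cons subUset; split => // w Fw i il.
  by rewrite Fw ?size_rcons ?nth_rcons ?il// ltnS ltnW.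
have sumE (f : nat -> R) : \sum_(x <- iota 0 S.+1) f x = \sum_(x < S.+1) f x.
  by rewrite -[iota 0 S.+1]/(index_iota 0 S.+1) big_mkord.
have PU : P U = P (cylinder l).
  have := @integral_bigsetU_EFin _ _ _ P _ F (fun=> 1) _ mF (iota_uniq 0 S.+1) tF _.
  rewrite -/U => h.
  rewrite -[LHS]mul1e -[X in (X * _)%E]/(1%:E)%E -integral_cst// h//.
    have e x : (\int[P]_(_ in F x) 1 = ((\prod_(y <- l) p0 y) * p0 x)%:E)%E.
      rewrite integral_cst// mul1e; apply: etrans (prob_cylinder _) _.
      by rewrite -cats1 big_cat big_seq1.
    under eq_bigr do rewrite e.
      by rewrite sumEFin sumE -mulr_sumr p0_sum1 mulr1 prob_cylinder.
  exact: measurable_cst.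
have mC := measurable_cylinder l.
have N0 : P (cylinder l `\` U) = 0%E.
  have fC : P (cylinder l) \is a fin_num by exact: fin_num_measure.
  have lC : (P (cylinder l) < +oo)%E by rewrite -ge0_fin_numE.
  apply: etrans (measureD mC mU lC) _.
  transitivity (P (cylinder l) - P (cylinder l))%E; last by rewrite subee.
  by congr (_ - _)%E; rewrite setIidr//; exact: PU.
have iG : P.-integrable (cylinder l) (EFin \o G).
  apply: (@integrableS _ _ _ P setT) => //.
  apply: measurable_bounded_integrable => //.
    by rewrite -ge0_fin_numE ?fin_num_measure.
  by exists M; split => //= x Mx w _ /=; exact: le_trans (GM w) (ltW Mx).
rewrite (negligible_integral (measurableD mC mU) mC iG N0).
rewrite setDD setIidr//.
rewrite integral_bigsetU_EFin// ?iota_uniq//; last first.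
  by apply: measurable_funTS; exact/measurable_EFinP.
rewrite -[iota 0 S.+1]/(index_iota 0 S.+1) big_mkord.
have e (x : 'I_S.+1) : (\int[P]_(w in F x) (G w)%:E = ((\prod_(y <- rcons l x) p0 y) *
    iid_expect S.+1 m p0 (fun l' => G (om (rcons l x ++ l'))))%:E)%E.
  by rewrite IH// ?size_rcons ?addSnnS// all_rcons ltn_ord.
rewrite (eq_bigr _ (fun x _ => e x)).
rewrite sumEFin /iid_expect /= mulr_sumr; congr EFin; apply: eq_bigr => x _.
rewrite -cats1 big_cat big_seq1 /= mulrA; congr (_ * _).
by apply: eq_expect => l' _ _; rewrite -catA.
Qed.

Lemma integral_determined n G (M : R) : determined n G -> (forall w, `|G w| <= M) ->
  (\int[P]_w (G w)%:E = (iid_expect S.+1 n p0 (fun l => G (om l)))%:E)%E.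
Proof.
move=> dG GM; have := @integral_cylinder n G M dG GM n [::] erefl isT.
by rewrite big_nil mul1r => <-; congr integral; apply/seteqP; split.
Qed.

Lemma prob_determined n (A : set T) :
  determined n (fun w => \1_A w) ->
  P A = (iid_expect S.+1 n p0 (fun l => \1_A (om l)))%:E.
Proof.
move=> dA.
rewrite -(integral_determined (M := 1) dA); last first.
  by move=> w; rewrite indicE; case: (_ \in _); rewrite ?normr1 ?normr0.
rewrite integral_indic ?setIT//.
have := measurable_determined dA measurableT (measurable_set1 1).
rewrite setTI (_ : _ @^-1` _ = A)//; apply/seteqP; split => w /=; rewrite indicE.
  by move=> h; apply: set_mem; move: h; case: (_ \in _) => // /eqP; rewrite eq_sym oner_eq0.
by move=> Aw; rewrite mem_set.
Qed.

End FiniteLaw.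

(** * Expectations of cosines under normal laws *)

Section BridgeCosine.
Variable R : realType.
Notation mu := (@lebesgue_measure R).

Lemma integral_normal_prob (s : R) (f : R -> \bar R) :
  (normal_prob 0 s).-integrable [set: R] f ->
  (\int[normal_prob 0 s]_x f x = \int[mu]_x (f x * (normal_pdf 0 s x)%:E))%E.
Proof.
move=> fi.
have dom := @normal_prob_dominates R 0 s.
rewrite -(Radon_Nikodym_change_of_variables dom)//=.
have mf := measurable_int _ fi.
apply: ae_eq_integral => //.
- exact: emeasurable_funM.
- apply: emeasurable_funM => //; apply/measurable_EFinP; exact: measurable_normal_pdf.
- apply: ae_eqe_mul2l => /=.
  rewrite Radon_NikodymE//=.
  case: cid => /= h [h1 h2 h3].
  apply: integral_ae_eq => //=.
  + by apply/measurable_EFinP; exact: measurable_normal_pdf.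
  + by move=> E _ mE; rewrite -h3.
Qed.

Lemma integral_normal_cos (s th : R) : s != 0 ->
  (\int[normal_prob 0 s]_x (cos (x + th))%:E = (expR (- (s ^+ 2 / 2)) * cos th)%:E)%E.
Proof.
move=> s0.
have mc : measurable_fun [set: R] (fun x : R => cos (x + th)).
  apply: continuous_measurable_fun => x.
  by have := @continuous_affine_cos R 1 th x; under eq_fun do rewrite mul1r.
have := @normal_char R s 1 th s0.
rewrite expr1n mul1r => <-; rewrite integral_normal_prob; last first.
  apply: measurable_bounded_integrable => //.
    by rewrite -ge0_fin_numE ?fin_num_measure.
  by exists 1; split => //= x Mx w _ /=; exact: le_trans (cos_max _) (ltW Mx).
rewrite /Rintegral fineK; last first.
  apply: integrable_fin_num => //; exact: integrable_cos_normal_pdf.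
by apply: eq_integral => x _; rewrite mul1r EFinM.
Qed.

Lemma centered_normal_cos d (T : measurableType d) (Q : probability T R) (Y : T -> R) (v th : R) :
  measurable_fun [set: T] Y -> 0 <= v ->
  (forall A : set R, measurable A -> Q (Y @^-1` A) = centered_normal_law v A) ->
  (\int[Q]_w (cos (Y w + th))%:E = (expR (- (v / 2)) * cos th)%:E)%E.
Proof.
move=> mY v0 lawY.
have mc : measurable_fun [set: R] (fun x : R => cos (x + th)).
  apply: continuous_measurable_fun => x.
  by have := @continuous_affine_cos R 1 th x; under eq_fun do rewrite mul1r.
have mcE : measurable_fun [set: R] (fun x : R => (cos (x + th))%:E) by exact/measurable_EFinP.
have ic : Q.-integrable (Y @^-1` setT) ((fun x : R => (cos (x + th))%:E) \o Y).
  rewrite preimage_setT.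
  have -> : (fun x : R => (cos (x + th))%:E) \o Y = EFin \o (fun w => cos (Y w + th)) by [].
  apply: measurable_bounded_integrable => //.
  - by rewrite -ge0_fin_numE ?fin_num_measure.
  - exact: (measurableT_comp mc mY).
  - by exists 1; split => //= x Mx w _ /=; exact: le_trans (cos_max _) (ltW Mx).
have mY' : @measurable_fun _ _ T (measurableTypeR R) [set: T] Y := mY.
have mcE' : @measurable_fun _ _ (measurableTypeR R) _ setT (fun x : R => (cos (x + th))%:E) := mcE.
have := integral_pushforward mY' mcE' ic measurableT.
rewrite preimage_setT => <-.
have [v00|vn0] := eqVneq v 0.
  rewrite (@eq_measure_integral _ _ _ _ (@dirac _ (measurableTypeR R) 0 R)); last first.
    by move=> A mA _; rewrite /= /pushforward lawY// /centered_normal_law v00 eqxx /dirac.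
  by rewrite integral_dirac// diracT mul1e add0r v00 mul0r oppr0 expR0 mul1r.
have s0 : Num.sqrt v != 0 by rewrite sqrtr_eq0 -ltNge lt0r vn0.
rewrite (@eq_measure_integral _ _ _ _ (normal_prob 0 (Num.sqrt v))); last first.
  by move=> A mA _; rewrite /= /pushforward lawY// /centered_normal_law (negbTE vn0).
by rewrite integral_normal_cos// sqr_sqrtr.
Qed.

End BridgeCosine.

(** * Convex least squares *)

Section LeastSquares.
Variable R : realType.
Implicit Types (p q h a b : nat -> R) (K k : nat).

Local Notation series a := (\sum_(0 <= k <oo) (a k)%:E)%E.

Lemma series_split a K : (forall k, 0 <= a k) ->
  (series a = (\sum_(k < K) a k)%:E + \sum_(K <= k <oo) (a k)%:E)%E.
Proof.
move=> a0; rewrite (nneseries_split 0 K); last by move=> k _; rewrite lee_fin.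
by rewrite add0n big_mkord sumEFin.
Qed.

Lemma series_tail_ge0 a K : (forall k, 0 <= a k) -> (0 <= \sum_(K <= k <oo) (a k)%:E)%E.
Proof. by move=> a0; apply: nneseries_ge0 => k _ _; rewrite lee_fin. Qed.

Lemma partial_sum_le_series a K : (forall k, 0 <= a k) -> ((\sum_(k < K) a k)%:E <= series a)%E.
Proof. by move=> a0; rewrite (series_split K a0) leeDl// series_tail_ge0. Qed.

Lemma ler_series a b : (forall k, 0 <= a k <= b k) -> (series a <= series b)%E.
Proof.
move=> ab; apply: lee_nneseries => k *; rewrite lee_fin.
  by case/andP: (ab k).
by case/andP: (ab k).
Qed.

Lemma seriesD a b : (forall k, 0 <= a k) -> (forall k, 0 <= b k) ->
  (series (fun k => a k + b k)%R = series a + series b)%E.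
Proof.
move=> a0 b0; rewrite -nneseriesD; try by move=> k _ _; rewrite lee_fin.
by apply: eq_eseriesr => k _; rewrite EFinD.
Qed.

Lemma series_finite_support a K : (forall k, 0 <= a k) -> (forall k, (K <= k)%N -> a k = 0) ->
  (series a = (\sum_(k < K) a k)%:E)%E.
Proof.
move=> a0 aK; rewrite (series_split K a0) eseries0 ?adde0// => k Kk _.
by rewrite aK.
Qed.

Lemma LS_crit_fin q p K : (forall k, (K <= k)%N -> q k = 0) -> in_C p ->
  (LS_crit q p < +oo)%E.
Proof.
move=> qK [_ p2].
apply: (@le_lt_trans _ _ (series (fun k => q k ^+ 2 + p k ^+ 2))).
  apply: ler_series => k; rewrite mulr_ge0 ?sqr_ge0//=.
  by have := sqr_ge0 (q k + p k); lra.
rewrite seriesD; try by move=> k; exact: sqr_ge0.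
rewrite lte_add_pinfty// (@series_finite_support _ K) ?ltry// => k; first exact: sqr_ge0.
by move=> Kk; rewrite qK// expr0n.
Qed.

Lemma LS_crit_split q p K :
  (LS_crit q p = (\sum_(k < K) (2^-1 * (q k - p k) ^+ 2))%:E + \sum_(K <= k <oo) (2^-1 * (q k - p k) ^+ 2)%:E)%E.
Proof. by apply: series_split => k; rewrite mulr_ge0 ?sqr_ge0. Qed.

Lemma in_C_local p h K : in_C p -> (forall k, (K <= k)%N -> h k = 0) ->
  (forall k, (1 <= k)%N -> 0 <= Delta (fun i => p i + h i) k) -> in_C (fun i => p i + h i).
Proof.
move=> [_ p2] hK cph; split => //.
rewrite (series_split K); last by move=> k; exact: sqr_ge0.
rewrite lte_add_pinfty ?ltry//.
apply: le_lt_trans p2.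
rewrite (series_split K (fun k => sqr_ge0 (p k))) -[leLHS]add0e leeD// ?lee_fin ?sumr_ge0//.
  by move=> i _; exact: sqr_ge0.
rewrite le_eqVlt; apply/orP; left; apply/eqP.
rewrite eseries_cond [RHS]eseries_cond; apply: eq_eseriesr => k /= Kk.
by rewrite hK// addr0.
Qed.

(** For a finitely supported direction h the infinite tails of the two criteria coincide and, being
    finite, cancel. What remains is a quadratic inequality in the step length t. *)
Lemma LSE_variation q p h K : (forall k, (K <= k)%N -> q k = 0) -> is_LSE q p ->
  (forall k, (K <= k)%N -> h k = 0) ->
  (forall k, (1 <= k)%N -> 0 <= Delta (fun i => p i + h i) k) ->
  0 <= \sum_(k < K) (p k - q k) * h k.
Proof.
move=> qK [pC pmin] hK cph.
set A := \sum_(k < K) _; pose B := \sum_(k < K) h k ^+ 2.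
have B0 : 0 <= B by apply: sumr_ge0 => k _; exact: sqr_ge0.
have key (t : R) : 0 < t -> t <= 1 -> 0 <= t * A + 2^-1 * (t ^+ 2 * B).
  move=> t0 t1.
  have thC : in_C (fun i => p i + t * h i).
    apply: (@in_C_local _ (fun i => t * h i) K) => // [k Kk|k k1]; first by rewrite hK ?mulr0.
    have -> : Delta (fun i => p i + t * h i) k = (1 - t) * Delta p k + t * Delta (fun i => p i + h i) k.
      by rewrite /Delta; ring.
    by rewrite addr_ge0// mulr_ge0 ?cph ?subr_ge0 ?(ltW t0)//; exact: pC.1.
  have := pmin _ thC; rewrite (LS_crit_split _ _ K) [leRHS](LS_crit_split _ _ K).
  have -> : (\sum_(K <= k <oo) (2^-1 * (q k - (p k + t * h k)) ^+ 2)%:E =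
     \sum_(K <= k <oo) (2^-1 * (q k - p k) ^+ 2)%:E)%E.
    rewrite eseries_cond [RHS]eseries_cond; apply: eq_eseriesr => k /= Kk.
    by rewrite hK// mulr0 addr0.
  have tf : (\sum_(K <= k <oo) (2^-1 * (q k - p k) ^+ 2)%:E \is a fin_num)%E.
    rewrite ge0_fin_numE; last by apply: series_tail_ge0 => k; rewrite mulr_ge0 ?sqr_ge0.
    apply: le_lt_trans (LS_crit_fin qK pC); rewrite (LS_crit_split _ _ K) leeDr// lee_fin.
    by apply: sumr_ge0 => k _; rewrite mulr_ge0 ?sqr_ge0.
  rewrite leeD2rE// lee_fin -subr_ge0 -sumrB.
  rewrite /A /B !mulr_sumr -big_split /=; congr (0 <= _); apply: eq_bigr => k _; by field.
rewrite leNgt; apply/negP => A0.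
pose t := - A / (B - A).
have BA : 0 < B - A by lra.
have t0 : 0 < t by rewrite divr_gt0//; lra.
have t1 : t <= 1 by rewrite ler_pdivrMr//; lra.
have := key t t0 t1.
have -> : t * A + 2^-1 * (t ^+ 2 * B) = t * (A + 2^-1 * (t * B)) by ring.
rewrite pmulr_rge0// => H.
have tB : t * B <= - A by rewrite /t mulrAC ler_pdivrMr//; nra.
lra.
Qed.

(** A single term of the criterion at p is bounded by the whole criterion at p'. With p' = p0,
    closeness of the empirical pmf to p0 passes to the estimator. *)
Lemma LSE_bound q p p' K : is_LSE q p -> in_C p' ->
  (forall k, (K <= k)%N -> q k = 0) -> (forall k, (K <= k)%N -> p' k = 0) ->
  forall k, (p k - q k) ^+ 2 <= \sum_(j < K) (q j - p' j) ^+ 2.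
Proof.
move=> [pC pmin] p'C qK p'K k.
have := pmin _ p'C.
have -> : LS_crit q p' = (\sum_(j < K) 2^-1 * (q j - p' j) ^+ 2)%:E.
  apply: series_finite_support => j; first by rewrite mulr_ge0 ?sqr_ge0.
  by move=> Kj; rewrite qK// p'K// subrr expr0n mulr0.
move=> le1.
have : ((\sum_(j < k.+1) 2^-1 * (q j - p j) ^+ 2)%:E <= (\sum_(j < K) 2^-1 * (q j - p' j) ^+ 2)%:E)%E.
  by apply: le_trans le1; apply: partial_sum_le_series => j; rewrite mulr_ge0 ?sqr_ge0.
rewrite lee_fin -!mulr_sumr ler_pM2l ?invr_gt0//; apply: le_trans.
rewrite big_ord_recr /= -[leLHS]add0r lerD//; first by apply: sumr_ge0 => j _; exact: sqr_ge0.
by rewrite -sqrrN opprB.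
Qed.

(** Parallelogram law at the midpoint of p and p', which is again admissible; finiteness of the
    criterion permits cancellation in the extended reals. *)
Lemma LSE_uniq q p p' K : (forall k, (K <= k)%N -> q k = 0) ->
  is_LSE q p -> is_LSE q p' -> p = p'.
Proof.
move=> qK [pC pmin] [p'C p'min].
pose m k := 2^-1 * p k + 2^-1 * p' k.
have mC : in_C m.
  case: pC p'C => cp p2 [cp' p2']; split.
    move=> k k1; have -> : Delta m k = 2^-1 * Delta p k + 2^-1 * Delta p' k by rewrite /Delta /m; ring.
    by rewrite addr_ge0// mulr_ge0 ?cp ?cp'.
  apply: (@le_lt_trans _ _ (series (fun k => p k ^+ 2 + p' k ^+ 2))).
    apply: ler_series => k; rewrite sqr_ge0 /=.
    by rewrite /m; have := sqr_ge0 (p k - p' k); have := sqr_ge0 (p k); have := sqr_ge0 (p' k); lra.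
  by rewrite seriesD ?lte_add_pinfty// => k; exact: sqr_ge0.
have LSE2 : LS_crit q p = LS_crit q p'.
  by apply/le_anti; rewrite pmin// p'min.
have fp := LS_crit_fin qK pC.
have n0 a k : 0 <= 2^-1 * (q k - a k) ^+ 2 by rewrite mulr_ge0 ?sqr_ge0.
have d0 k : 0 <= 4^-1 * (p k - p' k) ^+ 2 by rewrite mulr_ge0 ?sqr_ge0.
have E : (LS_crit q m + LS_crit q m + series (fun k => 4^-1 * (p k - p' k) ^+ 2)%R = LS_crit q p + LS_crit q p')%E.
  rewrite /LS_crit -!seriesD//; last by move=> k; rewrite addr_ge0.
  by apply: eq_eseriesr => k _; congr EFin; rewrite /m; field.
have fm : LS_crit q m \is a fin_num.
  by rewrite ge0_fin_numE ?(LS_crit_fin qK mC)//; exact: series_tail_ge0.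
have fp' : LS_crit q p \is a fin_num by rewrite ge0_fin_numE//; exact: series_tail_ge0.
have D0 : (series (fun k => 4^-1 * (p k - p' k) ^+ 2)%R <= 0)%E.
  have : (LS_crit q p + LS_crit q p + series (fun k => 4^-1 * (p k - p' k) ^+ 2)%R <= LS_crit q p + LS_crit q p + 0)%E.
    by rewrite adde0 {4}LSE2 -E leeD2r// leeD// pmin.
  by rewrite leeD2lE// fin_numD fp'.
apply/funext => k; apply/eqP; rewrite -subr_eq0 -sqrf_eq0 eq_le sqr_ge0 andbT.
have := le_trans (partial_sum_le_series k.+1 d0) D0.
rewrite lee_fin big_ord_recr /= => h.
have : 0 <= \sum_(i < k) 4^-1 * (p i - p' i) ^+ 2 by apply: sumr_ge0.
by lra.
Qed.

End LeastSquares.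

(** * Multinomial central limit theorem *)

Section CentralLimit.
Variables (R : realType) (p0 : nat -> R) (S m : nat).
Hypothesis p0w : weight S.+1 p0.
Hypothesis mS : (m <= S.+1)%N.
Variables (d : measure_display) (T : measurableType d) (Q : probability T R).
Variable U : T -> R -> R.
Hypothesis bU : brownian_bridge Q U.

(** The linear form with coefficients [t] at the centred indicator vector of the letter x. *)
Definition centered_test (t : nat -> R) (x : nat) : R :=
  (if (x < m)%N then t x else 0) - \sum_(k < m) t k * p0 k.

Lemma sum_restrict (f : nat -> R) :
  \sum_(x < S.+1) (if (x < m)%N then f x else 0) = \sum_(k < m) f k.
Proof. by rewrite (big_ord_widen S.+1 f mS) [RHS]big_mkcond. Qed.

Lemma centered_test_mean t : \sum_(x < S.+1) p0 x * centered_test t x = 0.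
Proof.
rewrite /centered_test.
under eq_bigr do rewrite mulrBr.
rewrite sumrB -mulr_suml p0w.2 mul1r.
rewrite (eq_bigr (fun x : 'I_S.+1 => if (x < m)%N then t x * p0 x else 0)); last first.
  by move=> x _; case: ifP; rewrite ?mulr0// mulrC.
by rewrite (sum_restrict (fun x => t x * p0 x)) subrr.
Qed.

Lemma centered_test_var t : \sum_(x < S.+1) p0 x * centered_test t x ^+ 2 =
  \sum_(k < m) t k ^+ 2 * p0 k - (\sum_(k < m) t k * p0 k) ^+ 2.
Proof.
rewrite /centered_test; set mu := \sum_(k < m) _.
rewrite (eq_bigr (fun x : 'I_S.+1 => (if (x < m)%N then t x ^+ 2 * p0 x else 0)
  - 2 * mu * (if (x < m)%N then t x * p0 x else 0) + mu ^+ 2 * p0 x)); last first.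
  by move=> x _; case: ifP => _; ring.
rewrite big_split sumrB -!mulr_sumr /= p0w.2 (sum_restrict (fun x => t x ^+ 2 * p0 x)).
by rewrite (sum_restrict (fun x => t x * p0 x)) -/mu; ring.
Qed.

Let F k := \sum_(j < k) p0 j.

Lemma cumulative_mono i j : (i <= j <= S.+1)%N -> F i <= F j.
Proof.
move=> /andP[ij jS]; rewrite /F (big_ord_widen j p0 ij) [leRHS](bigID (fun k : 'I_j => (k < i)%N)) /=.
by rewrite lerDl sumr_ge0// => k _; apply: p0w.1; rewrite (leq_trans _ jS).
Qed.

Lemma cumulative_01 k : (k <= S.+1)%N -> 0 <= F k <= 1.
Proof.
move=> kS; have := @cumulative_mono k S.+1; have := @cumulative_mono 0 k.
by rewrite /F p0w.2 big_ord0 leq0n leqnn kS => -> // ->.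
Qed.

(** The mixed second difference of min(F k, F l) is the length of the overlap of ]F k, F (k + 1)]
    and ]F l, F (l + 1)]: p0 k on the diagonal, 0 off it. *)
Lemma bridge_increment_cov (t : nat -> R) (k l : nat) : (k < m)%N -> (l < m)%N ->
  Num.min (F k.+1) (F l.+1) - Num.min (F k.+1) (F l) - Num.min (F k) (F l.+1) + Num.min (F k) (F l)
  = if k == l then p0 k else 0.
Proof.
move=> km lm.
have mn i j : (i <= j <= S.+1)%N -> Num.min (F i) (F j) = F i.
  by move=> ij; apply/min_idPl/cumulative_mono.
have mn' i j : (i <= j <= S.+1)%N -> Num.min (F j) (F i) = F i.
  by move=> ij; apply/min_idPr/cumulative_mono.
have [kl|lk|<-] := ltngtP k l.
- by rewrite !mn; [ring|lia..].
- by rewrite !mn'; [ring|lia..].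
- rewrite mn ?leqnn ?(leq_trans km)// mn' ?leqnSn ?(leq_trans km)// mn ?leqnSn ?(leq_trans km)//.
  rewrite mn ?leqnn ?(leq_trans (ltnW km))// /F big_ord_recr /=; ring.
Qed.

(** The variance of the sum of t k W(k) is the multinomial one: the minimum in the bridge covariance
    gives the diagonal part, the product gives the squared mean. *)
Lemma bridge_cos (t : nat -> R) (th : R) :
  (\int[Q]_w (cos (\sum_(k < m) t k * Wvec p0 (U w) k + th))%:E =
   (expR (- (\sum_(x < S.+1) p0 x * centered_test t x ^+ 2) / 2) * cos th)%:E)%E.
Proof.
(* Each increment is a difference of two bridge values, so the form is written over 2 m times: right
   endpoints with coefficient t, then left endpoints with coefficient - t. *)
pose c (i : 'I_(m + m)) := if (i < m)%N then t i else - t (i - m)%N.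
pose s (i : 'I_(m + m)) := if (i < m)%N then F i.+1 else F (i - m)%N.
have cl (k : 'I_m) : c (lshift m k) = t k by rewrite /c /= ltn_ord.
have cr (k : 'I_m) : c (rshift m k) = - t k by rewrite /c /= ltnNge leq_addr /= addKn.
have sl (k : 'I_m) : s (lshift m k) = F k.+1 by rewrite /s /= ltn_ord.
have sr (k : 'I_m) : s (rshift m k) = F k by rewrite /s /= ltnNge leq_addr /= addKn.
have s01 i : 0 <= s i <= 1.
  rewrite /s; case: ifP => im; apply: cumulative_01; first by rewrite (leq_trans im).
  by rewrite (leq_trans _ mS)//; have := ltn_ord i; lia.
have [_ mU law] := bU.
have mY : measurable_fun [set: T] (fun w => \sum_(i < m + m) c i * U w (s i)).
  by apply: measurable_sum => i; apply: measurable_funM.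
set v := \sum_(x < S.+1) _.
have v0 : 0 <= v by apply: sumr_ge0 => x _; rewrite mulr_ge0 ?sqr_ge0 ?p0w.1.
have vE : \sum_(i < m + m) \sum_(j < m + m) c i * c j * (Num.min (s i) (s j) - s i * s j) = v.
  rewrite /v centered_test_var big_split_ord /= -big_split /=.
  rewrite (eq_bigr (fun k : 'I_m => t k ^+ 2 * p0 k - (\sum_(l < m) t l * p0 l) * (t k * p0 k))); last first.
    move=> k _; rewrite !big_split_ord /= -!big_split /=.
    rewrite (eq_bigr (fun l : 'I_m => (if l == k then t k ^+ 2 * p0 k else 0) - t l * p0 l * (t k * p0 k))); last first.
      move=> l _; rewrite !cl !cr !sl !sr.
      have := bridge_increment_cov t (ltn_ord k) (ltn_ord l).
      have -> : F k.+1 = F k + p0 k by rewrite /F big_ord_recr.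
      have -> : F l.+1 = F l + p0 l by rewrite /F big_ord_recr.
      move: (Num.min _ _) (Num.min _ _) (Num.min _ _) (Num.min _ _) => a b e f H.
      have [lk|lk] := eqVneq l k.
        move: H; rewrite lk eqxx => H.
        have -> : a = b + e - f + p0 k by rewrite -H; ring.
        ring.
      move: H; rewrite ifF; last by apply/negbTE; rewrite eq_sym; apply: contra_neq lk => /val_inj.
      move=> H; have -> : a = b + e - f by rewrite -[LHS]subr0 -H; ring.
      ring.
    by rewrite sumrB -mulr_suml -big_mkcond /= big_pred1_eq.
  by rewrite sumrB -mulr_sumr; ring.
have lawY (A : set R) : measurable A -> Q ((fun w => \sum_(i < m + m) c i * U w (s i)) @^-1` A) = centered_normal_law v A.
  by move=> mA; have := law _ s c s01 A mA; rewrite vE.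
have := centered_normal_cos th mY v0 lawY.
rewrite mulNr => <-; apply: eq_integral => w _; congr (cos (_ + _))%:E.
rewrite big_split_ord /= -big_split /=; apply: eq_bigr => k _.
by rewrite cl cr sl sr /Wvec -/(F _) -/(F _); ring.
Qed.

(** For a word [l] of length n this is sqrt n times the error of the empirical pmf at k. *)
Definition empirical_fluct n (l : seq nat) (k : nat) : R :=
  (\sum_(x <- l) ((x == k)%:R - p0 k)) / Num.sqrt n%:R.

Lemma empirical_fluct_test n l (t : nat -> R) :
  \sum_(k < m) t k * empirical_fluct n l k = (\sum_(x <- l) centered_test t x) / Num.sqrt n%:R.
Proof.
rewrite /empirical_fluct; under eq_bigr do rewrite mulrA.
rewrite -mulr_suml; congr (_ / _).
under eq_bigr do rewrite mulr_sumr.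
rewrite exchange_big; apply: eq_bigr => x _ /=.
under eq_bigr do rewrite mulrBr.
rewrite sumrB /centered_test; congr (_ - _).
case: ifPn => xm.
  rewrite (bigD1 (Ordinal xm))//= eqxx mulr1 big1 ?addr0// => k kx.
  by rewrite [x == k]eq_sym (_ : (k : nat) == x = false) ?mulr0//; apply: contraNF kx => /eqP kx; apply/eqP/val_inj.
by rewrite big1// => k _; rewrite (_ : (x == k) = false) ?mulr0//; apply: contraNF xm => /eqP ->.
Qed.

Lemma empirical_fluct_sqr n k : (0 < n)%N -> (k <= S)%N ->
  iid_expect S.+1 n p0 (fun l => empirical_fluct n l k ^+ 2) <= 1.
Proof.
move=> n0 kS.
have mean0 : \sum_(x < S.+1) p0 x * ((x == k :> nat)%:R - p0 k) = 0.
  under eq_bigr do rewrite mulrBr.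
  rewrite sumrB -mulr_suml p0w.2 mul1r (bigD1 (Ordinal (kS : (k < S.+1)%N)))//= eqxx mulr1 big1 ?addr0 ?subrr// => j jk.
  by rewrite (_ : (j : nat) == k = false) ?mulr0//; apply: contraNF jk => /eqP jk; apply/eqP/val_inj.
have n00 : 0 < n%:R :> R by rewrite ltr0n.
rewrite /iid_expect (@eq_expect _ _ _ _ (fun l => n%:R^-1 * (0 + \sum_(x <- l) ((x == k)%:R - p0 k)) ^+ 2)); last first.
  by move=> l _ _; rewrite /empirical_fluct exprMn exprVn sqr_sqrtr ?ler0n// add0r mulrC.
rewrite expectZ -/(iid_expect _ _ _ _) (@iid_expect_sum_sqr _ S.+1 n p0 (fun x => (x == k)%:R - p0 k) 0 p0w mean0).
rewrite expr0n add0r mulrA mulVf ?gt_eqF// mul1r -[leRHS]p0w.2; apply: ler_sum => x _.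
rewrite ler_piMr ?p0w.1//.
have p0k : 0 <= p0 k <= 1.
  rewrite p0w.1//= -p0w.2 (bigD1 (Ordinal (kS : (k < S.+1)%N)))//= lerDl sumr_ge0// => j _.
  exact: p0w.1.
by case: (_ == _); rewrite ?mulr1n ?mulr0n; nra.
Qed.

Lemma measurable_Wvec k : measurable_fun [set: T] (fun w => Wvec p0 (U w) k).
Proof. by have [_ mU _] := bU; apply: measurable_funB. Qed.

(** Both sides are linear in [tau], so the cosine case extends by induction. Measurability and
    boundedness travel along because additivity of the integral requires integrable summands. *)
Lemma clt_trig tau : trig m tau -> exists c : R, [/\
  measurable_fun [set: T] (fun w => tau (Wvec p0 (U w))),
  exists B : R, forall x, `|tau x| <= B,
  (\int[Q]_w (tau (Wvec p0 (U w)))%:E = c%:E)%E &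
  iid_expect S.+1 n p0 (fun l => tau (empirical_fluct n l)) @[n --> \oo] --> c].
Proof.
elim=> {tau} [a t th|f g _ [c [mf [B fB] If cf]] _ [c' [mg [B' gB] Ig cg]]].
  exists (a * (expR (- (\sum_(x < S.+1) p0 x * centered_test t x ^+ 2) / 2) * cos th)).
  have mc : measurable_fun [set: T] (fun w => cos (\sum_(k < m) t k * Wvec p0 (U w) k + th)).
    apply: (measurableT_comp (f := @cos R)).
      by apply: continuous_measurable_fun; exact: continuous_cos.
    apply: measurable_funD => //; apply: measurable_sum => k.
    by apply: measurable_funM => //; exact: measurable_Wvec.
  split.
  - by apply: measurable_funM.
  - by exists `|a| => x; rewrite normrM ler_piMr// cos_max.
  - under eq_integral do rewrite EFinM.
    rewrite integralZl//; first by rewrite bridge_cos.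
    apply: measurable_bounded_integrable => //.
      by rewrite -ge0_fin_numE ?fin_num_measure.
    by exists 1; split => //= x Mx w _ /=; exact: le_trans (cos_max _) (ltW Mx).
  - have h := @cos_clt R S.+1 p0 (centered_test t) (\sum_(k < S.+1) `|centered_test t k|) th p0w.
    rewrite (_ : (fun n => _) = (fun n => a * iid_expect S.+1 n p0 (fun l => cos (th + (\sum_(x <- l) centered_test t x) / Num.sqrt n%:R)))).
      apply: cvgM; first exact: cvg_cst.
      apply: h; [exact: sumr_ge0| |exact: centered_test_mean].
      by move=> x xS; rewrite (bigD1 (Ordinal xS))//= lerDl; exact: sumr_ge0.
    apply/funext => n; rewrite -expectZ; apply: eq_expect => l _ _.
    by rewrite empirical_fluct_test addrC.
have ib (h : (nat -> R) -> R) (B0 : R) : measurable_fun [set: T] (fun w => h (Wvec p0 (U w))) -> (forall x, `|h x| <= B0) ->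
    Q.-integrable [set: T] (fun w => (h (Wvec p0 (U w)))%:E).
  move=> mh hB; apply: (@measurable_bounded_integrable _ _ _ Q (fun w => h (Wvec p0 (U w)))) => //.
    by rewrite -ge0_fin_numE ?fin_num_measure.
  by exists B0; split => //= x Mx w _ /=; exact: le_trans (hB _) (ltW Mx).
exists (c + c'); split.
- exact: measurable_funD.
- by exists (B + B') => x; apply: le_trans (ler_normD _ _) _; rewrite lerD.
- under eq_integral do rewrite EFinD.
  by rewrite integralD//; [rewrite If Ig EFinD|exact: (ib f B)|exact: (ib g B')].
- under eq_fun do rewrite /iid_expect expectD.
  exact: cvgD.
Qed.

Definition tail_event (L : nat) : set T :=
  [set w | exists2 k, (k < m)%N & L%:R < `|Wvec p0 (U w) k|].

Lemma measurable_tail_event L : measurable (tail_event L).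
Proof.
rewrite (_ : tail_event L = \bigcup_(k in `I_m) ((fun w => `|Wvec p0 (U w) k|) @^-1` `]L%:R, +oo[%classic)); last first.
  apply/seteqP; split => w.
    by move=> [k km Lk]; exists k => //=; rewrite in_itv/= andbT.
  by move=> [k /= km]; rewrite in_itv/= andbT => Lk; exists k.
apply: bigcup_measurable => k _; rewrite -[X in measurable X]setTI.
have mn : measurable_fun [set: T] (fun w => `|Wvec p0 (U w) k|).
  by apply: measurableT_comp; [apply: continuous_measurable_fun; exact: norm_continuous|exact: measurable_Wvec].
by apply: mn => //; exact: measurable_itv.
Qed.

(** The tail events decrease to the empty set, so continuity of Q from above applies. *)
Lemma Wvec_tight (eps : R) : 0 < eps -> exists L0 : nat, forall L : nat, (L0 <= L)%N ->
  (Q (tail_event L) <= eps%:E)%E.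
Proof.
move=> eps0.
pose A := tail_event; have mA := measurable_tail_event.
have A0 : \bigcap_L A L = set0.
  apply/seteqP; split => // w h.
  pose M := \sum_(k < m) `|Wvec p0 (U w) k|.
  have [k km] := h (Num.trunc M).+1 I.
  rewrite ltNge => /negP; apply; apply: ltW; apply: le_lt_trans (truncnS_gt M).
  by rewrite /M (bigD1 (Ordinal km))//= lerDl sumr_ge0.
have dA : {homo A : n' m' / (n' <= m')%N >-> (n' >= m')%O}.
  move=> i j ij; apply/subsetPset => w [k km jk]; exists k => //.
  by apply: le_lt_trans jk; rewrite ler_nat.
have h : (Q \o A) n @[n --> \oo] --> Q (\bigcap_n A n).
  apply: nonincreasing_cvg_mu => //; first by rewrite -ge0_fin_numE ?fin_num_measure.
  by rewrite A0.
rewrite A0 [Q set0]measure0 in h.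
have /fine_cvgP[_ /cvgrPdist_le/(_ _ eps0)[L0 _ hL0]] := h.
exists L0 => L L0L; have := hL0 L L0L.
rewrite /= sub0r normrN ger0_norm ?fine_ge0// => hL.
by rewrite -(@fineK _ (Q (A L))) ?lee_fin ?fin_num_measure.
Qed.

(** Trigonometric polynomials within 1 / (n + 1) of [phi] on the cube of radius n + 1 converge to it
    pointwise, and measurability passes to the limit. *)
Lemma measurable_comp_Wvec (phi : (nat -> R) -> R) (M : R) :
  (forall x, `|phi x| <= M) ->
  (forall L : R, 0 < L -> forall eta : R, 0 < eta -> exists2 delta : R, 0 < delta & forall x x' : nat -> R,
    (forall k, (k < m)%N -> `|x k| <= L) -> (forall k, (k < m)%N -> `|x' k| <= L) ->
    (forall k, (k < m)%N -> `|x k - x' k| <= delta) -> `|phi x - phi x'| <= eta) ->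
  measurable_fun [set: T] (fun w => phi (Wvec p0 (U w))).
Proof.
move=> phiM phic.
have /choice[tau htau] : forall n : nat, exists tau, trig m tau /\
    forall x, (forall k, (k < m)%N -> `|x k| <= n.+1%:R) -> `|tau x - phi x| <= n.+1%:R^-1.
  move=> n; have n0 : 0 < n.+1%:R :> R by rewrite ltr0n.
  have n1 : 0 < n.+1%:R^-1 :> R by rewrite invr_gt0.
  by have [tau [? _ ?]] := trig_approx n0 phiM (phic _ n0) n1; exists tau.
apply: (@measurable_fun_cvg _ _ _ _ (fun n w => tau n (Wvec p0 (U w)))).
  by move=> n; have [c []] := clt_trig (htau n).1.
move=> w _; apply/cvgrPdist_le => e e0; near=> n.
rewrite distrC; apply: le_trans ((htau n).2 _ _) _.
  move=> k km; apply: (@le_trans _ _ (\sum_(k < m) `|Wvec p0 (U w) k|)).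
    by rewrite (bigD1 (Ordinal km))//= lerDl sumr_ge0.
  apply: (@le_trans _ _ n%:R); last by rewrite ler_nat.
  by apply: ltW; near: n; exact: nbhs_infty_gtr.
rewrite invf_ple ?posrE ?ltr0n//; apply: (@le_trans _ _ n%:R); last by rewrite ler_nat.
by apply: ltW; near: n; exact: nbhs_infty_gtr.
Unshelve. all: by end_near. Qed.

(** Off the cube of radius L both [phi] and its approximant are bounded by M, and the cube is rarely
    left: by tightness under Q, and by Markov's inequality for second moments, uniformly in n, under
    the sampling law. *)
Lemma central_limit (phi : (nat -> R) -> R) (M : R) :
  (forall x, `|phi x| <= M) ->
  (forall L : R, 0 < L -> forall eta : R, 0 < eta -> exists2 delta : R, 0 < delta & forall x x' : nat -> R,
    (forall k, (k < m)%N -> `|x k| <= L) -> (forall k, (k < m)%N -> `|x' k| <= L) ->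
    (forall k, (k < m)%N -> `|x k - x' k| <= delta) -> `|phi x - phi x'| <= eta) ->
  iid_expect S.+1 n p0 (fun l => phi (empirical_fluct n l)) @[n --> \oo]
    --> \int[Q]_w phi (Wvec p0 (U w)).
Proof.
move=> phiM phic.
have mphi := measurable_comp_Wvec phiM phic.
have M0 : 0 <= M by apply: le_trans (phiM (fun=> 0)); exact: normr_ge0.
apply/cvgrPdist_le => e e0.
(* Replacing [phi] by [tau] on either side costs (1 + 2 M) eps, and the limit for [tau] costs eps:
   in total (3 + 4 M) eps. *)
pose eps := e / (4 + 4 * M).
have D0 : 0 < 4 + 4 * M by lra.
have eps0 : 0 < eps by rewrite divr_gt0.
have [L0 hL0] := Wvec_tight eps0.
(* Beyond L0 the bridge is tight; beyond m / eps the Markov bound m / L^2 is at most eps. *)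
pose L := (L0 + (Num.trunc (m%:R / eps)).+1)%N.
have Lpos : 0 < L%:R :> R by rewrite ltr0n /L addnS.
have mL : m%:R <= eps * L%:R ^+ 2.
  have : m%:R / eps <= L%:R.
    by apply: ltW; apply: lt_le_trans (truncnS_gt _) _; rewrite ler_nat leq_addl.
  rewrite ler_pdivrMr// mulrC => h; apply: le_trans h _; rewrite ler_wpM2l ?(ltW eps0)//.
  by rewrite expr2 ler_peMr ?ler0n// ler1n /L addnS.
have [tau [ttau tauM tauphi]] := trig_approx Lpos phiM (phic _ Lpos) eps0.
have [c [mtau _ Itau ctau]] := clt_trig ttau.
have ib (h : (nat -> R) -> R) : measurable_fun [set: T] (fun w => h (Wvec p0 (U w))) -> (forall x, `|h x| <= M) ->
    Q.-integrable [set: T] (EFin \o (fun w => h (Wvec p0 (U w)))).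
  move=> mh hB; apply: (@measurable_bounded_integrable _ _ _ Q (fun w => h (Wvec p0 (U w)))) => //.
    by rewrite -ge0_fin_numE ?fin_num_measure.
  by exists M; split => //= x Mx w _ /=; exact: le_trans (hB _) (ltW Mx).
(* [b] majorizes the indicator of leaving the cube: it will be that indicator under Q, and the sum
   of squares over L^2 for the sample. *)
have near_tau x (b : R) : 0 <= b -> ((exists2 k, (k < m)%N & L%:R < `|x k|) -> 1 <= b) ->
    `|phi x - tau x| <= eps + 2 * M * b.
  move=> b0 hb.
  have [cube|ncube] := pselect (forall k, (k < m)%N -> `|x k| <= L%:R).
    by rewrite distrC; apply: le_trans (tauphi x cube) _; rewrite lerDl !mulr_ge0.
  have b1 : 1 <= b.
    apply: hb; apply: contrapT => nex; apply: ncube => k km.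
    by rewrite leNgt; apply/negP => Lk; apply: nex; exists k.
  apply: (@le_trans _ _ (2 * M)); last first.
    by rewrite -[leLHS]add0r lerD ?(ltW eps0)// ler_peMr// mulr_ge0.
  by apply: le_trans (ler_normB _ _) _; have := phiM x; have := tauM x; lra.
have Qside : `|\int[Q]_w phi (Wvec p0 (U w)) - c| <= eps + 2 * M * eps.
  have -> : c = \int[Q]_w tau (Wvec p0 (U w)) by rewrite /Rintegral Itau.
  have i1 := ib phi mphi phiM; have i2 := ib tau mtau tauM.
  rewrite -RintegralB//.
  have i3 : Q.-integrable [set: T] (EFin \o (fun w => phi (Wvec p0 (U w)) - tau (Wvec p0 (U w)))).
    by rewrite /comp; under eq_fun do rewrite EFinB; exact: integrableB.
  apply: le_trans (le_normr_Rintegral measurableT i3) _.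
  set A := tail_event L; have mA : measurable A by exact: measurable_tail_event.
  have ic (a : R) : Q.-integrable [set: T] (EFin \o (fun=> a)).
    exact: finite_measure_integrable_cst.
  have iA : Q.-integrable [set: T] (EFin \o (fun w => 2 * M * \1_A w)).
    rewrite /comp; under eq_fun do rewrite EFinM.
    by apply: integrableZl => //; exact: integrable_indic.
  apply: (@le_trans _ _ (\int[Q]_w (eps + 2 * M * \1_A w))).
    apply: le_Rintegral => //.
    - exact: integrable_norm i3.
    - exact: (integrableD measurableT (ic eps) iA).
    - move=> w _; apply: near_tau; first by rewrite indicE ler0n.
      by move=> h; rewrite indicE mem_set.
  have -> : \int[Q]_w (eps + 2 * M * \1_A w) = \int[Q]_w eps + \int[Q]_w (2 * M * \1_A w).
    exact: (RintegralD measurableT (ic eps) iA).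
  have -> : \int[Q]_(w in [set: T]) (eps : R) = eps.
    have Q1 : fine (Q [set: T]) = 1 by rewrite (@probability_setT _ _ _ Q).
    by rewrite -[RHS]mulr1 -Q1; exact: Rintegral_cst.
  rewrite lerD2l.
  rewrite RintegralZl//; last exact: integrable_indic.
  rewrite ler_wpM2l ?mulr_ge0// /Rintegral integral_indic// setIT.
  rewrite -lee_fin fineK ?fin_num_measure//; apply: hL0; exact: leq_addr.
have nside n : (0 < n)%N -> `|iid_expect S.+1 n p0 (fun l => phi (empirical_fluct n l)) -
    iid_expect S.+1 n p0 (fun l => tau (empirical_fluct n l))| <= eps + 2 * M * eps.
  move=> n0; have wn : forall w, List.In w (nseq n p0) -> weight S.+1 w by exact: weight_nseq.
  rewrite /iid_expect -expectB; apply: le_trans (ler_norm_expect _ wn) _.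
  apply: (@le_trans _ _ (iid_expect S.+1 n p0 (fun l => eps + 2 * M / L%:R ^+ 2 * \sum_(k < m) empirical_fluct n l k ^+ 2))).
    apply: ler_expect => // l _ _; rewrite -mulrA; apply: near_tau.
      by rewrite mulr_ge0 ?invr_ge0 ?exprn_ge0 ?ler0n// sumr_ge0// => k _; exact: sqr_ge0.
    move=> [k km Lk]; rewrite ler_pdivlMl ?exprn_gt0// mulr1 (bigD1 (Ordinal km))//=.
    rewrite -[leLHS]addr0 lerD ?sumr_ge0//; last by move=> j _; exact: sqr_ge0.
    by rewrite -[leRHS]real_normK ?num_real// lerXn2r ?nnegrE ?ler0n// ltW.
  rewrite /iid_expect expectD expect_cst// lerD2l expectZ -mulrA ler_wpM2l ?mulr_ge0//.
  rewrite (expect_sum _ _ _ (fun k l => empirical_fluct n l k ^+ 2)).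
  rewrite ler_pdivrMl ?exprn_gt0// mulrC; apply: le_trans mL.
  rewrite -[leRHS]mulr1 mulrC mulr_natr -[m in leRHS]card_ord -sumr_const; apply: ler_sum => k _.
  by apply: empirical_fluct_sqr => //; have := ltn_ord k; lia.
move/cvgrPdist_le : ctau => /(_ _ eps0) ctau.
near=> n.
have n0 : (0 < n)%N by near: n; exists 1%N.
have h1 : `|c - iid_expect S.+1 n p0 (fun l => tau (empirical_fluct n l))| <= eps by near: n.
have h2 := nside n n0.
have -> : e = (4 + 4 * M) * eps by rewrite /eps mulrC divfK// gt_eqF.
move: Qside h1 h2; rewrite !ler_norml => /andP[a1 a2] /andP[b1 b2] /andP[c1 c2].
have Me : 0 <= M * eps by rewrite mulr_ge0// ltW.
apply/andP; split; lra.
Unshelve. all: by end_near. Qed.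

End CentralLimit.

(** * Minimizers at a knot *)

Section Heine.
Variables (R : realType) (m : nat).

Lemma closed_ball_rV_compact (B : R) : compact [set u : 'rV[R]_m | `|u| <= B].
Proof.
apply: bounded_closed_compact.
  by exists B; split => //= M BM u /= uB; exact: le_trans uB (ltW BM).
apply: (@closed_comp _ _ (fun u : 'rV[R]_m => `|u|) [set x | x <= B]) => [u _|]; last exact: closed_le.
exact: norm_continuous.
Qed.

(** The pairs in the ball with |f u - f v| >= eta form a compact set. If it is nonempty, |u - v|
    attains a positive minimum there, and half of it serves as delta. *)
Lemma uniformly_continuous_rV (f : 'rV[R]_m -> R) (B : R) : continuous f ->
  forall eta : R, 0 < eta -> exists2 delta : R, 0 < delta &
  forall u v, `|u| <= B -> `|v| <= B -> `|u - v| <= delta -> `|f u - f v| <= eta.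
Proof.
move=> cf eta eta0.
pose A := [set p : 'rV[R]_m * 'rV[R]_m | `|p.1| <= B /\ `|p.2| <= B] `&` [set p | eta <= `|f p.1 - f p.2|].
have c1 : continuous (fun p : 'rV[R]_m * 'rV[R]_m => f p.1).
  by move=> p; apply: (@continuous_comp _ _ _ fst f); [exact: cvg_fst|exact: cf].
have c2 : continuous (fun p : 'rV[R]_m * 'rV[R]_m => f p.2).
  by move=> p; apply: (@continuous_comp _ _ _ snd f); [exact: cvg_snd|exact: cf].
have cA : compact A.
  apply: (@subclosed_compact _ _ ([set u : 'rV[R]_m | `|u| <= B] `*` [set u : 'rV[R]_m | `|u| <= B])).
  - apply: closedI.
      have K : closed ([set u : 'rV[R]_m | `|u| <= B] `*` [set u : 'rV[R]_m | `|u| <= B]).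
        apply: compact_closed; first exact: norm_hausdorff.
        by apply: compact_setX; exact: closed_ball_rV_compact.
      by [].
    apply: (@closed_comp _ _ (fun p : 'rV[R]_m * 'rV[R]_m => `|f p.1 - f p.2|) [set x | eta <= x]) => [p _|]; last exact: closed_ge.
    exact: (cvg_norm (cvgB (c1 p) (c2 p))).
  - by apply: compact_setX; exact: closed_ball_rV_compact.
  - by move=> p [[]].
have [A0|/nonemptyPn A0] := pselect (A !=set0); last first.
  exists 1 => // u v uB vB _; rewrite leNgt; apply/negP => h.
  have : A (u, v) by split => //=; exact: ltW.
  by rewrite A0.
have cd : continuous (fun p : 'rV[R]_m * 'rV[R]_m => `|p.1 - p.2|).
  by move=> p; exact: (cvg_norm (cvgB cvg_fst cvg_snd)).
have [c] := compact_EVT_min A0 cA (continuous_subspaceT cd).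
rewrite inE => -[_ /= fc] hc.
have dc : 0 < `|c.1 - c.2|.
  rewrite normr_gt0 subr_eq0; apply: contraTneq fc => ->.
  by rewrite subrr normr0 -ltNge.
exists (`|c.1 - c.2| / 2); first by rewrite divr_gt0.
move=> u v uB vB uv; rewrite leNgt; apply/negP => h.
have : (u, v) \in A by rewrite inE; split => //=; exact: ltW.
move/hc => /= h2; lra.
Qed.

End Heine.

(** * Comparison of the minimizers at a knot, for fixed data *)

Section Deterministic.
Variables (R : realType) (p0 : nat -> R) (S s : nat).
Hypothesis hp0 : convex_pmf_support p0 S.
Hypothesis hs : s \in knots p0 S.

Definition flat k := ~~ (0 < Delta p0 k).

Lemma knot_bounds : [/\ (1 <= s)%N, (s <= S)%N & 0 < Delta p0 s].
Proof. by move: hs; rewrite mem_filter mem_iota add1n ltnS => /andP[D /andP[s1 sS]]. Qed.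

Lemma knot_ext : s \in ext_knots p0 S.
Proof. by have [s1 sS D] := knot_bounds; rewrite mem_ext_knots D !orbT andbT ltnW// ltnS. Qed.

Lemma is_min_CK_leP W g : is_min_CK_le p0 S s W g <-> cone_min flat s W g.
Proof.
split=> -[cg mg]; (split; first exact/(in_CK_leP _ knot_ext)) => h /(in_CK_leP _ knot_ext); exact: mg.
Qed.

Lemma is_min_CKP W g : is_min_CK p0 S W g <-> cone_min flat S.+1 W g.
Proof. by split=> -[cg mg]; (split; first exact/in_CKP) => h /in_CKP; exact: mg. Qed.

Lemma Wvec_sum (u : R -> R) k : u 0 = 0 ->
  \sum_(i < k) Wvec p0 u i = u (\sum_(j < k) p0 j).
Proof.
move=> u0; elim: k => [|k IH]; first by rewrite !big_ord0 u0.
by rewrite big_ord_recr IH /= /Wvec; ring.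
Qed.

Lemma cone_min_sum m (W g : nat -> R) : cone_min flat m W g -> \sum_(k < m.+1) g k = \sum_(k < m.+1) W k.
Proof.
move=> /cone_minP[cg mg].
have h (c : R) : 0 <= c * \sum_(k < m.+1) (g k - W k).
  have := mg (fun k => g k + c); rewrite mulr_sumr => /(_ _)/le_trans; apply.
    move=> k k0 fk; have -> : Delta (fun i => g i + c) k = Delta g k by rewrite /Delta; ring.
    exact: cg.
  apply: ler_sum => k _; have -> : (g k - W k) * (g k + c - g k) = c * (g k - W k) by ring.
  exact: lexx.
apply/eqP; rewrite -subr_eq0 -sumrB eq_le.
by have := h 1; have := h (-1); rewrite mul1r mulN1r oppr_ge0 => -> ->.
Qed.

Lemma restriction_min (W ghat : nat -> R) : cone_min flat S.+1 W ghat ->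
  \sum_(k < s.+1) ghat k = \sum_(k < s.+1) W k -> cone_min flat s W ghat.
Proof.
move=> mg sumE; have tot := cone_min_sum mg.
have [s1 sS Ds] := knot_bounds.
move/cone_minP : mg => [cg mg]; apply/cone_minP; split.
  by move=> k /andP[k0 ks] fk; apply: cg => //; rewrite k0 (leq_trans ks)// ltnW// ltnS.
move=> h ch.
pose h' k := if (k <= s)%N then h k else ghat k + (h s - ghat s).
have ch' : cone flat S.+1 h'.
  move=> k /andP[k0 kS] fk.
  (* At the junction s nothing has to be checked, since convexity is not imposed at a knot. *)
  have [ks|sk|ks] := ltngtP k s; last by move: fk; rewrite /flat ks Ds.
    rewrite /Delta /h' ks (ltnW ks) (leq_trans (leq_pred _) (ltnW ks)).
    by apply: ch => //; rewrite k0.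
  have e j : (s <= j)%N -> h' j = ghat j + (h s - ghat s).
    by rewrite /h'; case: ltngtP => // <- _; ring.
  rewrite /Delta !e; [|lia..].
  have := cg k _ fk; rewrite k0 kS => /(_ isT); rewrite /Delta; lra.
have := mg _ ch'.
rewrite -(big_mkord xpredT (fun k => (ghat k - W k) * (h' k - ghat k))) (@big_cat_nat _ _ _ s.+1)//=; last by lia.
rewrite big_mkord [X in _ + X](_ : _ = 0) ?addr0.
  move=> h0; apply: (le_trans h0); rewrite le_eqVlt; apply/orP; left; apply/eqP.
  by apply: eq_bigr => k _; rewrite /h' -ltnS ltn_ord.
(* Beyond s the direction is constant, so its inner product with the residual is a multiple of the
   mass of the residual there. That mass is 0, as the masses of [ghat] and W agree on {0, ..., S+1}
   and on {0, ..., s}. *)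
rewrite (eq_big_nat _ _ (F2 := fun k => (ghat k - W k) * (h s - ghat s))); last first.
  move=> k /andP[sk _]; rewrite /h' leqNgt sk /=; ring.
rewrite -mulr_suml (_ : \sum_(_ <= i < _) _ = 0) ?mul0r//.
move: tot; rewrite -!(big_mkord xpredT) !(@big_cat_nat _ _ _ s.+1 0 S.+2)//=; [|lia..].
rewrite !big_mkord sumE => /addrI; rewrite sumrB => ->; exact: subrr.
Qed.

Lemma first_part (u : R -> R) ghat : bridge_path u -> is_min_CK p0 S (Wvec p0 u) ghat ->
  (exists g, is_min_CK_le p0 S s (Wvec p0 u) g /\
     forall h, is_min_CK_le p0 S s (Wvec p0 u) h -> eq_upto s h g) /\
  (forall g, is_min_CK_le p0 S s (Wvec p0 u) g ->
     (eq_upto s g ghat <-> \sum_(k < s.+1) ghat k = u (Fcum p0 s))).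
Proof.
move=> [u0 _ _] /is_min_CKP mghat; split.
  have [g mg] := cone_min_ex flat s (Wvec p0 u).
  exists g; split; first exact/is_min_CK_leP.
  by move=> h /is_min_CK_leP mh k ks; exact: (cone_min_uniq mh mg).
move=> g /is_min_CK_leP mg; rewrite /Fcum -(Wvec_sum s.+1 u0); split=> [e|e].
  by rewrite -(cone_min_sum mg); apply: eq_bigr => k _; rewrite e// -ltnS.
by move=> k ks; apply: (cone_min_uniq mg _ ks); exact: restriction_min.
Qed.

(** Adding a step of height [Delta p s] on {0, ..., s} lowers the second difference at s to exactly
    0 and raises the one at s + 1, so convexity survives and the variational inequality applies. *)
Lemma LSE_cumulative_ge (q p : nat -> R) : (forall k, (S < k)%N -> q k = 0) -> is_LSE q p -> 0 < Delta p s ->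
  0 <= \sum_(k < s.+1) (p k - q k).
Proof.
move=> qS lse Dp; have [s1 sS Ds] := knot_bounds.
have cp : forall k, (1 <= k)%N -> 0 <= Delta p k by case: lse => -[].
pose h k := if (k <= s)%N then Delta p s else 0.
have := @LSE_variation R q p h S.+1 qS lse.
have -> : \sum_(k < S.+1) (p k - q k) * h k = Delta p s * \sum_(k < s.+1) (p k - q k).
  rewrite (big_ord_widen S.+1 (fun k => p k - q k)); last by lia.
  rewrite mulr_sumr [RHS]big_mkcond; apply: eq_bigr => k _; rewrite /h ltnS.
  by case: ifP; rewrite ?mulr0// mulrC.
rewrite pmulr_rge0//; apply.
  by move=> k Sk; rewrite /h leqNgt (leq_ltn_trans sS Sk).
move=> k k1.
have -> : Delta (fun i => p i + h i) k = Delta p k + Delta h k by rewrite /Delta; ring.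
have := cp k k1; have [ks|sk|ks] := ltngtP k s => Dk.
- have -> : Delta h k = 0; last by rewrite addr0.
  by rewrite /Delta /h ks (ltnW ks) (leq_trans (leq_pred _) (ltnW ks)); ring.
- rewrite addr_ge0// /Delta /h leqNgt ltnW//= (leqNgt k) sk /= mulr0 subrr add0r.
  by case: ifP => // _; exact: ltW.
- rewrite ks {2}/Delta /h ltnn leqnn (leq_pred s) /=; lra.
Qed.

Lemma positive_lower_bound (f : nat -> R) n :
  exists2 delta : R, 0 < delta & forall k, (k < n)%N -> 0 < f k -> delta <= f k.
Proof.
elim: n => [|n [delta d0 hd]]; first by exists 1.
have [fn|fn] := ltP 0 (f n).
  exists (Num.min delta (f n)); first by rewrite lt_min d0.
  move=> k; rewrite ltnS leq_eqVlt => /orP[/eqP-> _|kn fk]; first by rewrite ge_min lexx orbT.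
  by rewrite ge_min hd.
exists delta => // k; rewrite ltnS leq_eqVlt => /orP[/eqP->|kn]; last exact: hd.
by rewrite ltNge fn.
Qed.

Lemma p0_in_C : in_C p0.
Proof.
case: hp0 => _ _ p00 _ cp0; split => //.
rewrite (@series_finite_support _ _ S.+1) ?ltry// => [k|k Sk]; first exact: sqr_ge0.
by rewrite p00// expr0n.
Qed.

Lemma DeltaB_le (f : nat -> R) (B : R) k : `|f k.+1| <= B -> `|f k| <= B -> `|f k.-1| <= B ->
  `|Delta f k| <= 4 * B.
Proof. by rewrite /Delta !ler_norml => /andP[? ?] /andP[? ?] /andP[? ?]; apply/andP; split; lra. Qed.

(* On the good event [sum (q - p0)^2 <= theta] the estimator is curved at [s], and the candidate
   equal to [p0 + g / r] up to a constant on [0, s] and to [p] beyond [s] is convex. *)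
Lemma good_event : exists2 theta : R, 0 < theta & forall (q p : nat -> R) (r : R),
  0 < r -> (forall k, (S < k)%N -> q k = 0) -> is_LSE q p ->
  \sum_(k < S.+1) (q k - p0 k) ^+ 2 <= theta ->
  0 < Delta p s /\
  forall g, cone_min flat s (fun k => r * (q k - p0 k)) g ->
    \sum_(k < s.+1) (r * (p k - p0 k) - g k) ^+ 2 <=
    (\sum_(k < s.+1) r * (p k - q k)) ^+ 2.
Proof.
have [s1 sS Ds] := knot_bounds.
have [S1 p0pos p00 p01 cp0] := hp0.
have [delta d0 hd] := positive_lower_bound (Delta p0) S.+1.
(* At the knots p0 has second difference at least delta. The perturbations below amount to at most 8
   B = delta / 2: 8 B for p - p0, 4 B for g / r, and 6 B for the mixed difference at s. *)
pose B := delta / 16.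
have B0 : 0 < B by rewrite divr_gt0.
exists (B ^+ 2); first by rewrite exprn_gt0.
move=> q p r r0 qS lse qtheta.
have cp : forall k, (1 <= k)%N -> 0 <= Delta p k by case: lse => -[].
have sqB (x : R) : x ^+ 2 <= B ^+ 2 -> `|x| <= B.
  by move=> h; rewrite -(ler_pXn2r (n := 2))// ?nnegrE// ?(ltW B0)// real_normK ?num_real.
have qB k : `|q k - p0 k| <= B.
  apply: sqB; have [kS|Sk] := leqP k S; last by rewrite qS// p00// subrr expr0n exprn_ge0// ltW.
  apply: le_trans qtheta; rewrite (bigD1 (Ordinal (kS : (k < S.+1)%N)))//= lerDl sumr_ge0// => i _.
  exact: sqr_ge0.
have pqB k : `|p k - q k| <= B.
  by apply: sqB; apply: le_trans qtheta; apply: (LSE_bound lse p0_in_C).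
have pB k : `|p k - p0 k| <= 2 * B.
  have -> : p k - p0 k = (p k - q k) + (q k - p0 k) by ring.
  by apply: le_trans (ler_normD _ _) _; have := pqB k; have := qB k; lra.
have dDs : delta <= Delta p0 s by apply: hd.
have Dps : 0 < Delta p s.
  have h : `|Delta (fun k => p k - p0 k) s| <= 4 * (2 * B) by apply: DeltaB_le.
  have -> : Delta p s = Delta p0 s + Delta (fun k => p k - p0 k) s by rewrite /Delta; ring.
  by move: h; rewrite ler_norml /B => /andP[h1 h2]; lra.
split => // g mg.
(* Zero projects to zero, so nonexpansiveness bounds the projection g by its data. *)
have m0 : cone_min flat s (fun=> 0) (fun=> 0 : R).
  apply/cone_minP; split; first by move=> k _ _; rewrite /Delta mulr0 subrr addr0.
  by move=> h _; rewrite big1// => k _; rewrite subrr mul0r.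
have gB k : (k <= s)%N -> `|g k / r| <= B.
  move=> ks; apply: sqB; rewrite expr_div_n ler_pdivrMr ?exprn_gt0//.
  have := cone_min_nonexpansive mg m0.
  rewrite (eq_bigr (fun k : 'I_s.+1 => g k ^+ 2)); last by move=> i _; rewrite subr0.
  rewrite (eq_bigr (F1 := fun k : 'I_s.+1 => (r * (q k - p0 k) - 0) ^+ 2) (fun k : 'I_s.+1 => (q k - p0 k) ^+ 2 * r ^+ 2)); last first.
    by move=> i _; rewrite subr0 exprMn mulrC.
  rewrite -mulr_suml => h.
  apply: (@le_trans _ _ (\sum_(k < s.+1) g k ^+ 2)).
    rewrite (bigD1 (Ordinal (ks : (k < s.+1)%N)))//= lerDl sumr_ge0// => i _; exact: sqr_ge0.
  apply: le_trans h _; rewrite ler_wpM2r ?exprn_ge0 ?(ltW r0)//.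
  apply: le_trans qtheta; rewrite (big_ord_widen S.+1 (fun k => (q k - p0 k) ^+ 2)); last by lia.
  by rewrite big_mkcond; apply: ler_sum => k' _; case: ifP => // _; exact: sqr_ge0.
(* The shift makes the candidate meet p at s, so that h vanishes beyond s without a jump in p +
   h. *)
pose kappa := p0 s + g s / r - p s.
pose h k := if (k <= s)%N then p0 k + g k / r - p k - kappa else 0.
have [cg vg] := (cone_minP flat s _ g).1 mg.
have := @LSE_variation R q p h S.+1 qS lse.
have hS k : (S < k)%N -> h k = 0 by move=> Sk; rewrite /h leqNgt (leq_ltn_trans sS Sk).
have hconv k : (1 <= k)%N -> 0 <= Delta (fun i => p i + h i) k.
  move=> k1.
  have le_s j : (j <= s)%N -> p j + h j = p0 j + g j / r - kappa by move=> js; rewrite /h js; ring.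
  have ge_s j : (s <= j)%N -> p j + h j = p j.
    by rewrite /h; case: ltngtP => // <- _; rewrite /kappa; ring.
  have [ks|sk|ks] := ltngtP k s.
  - rewrite /Delta !le_s; [|lia..].
    have -> : p0 k.+1 + g k.+1 / r - kappa - 2 * (p0 k + g k / r - kappa) + (p0 k.-1 + g k.-1 / r - kappa)
      = Delta p0 k + Delta (fun j => g j / r) k by rewrite /Delta; ring.
    have [fk|fk] := boolP (flat k).
      rewrite addr_ge0// ?cp0//.
      have -> : Delta (fun j => g j / r) k = Delta g k / r by rewrite /Delta; ring.
      by rewrite divr_ge0 ?(ltW r0)// cg// k1.
    have : delta <= Delta p0 k by apply: hd; [lia|rewrite /flat negbK in fk].
    have : `|Delta (fun j => g j / r) k| <= 4 * B by apply: DeltaB_le; apply: gB; rewrite ?(ltnW ks) ?(leq_trans (leq_pred k) (ltnW ks)).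
    by rewrite ler_norml /B => /andP[a1 a2] a3; lra.
  - by rewrite /Delta !ge_s; [exact: cp|lia..].
  - rewrite ks /Delta (ge_s s.+1)// (ge_s s)// le_s ?leq_pred//.
    have -> : p s.+1 - 2 * p s + (p0 s.-1 + g s.-1 / r - kappa) =
      Delta p0 s + ((p s.+1 - p0 s.+1) - (p s - p0 s)) + (g s.-1 / r - g s / r).
      by rewrite /Delta /kappa; ring.
    have := pB s.+1; have := pB s; have := gB s (leqnn s); have := gB s.-1 (leq_pred s).
    by rewrite !ler_norml /B => /andP[? ?] /andP[? ?] /andP[? ?] /andP[? ?]; lra.
move=> /(_ hS hconv).
have -> : \sum_(k < S.+1) (p k - q k) * h k = \sum_(k < s.+1) (p k - q k) * (p0 k + g k / r - p k - kappa).
  rewrite (big_ord_widen S.+1 (fun k => (p k - q k) * (p0 k + g k / r - p k - kappa))); last by lia.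
  by rewrite [RHS]big_mkcond; apply: eq_bigr => k _; rewrite /h ltnS; case: ifP; rewrite ?mulr0.
set V := \sum_(k < s.+1) r * (p k - q k).
set X := \sum_(k < s.+1) (r * (p k - p0 k) - g k) ^+ 2.
pose e := g s - r * (p s - p0 s).
have rn : r != 0 by rewrite gt_eqF.
move=> var1.
have cc : cone flat s (fun k => r * (p k - p0 k)).
  move=> k /andP[k0 ks] fk.
  have -> : Delta (fun k => r * (p k - p0 k)) k = r * (Delta p k - Delta p0 k) by rewrite /Delta; ring.
  rewrite mulr_ge0 ?(ltW r0)// subr_ge0; apply: (@le_trans _ _ 0); last exact: cp.
  by rewrite leNgt.
have var2 := vg _ cc.
(* With Y = r (p - p0) and A = r (q - p0), the inequalities pair Y - A with g - Y - e and g - A with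
   Y - g. In their sum A cancels from the quadratic part, leaving - X, and the shift contributes - e
   V. *)
have sum12 : 0 <= - X - e * V.
  have : 0 <= r ^+ 2 * (\sum_(k < s.+1) (p k - q k) * (p0 k + g k / r - p k - kappa)) +
    \sum_(k < s.+1) (g k - r * (q k - p0 k)) * (r * (p k - p0 k) - g k).
    by rewrite addr_ge0// mulr_ge0// exprn_ge0// ltW.
  rewrite /X /V !mulr_sumr -big_split -sumrN -sumrB /=.
  congr (0 <= _); apply: eq_bigr => k _; rewrite /e /kappa; field; exact: rn.
have eX : e ^+ 2 <= X.
  rewrite /X (bigD1 (Ordinal (ltnSn s)))//= -sqrrN opprB /e lerDl sumr_ge0// => i _.
  exact: sqr_ge0.
have X0 : 0 <= X by apply: le_trans eX; exact: sqr_ge0.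
have [->|Xn] := eqVneq X 0; first exact: sqr_ge0.
have Xp : 0 < X by rewrite lt0r Xn.
have X2 : X ^+ 2 <= e ^+ 2 * V ^+ 2.
  have Xe : X <= - (e * V) by lra.
  by rewrite -exprMn -(sqrrN (e * V)) lerXn2r ?nnegrE// (le_trans X0).
rewrite -(ler_pM2l Xp) -expr2; apply: (le_trans X2).
by rewrite ler_wpM2r ?sqr_ge0.
Qed.

End Deterministic.

(** * Asymptotics *)

Section Clip.
Variables (R : realType) (a b : R).
Hypothesis ab : a <= b.

Definition clip (z : R) : R := Num.max a (Num.min z b).

Lemma clip_in z : a <= clip z <= b.
Proof. by rewrite /clip le_max lexx ge_max ab ge_min lexx orbT. Qed.

Lemma clip_id z : a <= z <= b -> clip z = z.
Proof. by case/andP => z1 z2; rewrite /clip (min_idPl _)// (max_idPr _). Qed.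

Lemma ler_clip x y : x <= y -> clip x <= clip y.
Proof.
move=> xy; rewrite /clip /Num.max /Num.min.
by do ! case: ifPn; rewrite -?leNgt => *; lra.
Qed.

Lemma clip_lipschitz x y : `|clip x - clip y| <= `|x - y|.
Proof.
have : `|x - y| <= `|x - y| by [].
rewrite [in X in X -> _]ler_norml => /andP[xy1 xy2].
rewrite ler_norml /clip /Num.max /Num.min; apply/andP.
by do ! case: ifPn; rewrite -?leNgt => *; lra.
Qed.

Lemma continuous_clip : continuous clip.
Proof.
move=> x; apply/cvgrPdist_le => eta eta0; near=> y.
apply: le_trans (clip_lipschitz _ _) _; near: y.
by apply: (@cvgr_dist_le _ _ _ (nbhs x) _ id x).
Unshelve. all: by end_near. Qed.

End Clip.

(** * Equivalence of a vanishing gap and convergence to the projection *)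

Section Reduction.
Variables (R : realType) (p0 : nat -> R) (S s : nat).
Hypothesis hp0 : convex_pmf_support p0 S.
Hypothesis hs : s \in knots p0 S.
Local Notation Ex n H := (iid_expect S.+1 n p0 H).
Local Notation fluct l := (empirical_fluct p0 (size l) l).

Lemma convex_pmf_weight : weight S.+1 p0.
Proof. by have [_ pos _ sum1 _] := hp0; split => // x xS; exact: ltW (pos _ _). Qed.

Lemma ler_iid_expect n (H H' : seq nat -> R) :
  (forall l, size l = n -> all (fun x => x < S.+1)%N l -> H l <= H' l) -> Ex n H <= Ex n H'.
Proof.
move=> h; apply: ler_expect; first exact: weight_nseq convex_pmf_weight.
by move=> l; rewrite size_nseq; exact: h.
Qed.

Lemma eq_iid_expect n (H H' : seq nat -> R) :
  (forall l, size l = n -> all (fun x => x < S.+1)%N l -> H l = H' l) -> Ex n H = Ex n H'.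
Proof. by move=> h; apply: eq_expect => l; rewrite size_nseq; exact: h. Qed.

Lemma iid_expect_fluct_sqr n m : (0 < n)%N -> (m <= S.+1)%N ->
  Ex n (fun l => \sum_(k < m) fluct l k ^+ 2) <= m%:R.
Proof.
move=> n0 mS.
rewrite (@eq_iid_expect n _ (fun l => \sum_(k < m) empirical_fluct p0 n l k ^+ 2)); last first.
  by move=> l -> _.
rewrite /iid_expect (expect_sum _ _ _ (fun k l => empirical_fluct p0 n l k ^+ 2)).
apply: (@le_trans _ _ (\sum_(k < m) (1 : R))); last by rewrite sumr_const card_ord.
apply: ler_sum => k _; apply: empirical_fluct_sqr => //; first exact: convex_pmf_weight.
by rewrite -ltnS (leq_trans (ltn_ord k)).
Qed.

Lemma sqr_large (c kappa : R) : 0 <= c -> 0 < kappa -> exists2 L : R, 1 <= L & c / L ^+ 2 <= kappa.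
Proof.
move=> c0 k0; exists (1 + c / kappa); first by rewrite lerDl divr_ge0// ltW.
have t0 : 0 <= c / kappa by rewrite divr_ge0// ltW.
have e : c = kappa * (c / kappa) by rewrite mulrC divfK// gt_eqF.
rewrite ler_pdivrMr; last by rewrite exprn_gt0//; lra.
by move: (c / kappa) t0 e => t t0 ->; rewrite ler_pM2l//; nra.
Qed.

Lemma near_natV_le (c kappa : R) : 0 < kappa -> \forall n \near \oo, c / n%:R <= kappa.
Proof.
move=> k0; near=> n.
have n0 : 0 < n%:R :> R by near: n; exact: nbhs_infty_gtr.
rewrite ler_pdivrMr// mulrC -ler_pdivrMr//; apply: ltW.
near: n; exact: nbhs_infty_gtr.
Unshelve. all: by end_near. Qed.

Lemma norm_row_le m (B : R) (v : nat -> R) : 0 <= B -> (forall i, (i < m)%N -> `|v i| <= B) ->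
  `|\row_(i < m) v i| <= B.
Proof.
move=> B0 h; rewrite /Num.norm /= mx_normrE; apply: bigmax_le => // i _.
by rewrite mxE; exact: h.
Qed.

Lemma norm_le_sum_sqr m (B : R) (v : nat -> R) : 0 <= B -> \sum_(k < m) v k ^+ 2 <= B ^+ 2 ->
  forall i, (i < m)%N -> `|v i| <= B.
Proof.
move=> B0 h i im; rewrite -ler_sqr ?nnegrE// real_normK ?num_real//.
apply: le_trans h; rewrite (bigD1 (Ordinal im))//= lerDl.
by apply: sumr_ge0 => j _; exact: sqr_ge0.
Qed.

Lemma sum_sqr_le m (B : R) (v : nat -> R) : 0 <= B -> (forall i, (i < m.+1)%N -> `|v i| <= B) ->
  \sum_(k < m.+1) v k ^+ 2 <= (m.+1%:R * B) ^+ 2.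
Proof.
move=> B0 h; apply: (@le_trans _ _ (\sum_(k < m.+1) B ^+ 2)).
  by apply: ler_sum => k _; rewrite -real_normK ?num_real// ler_sqr ?nnegrE ?h.
rewrite sumr_const card_ord -[leLHS]mulr_natl exprMn ler_wpM2r ?sqr_ge0//.
by rewrite -natrX ler_nat -mulnn leq_pmulr.
Qed.

Lemma cone_min0 N m : cone_min N m (fun=> 0 : R) (fun=> 0).
Proof.
split => [k _ _|h _]; first by rewrite /Delta; lra.
rewrite /Phi_le ler_pM2l ?invr_gt0//; apply: ler_sum => k _.
by rewrite subrr expr0n sqr_ge0.
Qed.

Lemma cone_min_norm N m (W g : nat -> R) : cone_min N m W g ->
  \sum_(k < m.+1) g k ^+ 2 <= \sum_(k < m.+1) W k ^+ 2.
Proof.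
move=> mg; have := cone_min_nonexpansive mg (cone_min0 N m).
have sub0 (h : nat -> R) : \sum_(k < m.+1) (h k - 0) ^+ 2 = \sum_(k < m.+1) h k ^+ 2.
  by apply: eq_bigr => k _; rewrite subr0.
by rewrite !sub0.
Qed.

(** The projection maps a cube into a ball and is nonexpansive, so the uniform continuity of f on
    that ball transfers. The factors [m.+1] are a crude price for passing from coordinates to sums
    of squares. *)
Lemma cone_min_comp_modulus N m (pr : (nat -> R) -> nat -> R) (f : 'rV[R]_m.+1 -> R) :
  (forall W, cone_min N m W (pr W)) -> continuous f ->
  forall L : R, 0 < L -> forall eta : R, 0 < eta -> exists2 delta : R, 0 < delta &
    forall x x' : nat -> R, (forall k, (k < m.+1)%N -> `|x k| <= L) ->
    (forall k, (k < m.+1)%N -> `|x' k| <= L) ->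
    (forall k, (k < m.+1)%N -> `|x k - x' k| <= delta) ->
    `|f (\row_(i < m.+1) pr x i) - f (\row_(i < m.+1) pr x' i)| <= eta.
Proof.
move=> prP cf  L L0 eta eta0.
have m0 : 0 < m.+1%:R :> R by rewrite ltr0n.
have [delta d0 hd] := uniformly_continuous_rV (m.+1%:R * L) cf eta0.
exists (delta / m.+1%:R); first by rewrite divr_gt0.
have B0 : 0 <= m.+1%:R * L by rewrite mulr_ge0 ?ltW.
have rowB x : (forall k, (k < m.+1)%N -> `|x k| <= L) -> `|\row_(i < m.+1) pr x i| <= m.+1%:R * L.
  move=> xL; apply: norm_row_le => //; apply: norm_le_sum_sqr => //.
  exact: le_trans (cone_min_norm (prP x)) (sum_sqr_le (ltW L0) xL).
move=> x x' xL x'L xx'; apply: hd; [exact: rowB|exact: rowB|].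
rewrite (_ : _ - _ = \row_(i < m.+1) (fun i => pr x i - pr x' i) i); last first.
  by apply/rowP => i; rewrite !mxE.
apply: (@norm_row_le _ _ (fun i => pr x i - pr x' i)); first exact: ltW.
apply: (@norm_le_sum_sqr _ _ (fun i => pr x i - pr x' i)); first exact: ltW.
apply: le_trans (cone_min_nonexpansive (prP x) (prP x')) _.
have dd : 0 <= delta / m.+1%:R by rewrite divr_ge0 ?ltW.
by have := @sum_sqr_le _ _ (fun i => x i - x' i) dd xx'; rewrite [m.+1%:R * _]mulrC divfK ?gt_eqF.
Qed.

Variable Y : seq nat -> nat -> R.
Let V l := \sum_(k < s.+1) Y l k - \sum_(k < s.+1) fluct l k.
Variable theta : R.
Hypothesis theta0 : 0 < theta.
(** The link between the estimator and the projection. The good event fails with probability of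
    order 1 / n, by Markov's inequality for the squared fluctuations. *)
Hypothesis Ygood : forall l, all (fun x => x < S.+1)%N l -> (0 < size l)%N ->
  \sum_(k < S.+1) fluct l k ^+ 2 <= theta * (size l)%:R ->
  0 <= V l /\ forall g, cone_min (flat p0) s (fluct l) g ->
    \sum_(k < s.+1) (Y l k - g k) ^+ 2 <= V l ^+ 2.

Lemma knot_lt_support : (s.+1 <= S.+1)%N.
Proof. by have [_ h _] := knot_bounds hs. Qed.

Variables (d : measure_display) (T : measurableType d) (Q : probability T R).
Variables (U : T -> R -> R) (Z : T -> nat -> R).
Hypothesis bU : brownian_bridge Q U.
Hypothesis ZU : forall w, cone_min (flat p0) s (Wvec p0 (U w)) (Z w).

(** By uniqueness Z is the projection of W, so measurability comes from the composition of f with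
    the projection, which has a modulus of continuity on every cube. *)
Lemma integrable_cone_min_comp (f : 'rV[R]_s.+1 -> R) (M : R) : continuous f -> (forall x, `|f x| <= M) ->
  Q.-integrable [set: T] (EFin \o (fun w => f (\row_(i < s.+1) Z w i))).
Proof.
move=> cf fM.
have /choice[pr prP] : forall W : nat -> R, exists g, cone_min (flat p0) s W g by move=> W; exact: cone_min_ex.
rewrite (_ : (fun w => _) = (fun w => f (\row_(i < s.+1) pr (Wvec p0 (U w)) i))); last first.
  apply/funext => w; congr f; apply/rowP => i; rewrite !mxE.
  by apply: (cone_min_uniq (ZU w) (prP _)); rewrite -ltnS.
apply: measurable_bounded_integrable => //.
- by rewrite -ge0_fin_numE ?fin_num_measure.
- exact: (measurable_comp_Wvec convex_pmf_weight knot_lt_support bU (fun x => fM _) (cone_min_comp_modulus prP cf)).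
- by exists M; split => //= x Mx w _ /=; exact: le_trans (fM _) (ltW Mx).
Qed.

(** The projected fluctuations converge by the central limit theorem. Replacing them by Y costs e /
    4 outside three rare events: a gap above [d1], failure of the good event, and fluctuations of
    norm above L. *)
Lemma cvg_of_small_gap (f : 'rV[R]_s.+1 -> R) (M : R) : continuous f -> (forall x, `|f x| <= M) ->
  (forall eps : R, 0 < eps -> Ex n (fun l => ((eps < `|V l|)%R)%:R) @[n --> \oo] --> (0 : R)) ->
  Ex n (fun l => f (\row_(i < s.+1) Y l i)) @[n --> \oo]
    --> \int[Q]_w f (\row_(i < s.+1) Z w i).
Proof.
move=> cf fM Vop.
have M0 : 0 <= M by apply: le_trans (fM 0); exact: normr_ge0.
have /choice[pr prP] : forall W : nat -> R, exists g, cone_min (flat p0) s W g by move=> W; exact: cone_min_ex.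
pose phi x := f (\row_(i < s.+1) pr x i).
have phic := cone_min_comp_modulus prP cf.
have phiM x : `|phi x| <= M by exact: fM.
have := central_limit convex_pmf_weight knot_lt_support bU phiM phic.
rewrite (_ : Rintegral _ _ (fun w => phi _) = \int[Q]_w f (\row_(i < s.+1) Z w i)); last first.
  congr (fine _); apply: eq_integral => w _; congr (f _)%:E; apply/rowP => i; rewrite !mxE.
  by apply: (cone_min_uniq (prP _) (ZU w)); rewrite -ltnS.
move=> cphi; apply/cvgrPdist_le => e e0.
(* The rare events cost 6 M kappa <= 3 e / 8, which together with two quarters of e stays below
   e. *)
pose kappa := e / (16 * (M + 1)).
have k0 : 0 < kappa by rewrite divr_gt0//; lra.
have kE : 16 * kappa * (M + 1) = e by rewrite /kappa; field; lra.
have [L L1 hL] := sqr_large (ler0n R s.+1) k0.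
have e4 : 0 < e / 4 by lra.
have L0 : 0 <= L by lra.
have L10 : 0 <= L + 1 by lra.
have [delta d0 hd] := uniformly_continuous_rV (L + 1) cf e4.
(* The cap at 1 keeps Y in the ball of radius L + 1, where delta is a modulus for f. *)
pose d1 := Num.min delta 1.
have d10 : 0 < d1 by rewrite lt_min d0 ltr01.
have L20 : 0 < L ^+ 2 by rewrite exprn_gt0//; lra.
near=> n.
have n0 : (0 < n)%N by near: n; exact: nbhs_infty_gt.
have n0R : 0 < n%:R :> R by rewrite ltr0n.
have h1 : `|\int[Q]_w f (\row_(i < s.+1) Z w i) - Ex n (fun l => phi (empirical_fluct p0 n l))| <= e / 4.
  by near: n; move/cvgrPdist_le : cphi; exact.
have h2 : S.+1%:R / theta / n%:R <= kappa by near: n; exact: near_natV_le.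
have h3 : Ex n (fun l => ((d1 < `|V l|)%R)%:R) <= kappa.
  have : `|0 - Ex n (fun l => ((d1 < `|V l|)%R)%:R)| <= kappa.
    by near: n; move/cvgrPdist_le : (Vop _ d10); exact.
  by rewrite sub0r normrN; apply: le_trans; exact: ler_norm.
suff h : `|Ex n (fun l => phi (empirical_fluct p0 n l)) - Ex n (fun l => f (\row_(i < s.+1) Y l i))|
    <= e / 4 + 2 * M * (kappa + kappa + kappa).
  rewrite (le_trans (ler_distD (Ex n (fun l => phi (empirical_fluct p0 n l))) _ _))//; nra.
rewrite /iid_expect -expectB; apply: le_trans (ler_norm_expect _ _) _.
  exact: weight_nseq convex_pmf_weight.
rewrite -/(iid_expect _ _ _ _).
have := ler_iid_expect (n := n) (H' := fun l => e / 4 + 2 * M * (((d1 < `|V l|)%R)%:R +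
  (theta * n%:R)^-1 * (\sum_(k < S.+1) fluct l k ^+ 2) + (L ^+ 2)^-1 * \sum_(k < s.+1) fluct l k ^+ 2)).
move=> h; apply: le_trans (h _ _) _; last first.
  rewrite /iid_expect expectD expectZ !expectD !expectZ expect_cst; last exact: weight_nseq convex_pmf_weight.
  rewrite -!/(iid_expect _ _ _ _) lerD2l ler_wpM2l//; first by rewrite mulr_ge0.
  rewrite !lerD//.
    rewrite mulrC ler_pdivrMr ?mulr_gt0//.
    apply: le_trans (iid_expect_fluct_sqr n0 (leqnn _)) _.
    by move: h2; rewrite ler_pdivrMr// ler_pdivrMr// -mulrA [n%:R * _]mulrC.
  rewrite mulrC ler_pdivrMr//.
  apply: le_trans (iid_expect_fluct_sqr n0 knot_lt_support) _.
  by rewrite -ler_pdivrMr.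
move=> l sl al; rewrite -{1}sl.
have SA0 m : 0 <= \sum_(k < m) fluct l k ^+ 2 by apply: sumr_ge0 => k _; exact: sqr_ge0.
have t2 : 0 <= (theta * n%:R)^-1 * (\sum_(k < S.+1) fluct l k ^+ 2).
  by rewrite mulr_ge0// invr_ge0 mulr_ge0 ?ltW.
have t3 : 0 <= (L ^+ 2)^-1 * \sum_(k < s.+1) fluct l k ^+ 2 by rewrite mulr_ge0// invr_ge0 ltW.
have far (t : R) : 1 <= t -> `|phi (fluct l) - f (\row_i Y l i)| <= e / 4 + 2 * M * t.
  move=> t1; apply: (@le_trans _ _ (M + M)); last first.
    by rewrite (_ : M + M = 0 + 2 * M); [rewrite lerD ?(ltW e4)// ler_peMr// mulr_ge0|ring].
  by apply: le_trans (ler_normB _ _) _; apply: lerD.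
have [big1|small1] := ltP d1 `|V l|; first by apply: far; rewrite mulr1n -addrA lerDl addr_ge0.
have [small2|big2] := leP (\sum_(k < S.+1) fluct l k ^+ 2) (theta * n%:R); last first.
  apply: far; rewrite mulr0n.
  rewrite add0r -[leLHS]addr0 lerD//.
  by rewrite mulrC ler_pdivlMr ?mulr_gt0// mul1r ltW.
have [small3|big3] := leP (\sum_(k < s.+1) fluct l k ^+ 2) (L ^+ 2); last first.
  apply: far; rewrite mulr0n.
  rewrite add0r -[leLHS]add0r lerD//.
  by rewrite mulrC ler_pdivlMr// mul1r ltW.
apply: (@le_trans _ _ (e / 4)); last by rewrite lerDl mulr0n add0r !mulr_ge0// addr_ge0.
have [_ /(_ _ (prP _)) Yg] := Ygood al (etrans (congr1 _ sl) n0) (eq_ind_r (fun m => _ <= theta * m%:R) small2 sl).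
have Yg' i : (i < s.+1)%N -> `|Y l i - pr (fluct l) i| <= d1.
  apply: (@norm_le_sum_sqr _ _ (fun i => Y l i - pr (fluct l) i)) i; first exact: ltW.
  by apply: le_trans Yg _; rewrite -real_normK ?num_real// ler_sqr ?nnegrE// ltW.
have pL i : (i < s.+1)%N -> `|pr (fluct l) i| <= L.
  apply: norm_le_sum_sqr i => //.
  exact: le_trans (cone_min_norm (prP _)) small3.
have d11 : d1 <= 1 by rewrite ge_min lexx orbT.
have d1d : d1 <= delta by rewrite ge_min lexx.
apply: hd.
- by apply: norm_row_le => // i /pL iL; rewrite (le_trans iL)// lerDl.
- apply: norm_row_le => // i im.
  rewrite -[Y l i](subrK (pr (fluct l) i)) addrC.
  by apply: le_trans (ler_normD _ _) _; apply: lerD; [exact: pL|exact: le_trans (Yg' _ im) _].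
- rewrite (_ : _ - _ = \row_(i < s.+1) (fun i => pr (fluct l) i - Y l i) i); last first.
    by apply/rowP => i; rewrite !mxE.
  apply: (@norm_row_le _ _ (fun i => pr (fluct l) i - Y l i)) => [|i im]; first exact: ltW.
  by rewrite distrC; exact: le_trans (Yg' _ im) _.
Unshelve. all: by end_near. Qed.

(* [sum Y] and [sum fluct] have the same limit law; as their difference [V] is nonnegative on the
   good event, testing against a nondecreasing truncation forces [V] to vanish. *)
Lemma small_gap_of_cvg :
  (forall (f : 'rV[R]_s.+1 -> R) (M : R), continuous f -> (forall x, `|f x| <= M) ->
    Ex n (fun l => f (\row_(i < s.+1) Y l i)) @[n --> \oo]
      --> \int[Q]_w f (\row_(i < s.+1) Z w i)) ->
  forall eps : R, 0 < eps -> Ex n (fun l => ((eps < `|V l|)%R)%:R) @[n --> \oo] --> (0 : R).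
Proof.
move=> cY eps eps0; apply/cvgrPdist_le => e e0.
pose kappa := e / 3.
have k0 : 0 < kappa by rewrite divr_gt0//; lra.
have [L1 L11 hL1] := sqr_large (ler0n R s.+1) k0.
pose L := s.+1%:R * L1.
have L10 : 0 <= L1 by lra.
have L0 : 0 < L by rewrite mulr_gt0 ?ltr0n//; lra.
have Leps : - L <= L + eps by lra.
(* The interval is longer by eps at the top: a mass in [-L, L] can grow by eps without being
   truncated, so a gap above eps stays visible after clipping. *)
pose c := clip (- L) (L + eps).
have c_bound (z : R) : `|c z| <= L + eps.
  by rewrite ler_norml /c; have /andP[? ->] := clip_in Leps z; rewrite andbT; lra.
pose f (v : 'rV[R]_s.+1) : R := c (\sum_i v ord0 i).
have f_cont : continuous f.
  move=> v; apply: (@continuous_comp _ _ _ (fun v : 'rV[R]_s.+1 => \sum_i v ord0 i) c); last exact: continuous_clip.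
  move: v; apply: continuous_big; first exact: (@add_continuous R).
  by move=> i _; exact: coord_continuous.
pose phi (x : nat -> R) : R := c (\sum_(k < s.+1) x k).
have phic : forall L : R, 0 < L -> forall eta : R, 0 < eta -> exists2 delta : R, 0 < delta &
    forall x x' : nat -> R, (forall k, (k < s.+1)%N -> `|x k| <= L) ->
    (forall k, (k < s.+1)%N -> `|x' k| <= L) ->
    (forall k, (k < s.+1)%N -> `|x k - x' k| <= delta) -> `|phi x - phi x'| <= eta.
  move=> B _ eta eta0; exists (eta / s.+1%:R); first by rewrite divr_gt0 ?ltr0n.
  move=> x x' _ _ xx'; apply: le_trans (clip_lipschitz _ _ _ _) _; rewrite -sumrB.
  apply: le_trans (ler_norm_sum _ _ _) _.
  apply: (@le_trans _ _ (\sum_(k < s.+1) eta / s.+1%:R)); first by apply: ler_sum => k _; exact: xx'.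
  by rewrite sumr_const card_ord -[leLHS]mulr_natr divfK ?gt_eqF ?ltr0n.
have cphi := central_limit (phi := phi) convex_pmf_weight knot_lt_support bU (fun x => c_bound _) phic.
have := cY f (L + eps) f_cont (fun v => c_bound _).
(* The minimizer has the mass of W, so the limits for Y and for the fluctuations coincide. *)
rewrite (_ : Rintegral _ _ _ = \int[Q]_w phi (Wvec p0 (U w))); last first.
  congr (fine _); apply: eq_integral => w _; congr (c _)%:E.
  by rewrite -(cone_min_sum (ZU w)); apply: eq_bigr => k _; rewrite mxE.
move=> cf; have gap : Ex n (fun l => f (\row_(i < s.+1) Y l i)) - Ex n (fun l => phi (empirical_fluct p0 n l)) @[n --> \oo] --> (0 : R).
  by rewrite -(subrr (\int[Q]_w phi (Wvec p0 (U w)))); exact: (cvgB cf cphi).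
(* Off the good event the gap may be negative, but (f - phi) / eps is at least - 2 (L + eps) / eps;
   C2 offsets this and leaves 1 for the indicator. *)
pose C2 := 1 + 2 * (L + eps) / eps.
have C20 : 0 <= C2 by rewrite addr_ge0// divr_ge0 ?ltW//; lra.
have ek0 : 0 < eps * kappa by rewrite mulr_gt0.
have L120 : 0 < L1 ^+ 2 by rewrite exprn_gt0//; lra.
near=> n.
have n0 : (0 < n)%N by near: n; exact: nbhs_infty_gt.
have n0R : 0 < n%:R :> R by rewrite ltr0n.
have h1 : Ex n (fun l => f (\row_(i < s.+1) Y l i)) - Ex n (fun l => phi (empirical_fluct p0 n l)) <= eps * kappa.
  have : `|0 - (Ex n (fun l => f (\row_(i < s.+1) Y l i)) - Ex n (fun l => phi (empirical_fluct p0 n l)))| <= eps * kappa.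
    by near: n; move/cvgrPdist_le : gap; exact.
  by rewrite sub0r normrN; apply: le_trans; exact: ler_norm.
have h2 : C2 * S.+1%:R / theta / n%:R <= kappa by near: n; exact: near_natV_le.
rewrite sub0r normrN ger0_norm; last first.
  rewrite -(expect_cst 0 (weight_nseq (n := n) convex_pmf_weight)).
  by apply: ler_iid_expect => l _ _; rewrite ler0n.
(* A pointwise majorant of the indicator of a gap above eps: the first term reaches 1 when the
   fluctuations are moderate, the other two take over off the good event and for fluctuations beyond
   L1. *)
apply: le_trans (ler_iid_expect (H' := fun l => eps^-1 * (f (\row_(i < s.+1) Y l i) - phi (empirical_fluct p0 n l)) +
  C2 * ((theta * n%:R)^-1 * (\sum_(k < S.+1) fluct l k ^+ 2)) + (L1 ^+ 2)^-1 * \sum_(k < s.+1) fluct l k ^+ 2) _) _; last first.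
  rewrite /iid_expect !expectD !expectZ expectB -!/(iid_expect _ _ _ _).
  rewrite (_ : e = kappa + kappa + kappa); last by rewrite /kappa; field.
  rewrite !lerD//.
  - by rewrite mulrC ler_pdivrMr// [kappa * _]mulrC.
  - rewrite mulrCA mulrC ler_pdivrMr ?mulr_gt0//.
    apply: le_trans (ler_wpM2l C20 (iid_expect_fluct_sqr n0 (leqnn _))) _.
    by move: h2; rewrite ler_pdivrMr// ler_pdivrMr// -mulrA [n%:R * _]mulrC.
  - rewrite mulrC ler_pdivrMr//.
    apply: le_trans (iid_expect_fluct_sqr n0 knot_lt_support) _.
    by rewrite -ler_pdivrMr.
move=> l sl al; rewrite -{1}sl.
have SA0 m : 0 <= \sum_(k < m) fluct l k ^+ 2 by apply: sumr_ge0 => k _; exact: sqr_ge0.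
have t2 : 0 <= C2 * ((theta * n%:R)^-1 * (\sum_(k < S.+1) fluct l k ^+ 2)).
  by rewrite mulr_ge0// mulr_ge0// invr_ge0 mulr_ge0 ?ltW.
have t3 : 0 <= (L1 ^+ 2)^-1 * \sum_(k < s.+1) fluct l k ^+ 2 by rewrite mulr_ge0// invr_ge0 ltW.
have b1 (b : bool) : b%:R <= 1 :> R by case: b; rewrite ?mulr1n ?mulr0n.
have [small2|big2] := leP (\sum_(k < S.+1) fluct l k ^+ 2) (theta * n%:R); last first.
  have r1 : 1 <= (theta * n%:R)^-1 * (\sum_(k < S.+1) fluct l k ^+ 2).
    by rewrite mulrC ler_pdivlMr ?mulr_gt0// mul1r ltW.
  have r2 : - (2 * (L + eps) / eps) <= eps^-1 * (f (\row_i Y l i) - phi (fluct l)).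
    rewrite -mulNr mulrC ler_pM2l ?invr_gt0//.
    have : `|phi (fluct l)| <= L + eps by exact: c_bound.
    have : `|f (\row_i Y l i)| <= L + eps by exact: c_bound.
    by rewrite !ler_norml => /andP[? ?] /andP[? ?]; lra.
  apply: le_trans (b1 _) _.
  have : C2 <= C2 * ((theta * n%:R)^-1 * (\sum_(k < S.+1) fluct l k ^+ 2)) by rewrite ler_peMr.
  by move: r2 t3; rewrite {1}/C2; lra.
have [V0 _] := Ygood al (etrans (congr1 _ sl) n0) (eq_ind_r (fun m => _ <= theta * m%:R) small2 sl).
have fE : f (\row_i Y l i) = c (\sum_(k < s.+1) fluct l k + V l).
  by rewrite /V addrC subrK; congr c; apply: eq_bigr => k _; rewrite mxE.
have r1 : 0 <= eps^-1 * (f (\row_i Y l i) - phi (fluct l)).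
  apply: mulr_ge0; first by rewrite invr_ge0 ltW.
  by rewrite subr_ge0 fE; apply: ler_clip; rewrite lerDl.
have [small3|big3] := leP (\sum_(k < s.+1) fluct l k ^+ 2) (L1 ^+ 2); last first.
  apply: le_trans (b1 _) _.
  rewrite -[leLHS]add0r lerD ?addr_ge0//.
  by rewrite mulrC ler_pdivlMr// mul1r ltW.
have [gapV|_] := ltP eps `|V l|; last by rewrite mulr0n !addr_ge0.
rewrite ger0_norm// in gapV.
rewrite mulr1n -[leLHS]addr0 -[leLHS]addr0 !lerD//.
rewrite mulrC ler_pdivlMr// mul1r.
have : `|\sum_(k < s.+1) fluct l k| <= L.
  apply: le_trans (ler_norm_sum _ _ _) _.
  apply: (@le_trans _ _ (\sum_(k < s.+1) L1)); last by rewrite sumr_const card_ord -[leLHS]mulr_natl.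
  apply: ler_sum => k _; apply: norm_le_sum_sqr (ltn_ord k) => //.
rewrite ler_norml => /andP[a1 a2].
have phiE : phi (fluct l) = \sum_(k < s.+1) fluct l k.
  by rewrite /phi /c clip_id// a1 (le_trans a2)// lerDl ltW.
have := ler_clip (- L) (L + eps) (lerD (lexx (\sum_(k < s.+1) fluct l k)) (ltW gapV)).
rewrite clip_id; last by rewrite lerD2r a2 andbT (le_trans a1)// lerDl ltW.
by rewrite fE phiE lerBrDl.
Unshelve. all: by end_near. Qed.

End Reduction.

(** The formulas over words hold for n >= 1 only, since the estimator is specified only there; a
    limit does not see n = 0. *)
Lemma cvg_EFin_pos (R : realType) (u : nat -> \bar R) (a : nat -> R) (l : R) :
  (forall n, (0 < n)%N -> u n = (a n)%:E) -> (u @ \oo --> l%:E) <-> (a @ \oo --> l).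
Proof.
move=> ua.
have e1 : {near \oo, u =1 EFin \o a} by near=> n; apply: ua; near: n; exact: nbhs_infty_gt.
have e2 : {near \oo, EFin \o a =1 u}.
  by near=> n; apply/esym/ua; near: n; exact: nbhs_infty_gt.
split=> h.
  have : EFin \o a @ \oo --> l%:E by apply: cvg_trans h; exact: near_eq_cvg.
  by move/fine_cvgP => [_].
have : EFin \o a @ \oo --> l%:E by apply: cvg_EFin h; exact: nearW.
by apply: cvg_trans; exact: near_eq_cvg.
Unshelve. all: by end_near. Qed.

(** * The estimator as a function of the sample word *)

Section Empirical.
Variables (R : realType) (p0 : nat -> R) (S s : nat).
Hypothesis hp0 : convex_pmf_support p0 S.
Hypothesis hs : s \in knots p0 S.
Variables (d : measure_display) (T : measurableType d).
Variables (X : nat -> T -> nat) (phat : nat -> T -> nat -> R).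
Hypothesis phatP : forall n w, (1 <= n)%N -> is_LSE (emp_pmf R X n w) (phat n w).

Lemma emp_pmf_eq n w w' : (forall i, (i < n)%N -> X i w = X i w') ->
  emp_pmf R X n w = emp_pmf R X n w'.
Proof.
by move=> e; apply/funext => k; congr (_ / _); apply: eq_bigr => i _; rewrite e.
Qed.

Lemma phat_eq n w w' : (1 <= n)%N -> (forall i, (i < n)%N -> X i w = X i w') ->
  phat n w = phat n w'.
Proof.
move=> n1 e.
(* Outcomes of probability zero may have observations above S, so the support bound comes from the
   sample: no observation exceeds their sum. *)
apply: (@LSE_uniq _ (emp_pmf R X n w) _ _ (\sum_(i < n) X i w).+1); [|exact: phatP|].
  move=> k Kk; rewrite /emp_pmf big1 ?mul0r// => i _.
  rewrite (_ : (X i w == k) = false)//; apply: contraTF Kk => /eqP <-.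
  by rewrite -leqNgt (bigD1 i)//= leq_addr.
by rewrite (emp_pmf_eq e); exact: phatP.
Qed.

Variable om : seq nat -> T.
Hypothesis omP : forall l, all (fun x => x < S.+1)%N l -> cylinder X l (om l).

Lemma emp_pmf_sample l k : all (fun x => x < S.+1)%N l ->
  emp_pmf R X (size l) (om l) k = (\sum_(x <- l) (x == k)%:R) / (size l)%:R.
Proof.
move=> al; rewrite /emp_pmf (big_nth 0%N) big_mkord; congr (_ / _).
by apply: eq_bigr => i _; rewrite (omP al).
Qed.

Lemma emp_pmf_sample_supp l k : all (fun x => x < S.+1)%N l -> (S < k)%N ->
  emp_pmf R X (size l) (om l) k = 0.
Proof.
move=> al Sk; rewrite emp_pmf_sample// big_seq big1 ?mul0r// => x xl.
have xS := allP al _ xl; rewrite (_ : (x == k) = false)//.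
by apply: contraTF xS => /eqP ->; rewrite -leqNgt.
Qed.

Lemma empirical_fluctE l k : all (fun x => x < S.+1)%N l -> (0 < size l)%N ->
  Num.sqrt (size l)%:R * (emp_pmf R X (size l) (om l) k - p0 k) = empirical_fluct p0 (size l) l k.
Proof.
move=> al l0; rewrite emp_pmf_sample// /empirical_fluct sumrB big_const_seq count_predT iter_addr_0.
have r0 : 0 < Num.sqrt (size l)%:R :> R by rewrite sqrtr_gt0 ltr0n.
have e : (size l)%:R = Num.sqrt (size l)%:R * Num.sqrt (size l)%:R :> R by rewrite -expr2 sqr_sqrtr.
rewrite -[p0 k *+ _]mulr_natr.
move: r0 e; move: (\sum_(x <- l) _) => t; set r := Num.sqrt _; move: r (size l)%:R => r n r0 ->; field; lra.
Qed.

(** The rescaled estimation error as a function of the word, read off at the chosen outcome [om l],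
    with the length of the word as sample size. *)
Definition scaled_error l k := Num.sqrt (size l)%:R * (phat (size l) (om l) k - p0 k).

Lemma scaled_gapE l : all (fun x => x < S.+1)%N l -> (0 < size l)%N ->
  \sum_(k < s.+1) scaled_error l k - \sum_(k < s.+1) empirical_fluct p0 (size l) l k =
  Num.sqrt (size l)%:R * (Fcum (phat (size l) (om l)) s - Fcum (emp_pmf R X (size l) (om l)) s).
Proof.
move=> al l0; rewrite -sumrB /Fcum -sumrB mulr_sumr; apply: eq_bigr => k _.
by rewrite /scaled_error -empirical_fluctE//; ring.
Qed.

(** The good event in the scale of the fluctuations: their squares are n times the squared errors of
    the empirical pmf, hence the threshold theta n. *)
Lemma scaled_error_good : exists2 theta : R, 0 < theta & forall l,
  all (fun x => x < S.+1)%N l -> (0 < size l)%N ->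
  \sum_(k < S.+1) empirical_fluct p0 (size l) l k ^+ 2 <= theta * (size l)%:R ->
  0 <= \sum_(k < s.+1) scaled_error l k - \sum_(k < s.+1) empirical_fluct p0 (size l) l k /\
  forall g, cone_min (flat p0) s (empirical_fluct p0 (size l) l) g ->
    \sum_(k < s.+1) (scaled_error l k - g k) ^+ 2 <=
    (\sum_(k < s.+1) scaled_error l k - \sum_(k < s.+1) empirical_fluct p0 (size l) l k) ^+ 2.
Proof.
have [theta theta0 good] := good_event hp0 hs; exists theta => // l al l0 small.
have n0 : 0 < (size l)%:R :> R by rewrite ltr0n.
have r0 : 0 < Num.sqrt (size l)%:R :> R by rewrite sqrtr_gt0.
have qS k : (S < k)%N -> emp_pmf R X (size l) (om l) k = 0 by exact: emp_pmf_sample_supp.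
have fE : (fun k => Num.sqrt (size l)%:R * (emp_pmf R X (size l) (om l) k - p0 k)) =
    empirical_fluct p0 (size l) l by apply/funext => k; exact: empirical_fluctE.
have [|Ds H] := good _ _ _ r0 qS (phatP (om l) l0).
  rewrite -(ler_pM2r n0); apply: le_trans small; rewrite mulr_suml; apply: ler_sum => k _.
  by rewrite -empirical_fluctE// exprMn sqr_sqrtr ?ler0n// mulrC.
have gapE : \sum_(k < s.+1) scaled_error l k - \sum_(k < s.+1) empirical_fluct p0 (size l) l k =
    Num.sqrt (size l)%:R * \sum_(k < s.+1) (phat (size l) (om l) k - emp_pmf R X (size l) (om l) k).
  by rewrite scaled_gapE// /Fcum sumrB.
split; first by rewrite gapE mulr_ge0 ?(ltW r0)// (LSE_cumulative_ge hs qS (phatP (om l) l0)).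
by move=> g mg; rewrite gapE mulr_sumr; apply: H; rewrite fE.
Qed.

End Empirical.

Theorem theorem4 (R : realType) (p0 : nat -> R) (S s : nat) :
  convex_pmf_support p0 S ->
  s \in knots p0 S ->
  (* first two assertions: for each realization u of the Brownian bridge *)
  (forall (u : R -> R), bridge_path u ->
   forall ghat : nat -> R, is_min_CK p0 S (Wvec p0 u) ghat ->
     (exists g, is_min_CK_le p0 S s (Wvec p0 u) g /\
        forall h, is_min_CK_le p0 S s (Wvec p0 u) h -> eq_upto s h g) /\
     (forall g, is_min_CK_le p0 S s (Wvec p0 u) g ->
        (eq_upto s g ghat <-> \sum_(k < s.+1) ghat k = u (Fcum p0 s)))) /\
  (* third assertion *)
  (forall d (T : measurableType d) (P : probability T R) (X : nat -> T -> nat)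
          (phat : nat -> T -> nat -> R),
     iid_pmf P X p0 ->
     (forall n w, (1 <= n)%N -> is_LSE (emp_pmf R X n w) (phat n w)) ->
   forall d' (T' : measurableType d') (Q : probability T' R) (U : T' -> R -> R)
          (Z : T' -> nat -> R),
     brownian_bridge Q U ->
     (forall w', is_min_CK_le p0 S s (Wvec p0 (U w')) (Z w')) ->
     (cvg_in_dist P Q
        (fun n w => \row_(i < s.+1) (Num.sqrt (n%:R) * (phat n w i - p0 i)))
        (fun w' => \row_(i < s.+1) Z w' i)
      <->
      op_sqrt_n P (fun n w => Fcum (phat n w) s - Fcum (emp_pmf R X n w) s))).
Proof.
move=> hp0 hs; split; first by move=> u bu ghat; exact: first_part.
move=> d T P X phat Xiid phatP d' T' Q U Z bU Zmin.
have [_ pos _ sum1 _] := hp0.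
have [om omP] := exists_samples pos Xiid.
have [theta theta0 good] := scaled_error_good hp0 hs phatP omP.
have ZU w : cone_min (flat p0) s (Wvec p0 (U w)) (Z w) by apply/(is_min_CK_leP hs).
pose gap l : R := \sum_(k < s.+1) scaled_error p0 phat om l k - \sum_(k < s.+1) empirical_fluct p0 (size l) l k.
have intE (f : 'rV[R]_s.+1 -> R) (M : R) : (forall x, `|f x| <= M) -> forall n, (0 < n)%N ->
    (\int[P]_w (f (\row_(i < s.+1) (Num.sqrt n%:R * (phat n w i - p0 i))))%:E =
    (iid_expect S.+1 n p0 (fun l => f (\row_(i < s.+1) scaled_error p0 phat om l i)))%:E)%E.
  move=> fM n n0.
  rewrite (@integral_determined _ _ _ _ _ _ _ sum1 Xiid om omP n (fun w => f (\row_(i < s.+1) (Num.sqrt n%:R * (phat n w i - p0 i)))) M).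
  - by congr EFin; apply: eq_iid_expect => l sl al; rewrite /scaled_error sl.
  - by move=> w w' e; congr f; apply/rowP => i; rewrite !mxE (phat_eq phatP n0 e).
  - by move=> w; exact: fM.
have limE (f : 'rV[R]_s.+1 -> R) (M : R) : continuous f -> (forall x, `|f x| <= M) ->
    (\int[Q]_w (f (\row_(i < s.+1) Z w i))%:E = (\int[Q]_w f (\row_(i < s.+1) Z w i))%R%:E)%E.
  move=> cf fM; rewrite /Rintegral fineK//.
  exact: (integrable_fin_num measurableT (integrable_cone_min_comp hp0 hs bU ZU cf fM)).
have probE (eps : R) n : (0 < n)%N ->
    P [set w | eps < `|Num.sqrt n%:R * (Fcum (phat n w) s - Fcum (emp_pmf R X n w) s)|] =
    (iid_expect S.+1 n p0 (fun l => ((eps < `|gap l|)%R)%:R))%:E.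
  move=> n0; rewrite (prob_determined sum1 Xiid omP (n := n)).
    congr EFin; apply: eq_iid_expect => l sl al.
    have l0 : (0 < size l)%N by rewrite sl.
    rewrite indicE /gap (scaled_gapE _ _ _ omP)// sl; congr (GRing.natmul 1 (nat_of_bool _)).
    by apply/idP/idP => [/set_mem//|h]; exact: mem_set.
  move=> w w' e; rewrite !indicE; congr (GRing.natmul 1 (nat_of_bool _)).
  have pe := phat_eq phatP n0 e; have ee := @emp_pmf_eq R _ _ _ _ _ _ e.
  by apply/idP/idP => /set_mem /= h; apply: mem_set => /=; [rewrite -pe -ee|rewrite pe ee].
split=> [cY eps eps0|Vop f cf [M fM]].
  apply/(cvg_EFin_pos _ (probE eps)).
  apply: (small_gap_of_cvg hp0 hs theta0 good bU ZU _ eps0) => f M cf fM.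
  apply/(cvg_EFin_pos _ (intE f M fM)); rewrite -(limE f M)//.
  by apply: cY => //; exists M.
rewrite (limE f M)//; apply/(cvg_EFin_pos _ (intE f M fM)).
apply: (cvg_of_small_gap hp0 hs theta0 good bU ZU cf fM) => eps eps0.
by apply/(cvg_EFin_pos _ (probE eps)); exact: Vop.
Qed.
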